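(* Let $x_1, x_2, w$ be complex numbers. Then \begin{align*} & x_1f(x_1,x_2^{-1};w)-x_2f(x_2,x_1^{-1};w) -f(x_1,x_1^{-1}x_2^{-1};w)+x_2f(x_2,x_1;wx_1^{-1}) \\ &\quad -x_1f(x_1,x_2;wx_2^{-1})+f(x_2,x_1^{-1}x_2^{-1};w) +f(x_1,x_2x_1^{-1};wx_2^{-1})-f(x_2,x_1x_2^{-1};wx_1^{-1}) \\ &= \frac{1}{4}\left(x_1 - \frac{1}{x_1} \right) \ln x_2 -\frac{1}{4}\left( x_2 - \frac{1}{x_2}\right) \ln x_1 \\ &\quad + \frac{1}{2} \sum_{r=1}^{\infty}\sum_{n=1}^{\infty} \Bigg\{ \frac{x_2}{\sqrt{x_2^2n^2+r^2+w^2}}- \frac{x_1}{\sqrt{x_1^2n^2+r^2+w^2}} -\frac{x_1x_2}{\sqrt{x_2^2x_1^2 n^2+x_1^2r^2+w^2}}+\frac{1}{\sqrt{n^2+r^2x_1^2+w^2}} \\ &\qquad -\frac{1}{\sqrt{n^2+x_2^2r^2+w^2}}+ \frac{x_1x_2}{\sqrt{x_1^2x_2^2n^2+x_2^2r^2+w^2}} +\frac{x_1}{\sqrt{x_1^2 n^2+x_1^2x_2^2r^2+w^2}}-\frac{x_2}{\sqrt{x_2^2n^2+r^2x_1^2x_2^2+w^2}} \Bigg\}, \end{align*} provided that all the series involved are convergent.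
   Context: For complex $x, y, w$ define the double series \[ f(x,y;w) = \sum_{n=1}^{\infty}\sum_{r=1}^{\infty}\frac{1}{\sqrt{x^2n^2+r^2+w^2}\left( e^{2 \pi y\sqrt{x^2n^2+r^2+w^2}}-1\right)}, \] whenever it converges.
   Formalization: With principal roots throughout, the formula fails for some complex w; here √ is any square-root determination, principal for large arguments, assumed to satisfy √(x₁²Z)=x₁√Z for Z=x₂²n²+r²+w²/x₁² and likewise with x₁,x₂ exchanged; x₁,x₂≠0 and all summands of f are defined. *)

(* Defs.v *)
From Stdlib Require Export Reals.
From Coquelicot Require Export Coquelicot.
From Stdlib Require Import Lra Lia.

Open Scope R_scope.
Open Scope C_scope.

Definition Cexp (z : C) : C :=
  (exp (Re z) * cos (Im z), exp (Re z) * sin (Im z))%R.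

(* Principal argument, with values in ]-PI, PI] for [z <> 0]. *)
Definition Carg (z : C) : R :=
  if Rlt_dec (Im z) 0 then (- acos (Re z / Cmod z))%R
  else acos (Re z / Cmod z)%R.

Definition Cln (z : C) : C := (ln (Cmod z), Carg z).

Definition Csqrt (z : C) : C :=
  (sqrt (Cmod z) * cos (Carg z / 2), sqrt (Cmod z) * sin (Carg z / 2))%R.

Definition Csq (z : C) : C := z * z.
Notation "z ²" := (Csq z) (at level 1, format "z ²") : C_scope.

Definition NtoC (n : nat) : C := RtoC (INR n).

(* Series indexed from 1, and iterated double series
   sum_{m >= 1} (sum_{k >= 1} a m k). The sums are total functions, meaningful
   under [ex_Cseries1] and [ex_Cdseries]. *)
Definition ex_Cseries1 (a : nat -> C) : Prop :=
  exists l : C, is_series (fun k => a (S k)) l.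

Definition Cseries1 (a : nat -> C) : C :=
  (Series (fun k => Re (a (S k))), Series (fun k => Im (a (S k)))).

Definition ex_Cdseries (a : nat -> nat -> C) : Prop :=
  (forall m, (1 <= m)%nat -> ex_Cseries1 (a m)) /\
  ex_Cseries1 (fun m => Cseries1 (a m)).

Definition Cdseries (a : nat -> nat -> C) : C :=
  Cseries1 (fun m => Cseries1 (a m)).

(* Determinations of the complex square root. The principal root does not
   satisfy sqrt (a^2 z) = a * sqrt z in general, and the identity relates
   radicals that differ by such a factor; for complex [w] it is false, by
   finitely many terms with a wrong sign, if the principal root is imposed on
   every radical. So the radical sign stands for a determination [sq] that is
   principal near infinity, together with the explicit compatibility
   [sqrt_scales] on the radicands involved. [Csqrt] is a determination. *)
Definition sqrt_determination (sq : C -> C) : Prop :=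
  (forall z, sq z * sq z = z) /\
  exists M : R, forall z, (M < Cmod z)%R -> sq z = Csqrt z.

Definition radicand (x w : C) (n r : nat) : C :=
  x² * (NtoC n)² + (NtoC r)² + w².

Definition sqrt_scales (sq : C -> C) (a x w : C) : Prop :=
  forall n r, (1 <= n)%nat -> (1 <= r)%nat ->
    sq (a² * radicand x w n r) = a * sq (radicand x w n r).

Definition f_denom (sq : C -> C) (x y w : C) (n r : nat) : C :=
  sq (radicand x w n r) *
  (Cexp (RtoC (2 * PI) * y * sq (radicand x w n r)) - 1).

Definition f (sq : C -> C) (x y w : C) : C :=
  Cdseries (fun n r => 1 / f_denom sq x y w n r).

(* Inversion being total on [C], the summands are required to be defined. *)
Definition f_converges (sq : C -> C) (x y w : C) : Prop :=
  (forall n r, (1 <= n)%nat -> (1 <= r)%nat -> f_denom sq x y w n r <> 0) /\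
  ex_Cdseries (fun n r => 1 / f_denom sq x y w n r).

Definition rhs_term (sq : C -> C) (x1 x2 w : C) (r n : nat) : C :=
  x2 / sq (x2² * (NtoC n)² + (NtoC r)² + w²)
  - x1 / sq (x1² * (NtoC n)² + (NtoC r)² + w²)
  - x1 * x2 / sq (x2² * x1² * (NtoC n)² + x1² * (NtoC r)² + w²)
  + 1 / sq ((NtoC n)² + (NtoC r)² * x1² + w²)
  - 1 / sq ((NtoC n)² + x2² * (NtoC r)² + w²)
  + x1 * x2 / sq (x1² * x2² * (NtoC n)² + x2² * (NtoC r)² + w²)
  + x1 / sq (x1² * (NtoC n)² + x1² * x2² * (NtoC r)² + w²)
  - x2 / sq (x2² * (NtoC n)² + (NtoC r)² * x1² * x2² + w²).

Lemma Cseries1_correct (a : nat -> C) :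
  ex_Cseries1 a -> is_series (fun k => a (S k)) (Cseries1 a).
Proof.
intros [l Hl].
assert (Hs : forall (b : nat -> C) n,
  sum_n b n = (sum_n (fun k => Re (b k)) n, sum_n (fun k => Im (b k)) n)).
{ intros b n; induction n as [|n IH].
  - rewrite !sum_O; now destruct (b 0%nat).
  - now rewrite !sum_Sn, IH. }
assert (H1 : is_series (fun k => Re (a (S k))) (Re l)).
{ intros P HP.
  destruct HP as [e He].
  destruct (Hl (fun z : C => P (Re z))) as [N HN].
  - exists e; intros z Hz; apply He, Hz.
  - exists N; intros n Hn; specialize (HN n Hn); cbv beta in HN.
    rewrite (Hs (fun k => a (S k))) in HN; exact HN. }
assert (H2 : is_series (fun k => Im (a (S k))) (Im l)).
{ intros P HP.
  destruct HP as [e He].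
  destruct (Hl (fun z : C => P (Im z))) as [N HN].
  - exists e; intros z Hz; apply He, Hz.
  - exists N; intros n Hn; specialize (HN n Hn); cbv beta in HN.
    rewrite (Hs (fun k => a (S k))) in HN; exact HN. }
unfold Cseries1.
rewrite (is_series_unique _ _ H1), (is_series_unique _ _ H2).
now destruct l.
Qed.

Lemma Csqrt_determination : sqrt_determination Csqrt.
Proof.
split; [|now exists 0%R].
intros z.
assert (Hp : (Cmod z * cos (Carg z) = Re z /\ Cmod z * sin (Carg z) = Im z)%R).
{ destruct (Ceq_dec z 0) as [->|Hz].
  { rewrite Cmod_0; simpl; split; ring. }
  assert (Hm := Cmod_gt_0 z); destruct Hm as [Hm _]; specialize (Hm Hz).
  assert (Hq : (Cmod z * Cmod z = Re z * Re z + Im z * Im z)%R).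
  { unfold Cmod; rewrite sqrt_sqrt; unfold Re, Im; [ring|nra]. }
  assert (Hb : (-1 <= Re z / Cmod z <= 1)%R).
  { assert (Re z <= Cmod z /\ - Cmod z <= Re z)%R by (split; nra).
    split; [apply Rmult_le_reg_r with (Cmod z)|apply Rmult_le_reg_r with (Cmod z)];
    auto; unfold Rdiv; rewrite Rmult_assoc, Rinv_l; lra. }
  assert (Hsn : (Cmod z * sin (acos (Re z / Cmod z)) = Rabs (Im z))%R).
  { rewrite sin_acos by assumption.
    apply Rsqr_inj.
    - apply Rmult_le_pos; [lra|apply sqrt_pos].
    - apply Rabs_pos.
    - rewrite <- Rsqr_abs, Rsqr_mult, Rsqr_sqrt.
      + unfold Rsqr. replace (Im z * Im z)%R with (Cmod z * Cmod z - Re z * Re z)%R by lra.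
        field; lra.
      + unfold Rsqr; nra. }
  unfold Carg; destruct (Rlt_dec (Im z) 0).
  - rewrite cos_neg, sin_neg, cos_acos by assumption; split; [field; lra|].
    rewrite Rabs_left in Hsn by assumption; lra.
  - rewrite cos_acos by assumption; split; [field; lra|].
    rewrite Rabs_right in Hsn by lra; exact Hsn. }
destruct Hp as [Hc Hs].
assert (Hr := sqrt_sqrt (Cmod z) (Cmod_ge_0 z)).
replace (Carg z) with (2 * (Carg z / 2))%R in Hc, Hs by field.
rewrite cos_2a in Hc; rewrite sin_2a in Hs.
unfold Csqrt, Cmult; cbn [fst snd].
destruct z as [a b]; unfold Re, Im in *; cbn [fst snd] in *.
set (s := sqrt (Cmod (a, b))) in *; rewrite <- Hr in Hc, Hs; f_equal; nra.
Qed.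

(* Main.v *)
Require Import Defs.
From Stdlib Require Import Lra Lia Psatz ZArith Classical.

(** Since [1 / (s (e^{2 pi y s} - 1)) + 1 / (2 s) = coth (pi y s) / (2 s)], the
    partial fractions of [coth] turn each of the eight double series, once
    completed by the corresponding term of the right-hand side, into a sum over
    [n, r >= 1] and [k] in [Z] of [x1 x2 / (2 pi)] times the inverse of a
    quadratic form plus [w^2].  The forms agree in pairs up to the roles of [n]
    and [k].  For fixed [r], the terms with [k <> 0] cancel by Fubini, because
    the difference of two such sums with different constants is absolutely
    convergent.  The terms with [k = 0] also match in pairs, but with [n] and
    [r] exchanged in a conditionally convergent sum: exchanging the order of
    summation of [1 / (al^2 n^2 + r^2 + c)] costs [(pi / (2 al)) ln al], which
    produces the logarithms.

    Convergence of the series forces [x1], [x2], [x1 x2] and [x1 / x2] to lie in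
    the open right half-plane, where all the estimates hold. *)

(** * Finite sums and series indexed from 1 *)

(** Each [f] is an iterated sum, and the right-hand side is not known to converge absolutely, so
    nothing can be rearranged globally: the eight series must first be brought to one outer index,
    the [r] of the right-hand side. Four of them are therefore summed by columns, which the
    exponential decay of their terms permits. This decay is what the half-planes are for: with [x],
    [y] and [x * y] in the right half-plane, the root stays near the cone spanned by [x] and [1],
    and its product with [y] has a real part of order [n + r]. The half-planes themselves are
    visible in the row [n = 1], where the root is [r + O(1 / r)]: for [Re y < 0] the terms are close
    to [- 1 / r], and for [Re y = 0] infinitely many stay away from 0. The logarithm is obtained
    without integrals. The antisymmetrised sum with [c = 0] vanishes at [al = 1], and its derivative
    with respect to [ln al] consists of inverse squares of linear forms, which telescope. Rectangles
    of sides [R0] and [N] with [R0 * R0 <= N] make what is left at the far end as small as the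
    telescoping errors. *)

Fixpoint csum (a : nat -> C) (n : nat) : C :=
  match n with
  | O => 0
  | S m => csum a m + a (S m)
  end.

Lemma csum_S (a : nat -> C) (n : nat) : csum a (S n) = csum a n + a (S n).
Proof. reflexivity. Qed.

Lemma csum_ext (a b : nat -> C) (n : nat) :
  (forall k, (1 <= k <= n)%nat -> a k = b k) -> csum a n = csum b n.
Proof.
induction n as [|n IH]; intros H; [reflexivity|].
simpl; rewrite IH, (H (S n)); [reflexivity|lia|intros k Hk; apply H; lia].
Qed.

Lemma csum_plus (a b : nat -> C) (n : nat) :
  csum (fun k => a k + b k) n = csum a n + csum b n.
Proof. induction n as [|n IH]; simpl; [ring|rewrite IH; ring]. Qed.

Lemma csum_minus (a b : nat -> C) (n : nat) :
  csum (fun k => a k - b k) n = csum a n - csum b n.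
Proof. induction n as [|n IH]; simpl; [ring|rewrite IH; ring]. Qed.

Lemma csum_scal (c : C) (a : nat -> C) (n : nat) :
  csum (fun k => c * a k) n = c * csum a n.
Proof. induction n as [|n IH]; simpl; [ring|rewrite IH; ring]. Qed.

Lemma csum_swap (a : nat -> nat -> C) (m n : nat) :
  csum (fun i => csum (fun j => a i j) m) n
  = csum (fun j => csum (fun i => a i j) n) m.
Proof.
induction n as [|n IH]; simpl.
- induction m as [|m IHm]; simpl; [reflexivity|rewrite <- IHm; ring].
- now rewrite IH, csum_plus.
Qed.

Lemma INR_ge_1 (n : nat) : (1 <= n)%nat -> (1 <= INR n)%R.
Proof. intros H; apply (le_INR 1 n H). Qed.

Lemma Cmod_minus_sym (a b : C) : Cmod (a - b) = Cmod (b - a).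
Proof. rewrite <- Cmod_opp; f_equal; ring. Qed.

Lemma Cmod_minus_le (a b : C) : (Cmod (a - b) <= Cmod a + Cmod b)%R.
Proof.
eapply Rle_trans; [apply Cmod_triangle|rewrite Cmod_opp; lra].
Qed.

Lemma Cmod_ge_minus (a b : C) : (Cmod a - Cmod b <= Cmod (a + b))%R.
Proof.
assert (H := Cmod_minus_le (a + b) b).
replace (a + b - b) with a in H by ring; lra.
Qed.

Lemma Cmod_dist (a b c : C) : (Cmod (a - c) <= Cmod (a - b) + Cmod (b - c))%R.
Proof.
replace (a - c) with ((a - b) + (b - c)) by ring; apply Cmod_triangle.
Qed.

Lemma Cmod_le_Re_Im (z : C) : (Cmod z <= Rabs (Re z) + Rabs (Im z))%R.
Proof.
assert (H1 := Rabs_pos (Re z)); assert (H2 := Rabs_pos (Im z)).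
assert (H := Cmod2_alt z); rewrite <- (pow2_abs (Re z)), <- (pow2_abs (Im z)) in H.
assert (H3 := Cmod_ge_0 z); nra.
Qed.

Lemma im_le_Cmod (z : C) : (Rabs (Im z) <= Cmod z)%R.
Proof. eapply Rle_trans; [apply Rmax_r|apply Rmax_Cmod]. Qed.

Lemma RtoC_neq_0 (x : R) : x <> 0%R -> RtoC x <> 0.
Proof. intros H E; apply H; now apply RtoC_inj. Qed.

Lemma Cmod_NtoC (n : nat) : Cmod (NtoC n) = INR n.
Proof. unfold NtoC; rewrite Cmod_R; apply Rabs_right, Rle_ge, pos_INR. Qed.

Lemma NtoC_S (n : nat) : NtoC (S n) = NtoC n + 1.
Proof. unfold NtoC; now rewrite S_INR, RtoC_plus. Qed.

Lemma Cmod_csum_le (a : nat -> C) (n : nat) (B : R) :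
  (forall k, (1 <= k <= n)%nat -> (Cmod (a k) <= B)%R) ->
  (Cmod (csum a n) <= INR n * B)%R.
Proof.
induction n as [|n IH]; intros H; simpl csum.
- rewrite Cmod_0; simpl; lra.
- rewrite S_INR; eapply Rle_trans; [apply Cmod_triangle|].
  assert (H1 : (Cmod (csum a n) <= INR n * B)%R) by (apply IH; intros; apply H; lia).
  assert (H2 := H (S n) ltac:(lia)); lra.
Qed.

(** Since [1 / k²] is at most [1 / (k - 1) - 1 / k], the tail telescopes. The term [- / INR n] is
    kept for the induction. *)
Lemma Cmod_csum_tail (a : nat -> C) (B : R) (m n : nat) :
  (1 <= m <= n)%nat -> (0 <= B)%R ->
  (forall k, (m < k <= n)%nat -> (Cmod (a k) <= B / (INR k)²)%R) ->
  (Cmod (csum a n - csum a m) <= B * (/ INR m - / INR n))%R.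
Proof.
intros [Hm Hmn] HB; induction Hmn as [|n Hmn IH]; intros H.
- replace (csum a m - csum a m) with (RtoC 0) by ring; rewrite Cmod_0; lra.
- assert (IH' := IH (fun k Hk => H k ltac:(lia))).
  assert (Hn := H (S n) ltac:(lia)).
  assert (H1 : (1 <= INR n)%R) by (apply INR_ge_1; lia).
  simpl csum.
  replace (csum a n + a (S n) - csum a m) with ((csum a n - csum a m) + a (S n)) by ring.
  eapply Rle_trans; [apply Cmod_triangle|].
  assert (H2 : (B / (INR (S n))² <= B * (/ INR n - / INR (S n)))%R).
  { unfold Rdiv; apply Rmult_le_compat_l; [assumption|].
    rewrite S_INR; unfold Rsqr.
    replace (/ INR n - / (INR n + 1))%R with (/ (INR n * (INR n + 1)))%R by (field; lra).
    apply Rinv_le_contravar; nra. }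
  lra.
Qed.

(** * Limits of complex sequences *)

Definition Clim (s : nat -> C) (l : C) : Prop :=
  forall eps, (0 < eps)%R ->
    exists N, forall n, (N <= n)%nat -> (Cmod (s n - l) < eps)%R.

Lemma Clim_const (c : C) : Clim (fun _ => c) c.
Proof.
intros eps He; exists 0%nat; intros n _.
replace (c - c) with (RtoC 0) by ring; now rewrite Cmod_0.
Qed.

Lemma Clim_ext (s t : nat -> C) (l : C) : (forall n, s n = t n) -> Clim s l -> Clim t l.
Proof.
intros H Hs eps He; destruct (Hs eps He) as [N HN]; exists N; intros n Hn.
rewrite <- H; now apply HN.
Qed.

Lemma Clim_plus (s t : nat -> C) (l l' : C) :
  Clim s l -> Clim t l' -> Clim (fun n => s n + t n) (l + l').
Proof.
intros Hs Ht eps He.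
destruct (Hs (eps / 2)%R) as [N HN]; [lra|].
destruct (Ht (eps / 2)%R) as [N' HN']; [lra|].
exists (max N N'); intros n Hn.
replace (s n + t n - (l + l')) with ((s n - l) + (t n - l')) by ring.
eapply Rle_lt_trans; [apply Cmod_triangle|].
specialize (HN n ltac:(lia)); specialize (HN' n ltac:(lia)); lra.
Qed.

Lemma Clim_mult (s t : nat -> C) (l l' : C) :
  Clim s l -> Clim t l' -> Clim (fun n => s n * t n) (l * l').
Proof.
intros Hs Ht eps He.
assert (H1 := Cmod_ge_0 l); assert (H2 := Cmod_ge_0 l').
set (B := (Cmod l + Cmod l' + 1)%R).
assert (HB : (0 < B)%R) by (unfold B; lra).
set (d := Rmin 1 (eps / B)).
assert (Hd : (0 < d)%R) by (apply Rmin_pos; [lra|now apply Rdiv_lt_0_compat]).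
destruct (Hs d Hd) as [N HN]; destruct (Ht d Hd) as [N' HN'].
exists (max N N'); intros n Hn.
specialize (HN n ltac:(lia)); specialize (HN' n ltac:(lia)).
replace (s n * t n - l * l')
  with ((s n - l) * (t n - l') + (s n - l) * l' + l * (t n - l')) by ring.
eapply Rle_lt_trans; [apply Cmod_triangle|].
eapply Rle_lt_trans; [apply Rplus_le_compat_r, Cmod_triangle|].
rewrite !Cmod_mult.
assert (Hd1 : (d <= 1)%R) by apply Rmin_l.
assert (Hd2 : (d * B <= eps)%R).
{ apply Rle_trans with (eps / B * B)%R; [apply Rmult_le_compat_r; [lra|apply Rmin_r]|].
  apply Req_le; field; lra. }
assert (H3 := Cmod_ge_0 (s n - l)); assert (H4 := Cmod_ge_0 (t n - l')).
unfold B in Hd2.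
destruct (Req_dec (Cmod (s n - l)) 0) as [E|E].
- rewrite E in *; nra.
- nra.
Qed.

Lemma Clim_inv (s : nat -> C) (l : C) : l <> 0 -> Clim s l -> Clim (fun n => / s n) (/ l).
Proof.
intros Hl Hs eps He.
assert (Hm : (0 < Cmod l)%R) by now apply Cmod_gt_0.
set (d := Rmin (Cmod l / 2) (eps * (Cmod l * Cmod l) / 2)).
assert (Hd : (0 < d)%R).
{ apply Rmin_pos; [lra|].
  assert (0 < Cmod l * Cmod l)%R by nra; nra. }
destruct (Hs d Hd) as [N HN]; exists N; intros n Hn; specialize (HN n Hn).
assert (Hd1 : (d <= Cmod l / 2)%R) by apply Rmin_l.
assert (Hd2 : (d <= eps * (Cmod l * Cmod l) / 2)%R) by apply Rmin_r.
assert (Hsn : (Cmod l / 2 <= Cmod (s n))%R).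
{ assert (H := Cmod_ge_minus l (s n - l)).
  replace (l + (s n - l)) with (s n) in H by ring; lra. }
assert (Hs0 : s n <> 0) by (apply Cmod_gt_0; lra).
replace (/ s n - / l) with ((l - s n) / (s n * l)) by (field; auto).
rewrite Cmod_div, Cmod_mult, Cmod_minus_sym by now apply Cmult_neq_0.
apply Rmult_lt_reg_r with (Cmod (s n) * Cmod l)%R; [nra|].
replace (Cmod (s n - l) / (Cmod (s n) * Cmod l) * (Cmod (s n) * Cmod l))%R
  with (Cmod (s n - l)) by (field; lra).
apply Rlt_le_trans with d; [exact HN|].
apply Rle_trans with (eps * (Cmod l * Cmod l) / 2)%R; [exact Hd2|].
assert (Cmod l / 2 * Cmod l <= Cmod (s n) * Cmod l)%R by (apply Rmult_le_compat_r; lra).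
nra.
Qed.

Lemma Clim_bound (s : nat -> C) (l x : C) (B : R) (N : nat) :
  Clim s l -> (forall n, (N <= n)%nat -> (Cmod (s n - x) <= B)%R) ->
  (Cmod (l - x) <= B)%R.
Proof.
intros Hs HB; destruct (Rle_or_lt (Cmod (l - x)) B) as [|Hl]; [assumption|exfalso].
destruct (Hs (Cmod (l - x) - B)%R) as [N' HN']; [lra|].
specialize (HN' (max N N') ltac:(lia)); specialize (HB (max N N') ltac:(lia)).
assert (H := Cmod_dist l (s (max N N')) x).
rewrite (Cmod_minus_sym l (s _)) in H; lra.
Qed.

(** * Complex series indexed from 1 *)

Definition Cser (a : nat -> C) (l : C) : Prop := Clim (csum a) l.

Lemma Cser_ext (a b : nat -> C) (l : C) :
  (forall k, (1 <= k)%nat -> a k = b k) -> Cser a l -> Cser b l.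
Proof.
intros H Ha eps He; destruct (Ha eps He) as [N HN]; exists N; intros n Hn.
rewrite <- (csum_ext a b); [now apply HN|intros; apply H; lia].
Qed.

Lemma Cser_plus (a b : nat -> C) (l l' : C) :
  Cser a l -> Cser b l' -> Cser (fun k => a k + b k) (l + l').
Proof.
intros Ha Hb; apply (Clim_ext (fun n => csum a n + csum b n)).
- intros n; symmetry; apply csum_plus.
- now apply Clim_plus.
Qed.

Lemma Cser_scal (c : C) (a : nat -> C) (l : C) :
  Cser a l -> Cser (fun k => c * a k) (c * l).
Proof.
intros Ha; apply (Clim_ext (fun n => c * csum a n)).
- intros n; symmetry; apply csum_scal.
- apply Clim_mult; [apply Clim_const|exact Ha].
Qed.

Lemma Cser_minus (a b : nat -> C) (l l' : C) :
  Cser a l -> Cser b l' -> Cser (fun k => a k - b k) (l - l').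
Proof.
intros Ha Hb; replace (l - l') with (l + - (1) * l') by ring.
eapply Cser_ext; [|exact (Cser_plus _ _ _ _ Ha (Cser_scal (- (1)) _ _ Hb))].
intros k _; cbv beta; ring.
Qed.

Lemma Cser_csum (a : nat -> nat -> C) (v : nat -> C) (K : nat) :
  (forall k, (1 <= k <= K)%nat -> Cser (fun n => a n k) (v k)) ->
  Cser (fun n => csum (a n) K) (csum v K).
Proof.
induction K as [|K IH]; intros H; simpl.
- intros eps He; exists 0%nat; intros n _.
  replace (csum (fun _ => RtoC 0) n) with (RtoC 0).
  + replace (0 - 0) with (RtoC 0) by ring; now rewrite Cmod_0.
  + induction n as [|n IHn]; simpl; [reflexivity|rewrite <- IHn; ring].
- apply (Cser_plus (fun n => csum (a n) K) (fun n => a n (S K))).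
  + apply IH; intros; apply H; lia.
  + apply H; lia.
Qed.

Lemma Cser_bound (a : nat -> C) (l : C) (B : R) (N : nat) :
  Cser a l -> (forall n, (N <= n)%nat -> (Cmod (csum a n) <= B)%R) -> (Cmod l <= B)%R.
Proof.
intros Ha HB; replace l with (l - 0) by ring.
apply (Clim_bound _ _ _ _ N Ha); intros n Hn.
replace (csum a n - 0) with (csum a n) by ring; now apply HB.
Qed.

Lemma archimed_div (B eps : R) : (0 < eps)%R ->
  exists N, (1 <= N)%nat /\ forall n, (N <= n)%nat -> (B / INR n < eps)%R.
Proof.
intros He.
destruct (INR_unbounded (B / eps)) as [N HN]; exists (S N); split; [lia|].
intros n Hn.
assert (H : (B / eps < INR n)%R).
{ apply Rlt_le_trans with (INR N); [exact HN|apply le_INR; lia]. }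
assert (H1 : (1 <= INR n)%R) by (apply INR_ge_1; lia).
apply Rmult_lt_reg_r with (INR n); [lra|].
unfold Rdiv; rewrite Rmult_assoc, Rinv_l, Rmult_1_r by lra.
apply Rmult_lt_reg_r with (/ eps)%R; [now apply Rinv_0_lt_compat|].
replace (eps * INR n * / eps)%R with (INR n) by (field; lra); exact H.
Qed.

Lemma Cser_of_rate (a : nat -> C) (l : C) (B : R) (N : nat) :
  (forall n, (N <= n)%nat -> (Cmod (csum a n - l) <= B / INR n)%R) -> Cser a l.
Proof.
intros H eps He; destruct (archimed_div B eps He) as [N' [_ HN']].
exists (max N N'); intros n Hn.
eapply Rle_lt_trans; [apply H; lia|apply HN'; lia].
Qed.

Lemma sum_n_csum (a : nat -> C) (n : nat) :
  sum_n (fun k => a (S k)) n = csum a (S n).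
Proof.
induction n as [|n IH].
- rewrite sum_O; simpl; now rewrite Cplus_0_l.
- now rewrite sum_Sn, IH.
Qed.

Lemma sum_n_Re_csum (a : nat -> C) (n : nat) :
  sum_n (fun k => Re (a (S k))) n = Re (csum a (S n)).
Proof.
induction n as [|n IH].
- rewrite sum_O; simpl csum; now rewrite Cplus_0_l.
- now rewrite sum_Sn, IH.
Qed.

Lemma sum_n_Im_csum (a : nat -> C) (n : nat) :
  sum_n (fun k => Im (a (S k))) n = Im (csum a (S n)).
Proof.
induction n as [|n IH].
- rewrite sum_O; simpl csum; now rewrite Cplus_0_l.
- now rewrite sum_Sn, IH.
Qed.

(** Together with [ex_Cseries1_Cser], this passes between the total function [Cseries1], defined by
    components, and epsilon estimates on the modulus. *)
Lemma Cser_Cseries1 (a : nat -> C) (l : C) : Cser a l -> Cseries1 a = l.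
Proof.
intros H; unfold Cseries1.
rewrite (is_series_unique (fun k => Re (a (S k))) (Re l)),
        (is_series_unique (fun k => Im (a (S k))) (Im l));
  [now destruct l| |];
  intros P [e He]; destruct (H e (cond_pos e)) as [N HN];
  exists N; intros n Hn; apply He;
  specialize (HN (S n) ltac:(lia)).
- rewrite sum_n_Im_csum.
  change (Rabs (Im (csum a (S n)) - Im l) < e)%R.
  eapply Rle_lt_trans; [exact (im_le_Cmod (csum a (S n) - l))|exact HN].
- rewrite sum_n_Re_csum.
  change (Rabs (Re (csum a (S n)) - Re l) < e)%R.
  eapply Rle_lt_trans; [exact (re_le_Cmod (csum a (S n) - l))|exact HN].
Qed.

Lemma ex_Cseries1_Cser (a : nat -> C) : ex_Cseries1 a -> Cser a (Cseries1 a).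
Proof.
intros H eps He.
assert (He2 : (0 < eps / 2)%R) by lra.
destruct (Cseries1_correct a H (fun z => (Cmod (z - Cseries1 a) < eps)%R)) as [N HN].
- exists (mkposreal _ He2); intros z [Hz1 Hz2].
  change (Rabs (fst z - fst (Cseries1 a)) < eps / 2)%R in Hz1.
  change (Rabs (snd z - snd (Cseries1 a)) < eps / 2)%R in Hz2.
  eapply Rle_lt_trans; [apply Cmod_le_Re_Im|].
  change (Rabs (fst z - fst (Cseries1 a)) + Rabs (snd z - snd (Cseries1 a)) < eps)%R.
  lra.
- exists (S N); intros [|n] Hn; [lia|].
  specialize (HN n ltac:(lia)); cbv beta in HN.
  now rewrite sum_n_csum in HN.
Qed.

Lemma Cser_unique (a : nat -> C) (l l' : C) : Cser a l -> Cser a l' -> l = l'.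
Proof. intros H H'; rewrite <- (Cser_Cseries1 _ _ H); now apply Cser_Cseries1. Qed.

(** The telescoped tail [B / m] makes the partial sums Cauchy, and both components converge by
    completeness of the reals. *)
Lemma Cser_abs (a : nat -> C) (B : R) : (0 <= B)%R ->
  (forall k, (1 <= k)%nat -> (Cmod (a k) <= B / (INR k)²)%R) ->
  exists l, Cser a l.
Proof.
intros HB Ha.
assert (Ht : forall m n, (1 <= m <= n)%nat -> (Cmod (csum a n - csum a m) <= B / INR m)%R).
{ intros m n Hmn.
  eapply Rle_trans; [apply Cmod_csum_tail with (B := B)|].
  - exact Hmn.
  - exact HB.
  - intros k Hk; apply Ha; lia.
  - assert (H1 : (0 < / INR n)%R)
      by (apply Rinv_0_lt_compat; assert (1 <= INR n)%R by (apply INR_ge_1; lia); lra).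
    unfold Rdiv; nra. }
assert (Hc : forall eps, (0 < eps)%R -> exists N, forall n m, (N <= n)%nat -> (N <= m)%nat ->
  (Cmod (csum a n - csum a m) < eps)%R).
{ intros eps He; destruct (archimed_div B eps He) as [N [HN1 HN]]; exists N.
  intros n m Hn Hm; destruct (Nat.le_gt_cases n m).
  - rewrite Cmod_minus_sym; eapply Rle_lt_trans; [apply Ht; lia|apply HN; lia].
  - eapply Rle_lt_trans; [apply Ht; lia|apply HN; lia]. }
assert (Hr : {l : R | Un_cv (fun n => Re (csum a n)) l}).
{ apply Rcomplete.R_complete; intros eps He; destruct (Hc eps He) as [N HN]; exists N.
  intros n m Hn Hm; unfold Rdist.
  eapply Rle_lt_trans; [exact (re_le_Cmod (csum a n - csum a m))|apply HN; lia]. }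
assert (Hi : {l : R | Un_cv (fun n => Im (csum a n)) l}).
{ apply Rcomplete.R_complete; intros eps He; destruct (Hc eps He) as [N HN]; exists N.
  intros n m Hn Hm; unfold Rdist.
  eapply Rle_lt_trans; [exact (im_le_Cmod (csum a n - csum a m))|apply HN; lia]. }
destruct Hr as [lr Hr], Hi as [li Hi]; exists (lr, li); intros eps He.
destruct (Hr (eps / 2)%R) as [N1 HN1]; [lra|].
destruct (Hi (eps / 2)%R) as [N2 HN2]; [lra|].
exists (max N1 N2); intros n Hn.
specialize (HN1 n ltac:(lia)); specialize (HN2 n ltac:(lia)); unfold Rdist in *.
eapply Rle_lt_trans; [apply Cmod_le_Re_Im|].
change (Rabs (Re (csum a n) - lr) + Rabs (Im (csum a n) - li) < eps)%R; lra.
Qed.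

Lemma Cser_tail (a : nat -> C) (l : C) (B : R) (m : nat) : (0 <= B)%R -> (1 <= m)%nat ->
  (forall k, (1 <= k)%nat -> (Cmod (a k) <= B / (INR k)²)%R) -> Cser a l ->
  (Cmod (l - csum a m) <= B / INR m)%R.
Proof.
intros HB Hm Ha Hl; apply (Clim_bound (csum a) l (csum a m) _ m Hl); intros n Hn.
eapply Rle_trans; [apply Cmod_csum_tail with (B := B)|].
- lia.
- exact HB.
- intros k Hk; apply Ha; lia.
- assert (H1 : (0 < / INR n)%R)
    by (apply Rinv_0_lt_compat; assert (1 <= INR n)%R by (apply INR_ge_1; lia); lra).
  unfold Rdiv; nra.
Qed.

(** The first term costs [B], the telescoped tail at most another [B]. *)
Lemma Cmod_csum_inv_sqr (a : nat -> C) (B : R) (n : nat) : (0 <= B)%R ->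
  (forall k, (1 <= k)%nat -> (Cmod (a k) <= B / (INR k)²)%R) ->
  (Cmod (csum a n) <= 2 * B)%R.
Proof.
intros HB Ha; destruct n as [|n].
- simpl; rewrite Cmod_0; lra.
- assert (H := Cmod_csum_tail a B 1 (S n) ltac:(lia) HB (fun k Hk => Ha k ltac:(lia))).
  assert (H1 := Ha 1%nat ltac:(lia)).
  assert (H2 := Cmod_ge_minus (csum a (S n)) (- csum a 1)).
  rewrite Cmod_opp in H2.
  change (csum a 1) with (0 + a 1%nat) in H, H2; rewrite Cplus_0_l in H, H2.
  assert (H3 : (0 < / INR (S n))%R)
    by (apply Rinv_0_lt_compat; assert (1 <= INR (S n))%R by (apply INR_ge_1; lia); lra).
  change (INR 1) with 1%R in H, H1; unfold Rsqr in H1.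
  unfold Cminus in H.
  rewrite Rinv_1 in H; rewrite Rmult_1_l in H1; unfold Rdiv in H1; rewrite Rinv_1 in H1.
  nra.
Qed.

(** [L - csum v K] is the sum over [n] of the tails of the rows beyond [K]. Each tail is at most
    [B / (K n²)], so the whole is at most [2 * B / K]. *)
Lemma Cser_Fubini (a : nat -> nat -> C) (u v : nat -> C) (L : C) (B : R) :
  (0 <= B)%R ->
  (forall n k, (1 <= n)%nat -> (1 <= k)%nat ->
     (Cmod (a n k) <= B / ((INR n)² * (INR k)²))%R) ->
  (forall n, (1 <= n)%nat -> Cser (a n) (u n)) ->
  (forall k, (1 <= k)%nat -> Cser (fun n => a n k) (v k)) ->
  Cser u L -> Cser v L.
Proof.
intros HB Ha Hu Hv HL.
assert (Hpos : forall n, (1 <= n)%nat -> (0 < (INR n)²)%R).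
{ intros n Hn; assert (H := INR_ge_1 n Hn); unfold Rsqr; nra. }
apply Cser_of_rate with (B := (2 * B)%R) (N := 1%nat); intros K HK.
assert (HK1 := INR_ge_1 K HK).
rewrite Cmod_minus_sym.
assert (Hd : Cser (fun n => u n - csum (a n) K) (L - csum v K)).
{ apply Cser_minus; [exact HL|apply Cser_csum; intros; apply Hv; lia]. }
apply (Cser_bound _ _ _ 0 Hd); intros N _.
replace (2 * B / INR K)%R with (2 * (B / INR K))%R by (field; lra).
apply Cmod_csum_inv_sqr.
- apply Rdiv_le_0_compat; lra.
- intros n Hn; specialize (Hpos n Hn).
  replace (B / INR K / (INR n)²)%R with (B / (INR n)² / INR K)%R by (field; lra).
  apply Cser_tail with (a := a n); [apply Rdiv_le_0_compat; lra|exact HK| |now apply Hu].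
  intros k Hk; eapply Rle_trans; [now apply Ha|].
  assert (H := INR_ge_1 k Hk); apply Req_le; unfold Rsqr in *; field; split; nra.
Qed.

(** Pairs with [n + k < M] lie in a finite square, whose maximum enlarges the bound. Estimates valid
    near infinity, such as those for a root that is principal only there, are thus extended to all
    indices. *)
Lemma bounded_of_eventually_bounded (g : nat -> nat -> R) (M : nat) (B : R) :
  (forall n k, (1 <= n)%nat -> (1 <= k)%nat -> (M <= n + k)%nat -> (g n k <= B)%R) ->
  exists B', (0 <= B')%R /\
    forall n k, (1 <= n)%nat -> (1 <= k)%nat -> (g n k <= B')%R.
Proof.
intros H.
assert (Hrow : forall N K, exists B', (0 <= B')%R /\
  forall n k, (n <= N)%nat -> (k <= K)%nat -> (g n k <= B')%R).
{ intros N K.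
  assert (H1 : forall n, exists B', (0 <= B')%R /\ forall k, (k <= K)%nat -> (g n k <= B')%R).
  { intros n; clear H; induction K as [|K [B1 [H0 H1]]].
    - exists (Rmax 0 (g n 0%nat)); split; [apply Rmax_l|].
      intros k Hk; replace k with 0%nat by lia; apply Rmax_r.
    - exists (Rmax B1 (g n (S K))); split; [eapply Rle_trans; [exact H0|apply Rmax_l]|].
      intros k Hk; destruct (Nat.eq_dec k (S K)) as [->|]; [apply Rmax_r|].
      eapply Rle_trans; [apply H1; lia|apply Rmax_l]. }
  induction N as [|N [B1 [H0 HB1]]].
  - destruct (H1 0%nat) as [B1 [H0 HB1]]; exists B1; split; [exact H0|].
    intros n k Hn; replace n with 0%nat by lia; apply HB1.
  - destruct (H1 (S N)) as [B2 [H02 HB2]].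
    exists (Rmax B1 B2); split; [eapply Rle_trans; [exact H0|apply Rmax_l]|].
    intros n k Hn Hk; destruct (Nat.eq_dec n (S N)) as [->|].
    + eapply Rle_trans; [now apply HB2|apply Rmax_r].
    + eapply Rle_trans; [apply HB1; lia|apply Rmax_l]. }
destruct (Hrow M M) as [B' [H0 HB']].
exists (Rmax B' B); split; [eapply Rle_trans; [exact H0|apply Rmax_l]|].
intros n k Hn Hk; destruct (Nat.le_gt_cases M (n + k)).
- eapply Rle_trans; [now apply H|apply Rmax_r].
- eapply Rle_trans; [apply HB'; lia|apply Rmax_l].
Qed.

(** * The complex exponential *)

Lemma Clim_csum (s : nat -> nat -> C) (l : nat -> C) (J : nat) :
  (forall j, (1 <= j <= J)%nat -> Clim (s j) (l j)) ->
  Clim (fun n => csum (fun j => s j n) J) (csum l J).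
Proof.
induction J as [|J IH]; intros H; simpl; [apply Clim_const|].
apply Clim_plus; [apply IH; intros; apply H; lia|apply H; lia].
Qed.

(** In the applications [M n] is [2 * 2 ^ n], since the multiplication formula of [ccoth] is
    established at powers of 2. *)
Lemma Clim_of_rate (s : nat -> C) (l : C) (B : R) (M : nat -> nat) (N : nat) :
  (forall n, (n <= M n)%nat) ->
  (forall n, (N <= n)%nat -> (Cmod (s n - l) <= B / INR (M n))%R) -> Clim s l.
Proof.
intros HM H eps He; destruct (archimed_div B eps He) as [N' [_ HN']].
exists (max N N'); intros n Hn.
eapply Rle_lt_trans; [apply H; lia|apply HN'].
specialize (HM n); lia.
Qed.

Lemma Cexp_plus (a b : C) : Cexp (a + b) = Cexp a * Cexp b.
Proof.
destruct a as [x y], b as [x' y']; unfold Cexp, Cmult; simpl.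
rewrite exp_plus, cos_plus, sin_plus; f_equal; ring.
Qed.

Lemma Cexp_0 : Cexp 0 = 1.
Proof. unfold Cexp; simpl; rewrite exp_0, cos_0, sin_0; unfold RtoC; f_equal; ring. Qed.

Lemma Cmod_Cexp (z : C) : Cmod (Cexp z) = exp (Re z).
Proof.
unfold Cmod, Cexp; simpl fst; simpl snd.
transitivity (sqrt (exp (Re z))²%R); [|apply sqrt_Rsqr; left; apply exp_pos].
apply (f_equal sqrt); assert (H := sin2_cos2 (Im z)); unfold Rsqr in *.
transitivity (exp (Re z) * exp (Re z)
  * (sin (Im z) * sin (Im z) + cos (Im z) * cos (Im z)))%R; [ring|].
rewrite H; ring.
Qed.

Lemma Cexp_neq_0 (z : C) : Cexp z <> 0.
Proof. apply Cmod_gt_0; rewrite Cmod_Cexp; apply exp_pos. Qed.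

Lemma abs_sin_le (y : R) : (Rabs (sin y) <= Rabs y)%R.
Proof.
destruct (Rtotal_order y 0) as [H|[->|H]].
- rewrite <- (Rabs_Ropp y), <- (Rabs_Ropp (sin y)), <- sin_neg.
  rewrite (Rabs_right (- y)) by lra.
  assert (H1 := sin_lt_x (- y) ltac:(lra)).
  apply Rabs_le; split; [|lra].
  destruct (Rle_or_lt (- y) PI) as [H2|H2].
  + assert (H3 := sin_ge_0 (- y) ltac:(lra) H2); lra.
  + assert (H3 := SIN_bound (- y)); assert (H4 := PI_RGT_0); assert (H5 := PI2_1); lra.
- rewrite sin_0, Rabs_R0; lra.
- rewrite (Rabs_right y) by lra.
  assert (H1 := sin_lt_x y H).
  apply Rabs_le; split; [|lra].
  destruct (Rle_or_lt y PI) as [H2|H2].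
  + assert (H3 := sin_ge_0 y ltac:(lra) H2); lra.
  + assert (H3 := SIN_bound y); assert (H4 := PI_RGT_0); assert (H5 := PI2_1); lra.
Qed.

Lemma cos_minus_1_bound (y : R) : (0 <= 1 - cos y <= y * y / 2)%R.
Proof.
split; [assert (H := COS_bound y); lra|].
replace y with (2 * (y / 2))%R at 1 by field; rewrite cos_2a_sin.
assert (H := abs_sin_le (y / 2)).
assert (H1 : (sin (y / 2) * sin (y / 2) <= y / 2 * (y / 2))%R) by now apply Rsqr_le_abs_1.
lra.
Qed.

Lemma sin_minus_id_bound (y : R) : (Rabs (sin y - y) <= Rabs y * (y * y) / 2)%R.
Proof.
destruct (MVT_cor4 sin cos 0 (Rabs y)) with (b := y) as [c [Hc1 Hc2]].
- intros c _; apply is_derive_sin.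
- rewrite Rminus_0_r; lra.
- rewrite sin_0, !Rminus_0_r in *.
  replace (sin y - y)%R with (- (1 - cos c) * y)%R by (rewrite Hc1; ring).
  rewrite Rabs_mult, Rabs_Ropp.
  assert (H := cos_minus_1_bound c).
  rewrite (Rabs_right (1 - cos c)) by lra.
  assert (H1 : (c * c <= y * y)%R) by now apply Rsqr_le_abs_1.
  assert (H2 := Rabs_pos y); nra.
Qed.

(** The upper bound comes from [exp x * exp (- x) = 1] and [exp (- x) >= 1 - x], that is, from
    [exp x <= 1 / (1 - x)]. *)
Lemma exp_minus_1_bound (x : R) : (Rabs x <= 1 / 2)%R ->
  (0 <= exp x - 1 - x <= 2 * (x * x))%R.
Proof.
intros Hx; apply Rabs_le_between in Hx; split.
- assert (H := exp_ineq1_le x); lra.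
- assert (H := exp_ineq1_le (- x)); assert (Hp := exp_pos x).
  assert (H1 : (exp x * exp (- x) = 1)%R) by (rewrite <- exp_plus, Rplus_opp_r; apply exp_0).
  nra.
Qed.

(** The two components add up to at most [2 x² + 2 |x y| + 2 y²], and [2 |x y| <= x² + y²] gives the
    constant 3. *)
Lemma Cexp_order_2 (u : C) : (Cmod u <= 1 / 2)%R ->
  (Cmod (Cexp u - 1 - u) <= 3 * (Cmod u * Cmod u))%R.
Proof.
intros Hu.
assert (Hx := re_le_Cmod u); assert (Hy := im_le_Cmod u).
assert (Hm := Cmod2_alt u).
destruct u as [x y]; simpl Re in *; simpl Im in *.
eapply Rle_trans; [apply Cmod_le_Re_Im|].
unfold Cexp; simpl.
assert (He := exp_minus_1_bound x ltac:(lra)).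
assert (Hc := cos_minus_1_bound y).
assert (Hs := sin_minus_id_bound y); assert (Hs' := abs_sin_le y).
assert (Hcb := COS_bound y).
assert (Hx0 := Rabs_pos x); assert (Hy0 := Rabs_pos y).
replace (Cmod (x, y) * Cmod (x, y))%R with (x * x + y * y)%R by (simpl in Hm; lra).
assert (Hxx : (Rabs x * Rabs x = x * x)%R) by (rewrite <- Rabs_mult; apply Rabs_right; nra).
assert (Hyy : (Rabs y * Rabs y = y * y)%R) by (rewrite <- Rabs_mult; apply Rabs_right; nra).
assert (Hxi : (- (1/2) <= x <= 1 / 2)%R) by (apply Rabs_le_between; lra).
assert (HRe : (Rabs (exp x * cos y + - (1) + - x) <= 2 * (x * x) + y * y)%R).
{ replace (exp x * cos y + - (1) + - x)%R
    with ((exp x - 1 - x) * cos y - (1 + x) * (1 - cos y))%R by ring.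
  apply Rabs_le; split; nra. }
assert (HIm : (Rabs (exp x * sin y + - 0 + - y) <= 2 * (Rabs x * Rabs y) + y * y)%R).
{ replace (exp x * sin y + - 0 + - y)%R
    with ((exp x - 1) * sin y + (sin y - y))%R by ring.
  eapply Rle_trans; [apply Rabs_triang|]; rewrite Rabs_mult.
  apply Rplus_le_compat.
  - rewrite <- Rmult_assoc; apply Rmult_le_compat; try apply Rabs_pos; [|exact Hs'].
    replace (exp x - 1)%R with ((exp x - 1 - x) + x)%R by ring.
    eapply Rle_trans; [apply Rabs_triang|].
    rewrite (Rabs_right (exp x - 1 - x)) by lra; nra.
  - nra. }
assert (Hq : (0 <= (Rabs x - Rabs y) * (Rabs x - Rabs y))%R) by apply Rle_0_sqr.
apply Rle_trans with (2 * (x * x) + y * y + (2 * (Rabs x * Rabs y) + y * y))%R; lra.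
Qed.

Lemma Cexp_order_1 (u : C) : (Cmod u <= 1 / 2)%R ->
  (Cmod (Cexp u - 1) <= 3 * Cmod u)%R.
Proof.
intros Hu; replace (Cexp u - 1) with ((Cexp u - 1 - u) + u) by ring.
eapply Rle_trans; [apply Cmod_triangle|].
assert (H := Cexp_order_2 u Hu); assert (H0 := Cmod_ge_0 u); nra.
Qed.

(** * The hyperbolic cotangent and its multiplication formula *)

Definition exp2pi (z : C) : C := Cexp (RtoC (2 * PI) * z).

Lemma exp2pi_plus (a b : C) : exp2pi (a + b) = exp2pi a * exp2pi b.
Proof. unfold exp2pi; rewrite <- Cexp_plus; f_equal; ring. Qed.

Lemma exp2pi_imag (t : R) :
  exp2pi (Ci * RtoC t) = (cos (2 * PI * t), sin (2 * PI * t)).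
Proof.
unfold exp2pi, Cexp; simpl.
replace (2 * PI * (0 * t - 1 * 0) - 0 * (0 * 0 + 1 * t))%R with 0%R by ring.
replace (2 * PI * (0 * 0 + 1 * t) + 0 * (0 * t - 1 * 0))%R with (2 * PI * t)%R by ring.
rewrite exp_0; f_equal; ring.
Qed.

Lemma exp2pi_Ci : exp2pi Ci = 1.
Proof.
rewrite <- (Cmult_1_r Ci), exp2pi_imag, Rmult_1_r, cos_2PI, sin_2PI; reflexivity.
Qed.

Lemma exp2pi_half_Ci : exp2pi (Ci / 2) = - (1).
Proof.
replace (Ci / 2) with (Ci * RtoC (/ 2))
  by (rewrite RtoC_inv by lra; unfold Cdiv; reflexivity).
rewrite exp2pi_imag.
replace (2 * PI * / 2)%R with PI by field.
rewrite cos_PI, sin_PI; unfold Copp; simpl; f_equal; ring.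
Qed.

Lemma exp2pi_0 : exp2pi 0 = 1.
Proof. unfold exp2pi; rewrite Cmult_0_r; apply Cexp_0. Qed.

Lemma exp2pi_NtoC (n : nat) (z : C) : exp2pi z = 1 -> exp2pi (NtoC n * z) = 1.
Proof.
intros H; induction n as [|n IH].
- unfold NtoC; simpl; rewrite Cmult_0_l; apply exp2pi_0.
- rewrite NtoC_S; replace ((NtoC n + 1) * z) with (NtoC n * z + z) by ring.
  rewrite exp2pi_plus, IH, H; ring.
Qed.

(* [coth (PI * z)] *)
Definition ccoth (z : C) : C := (exp2pi z + 1) / (exp2pi z - 1).

Lemma ccoth_period (z : C) : ccoth (z + Ci) = ccoth z.
Proof. unfold ccoth; rewrite exp2pi_plus, exp2pi_Ci, Cmult_1_r; reflexivity. Qed.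

(** With [e = exp2pi (z / 2)], the shift by [Ci / 2] replaces [e] by [- e], and the identity becomes
    rational in [e]. *)
Lemma ccoth_double (z : C) : exp2pi z <> 1 ->
  ccoth (z / 2) + ccoth (z / 2 + Ci / 2) = 2 * ccoth z.
Proof.
intros Hz; unfold ccoth; rewrite (exp2pi_plus (z / 2)), exp2pi_half_Ci.
assert (H : exp2pi z = exp2pi (z / 2) * exp2pi (z / 2)).
{ rewrite <- exp2pi_plus; f_equal; field. }
rewrite H in *; set (e := exp2pi (z / 2)) in *.
assert (H1 : e - 1 <> 0).
{ intros E; apply Hz; replace e with (RtoC 1); [ring|].
  symmetry; now apply Ceq_minus. }
assert (H2 : e + 1 <> 0).
{ intros E; apply Hz; replace e with ((e + 1) - 1) by ring; rewrite E; ring. }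
assert (H3 : e * e - 1 <> 0).
{ replace (e * e - 1) with ((e - 1) * (e + 1)) by ring; now apply Cmult_neq_0. }
field; repeat split; auto.
intros E; apply H2; replace (e + 1) with (- (e * -1 - 1)) by ring; rewrite E; ring.
Qed.

Lemma csum_append (a : nat -> C) (m n : nat) :
  csum a (m + n) = csum a m + csum (fun j => a (m + j)%nat) n.
Proof.
induction n as [|n IH]; simpl.
- rewrite Nat.add_0_r; ring.
- rewrite Nat.add_succ_r; simpl; rewrite IH; ring.
Qed.

Lemma csum_reflect (a : nat -> C) (N p : nat) : (p <= N)%nat ->
  csum a N = csum a (N - p) + csum (fun j => a (S N - j)%nat) p.
Proof.
induction p as [|p IH]; intros Hp.
- rewrite Nat.sub_0_r; simpl; ring.
- rewrite IH by lia; simpl csum.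
  replace (N - p)%nat with (S (N - S p)) by lia; simpl csum.
  replace (S (N - S p)) with (N - p)%nat by lia; ring.
Qed.

Lemma NtoC_neq_0 (n : nat) : (1 <= n)%nat -> NtoC n <> 0.
Proof.
intros Hn; apply Cmod_gt_0; rewrite Cmod_NtoC.
assert (H := INR_ge_1 n Hn); lra.
Qed.

Lemma NtoC_plus (m n : nat) : NtoC (m + n) = NtoC m + NtoC n.
Proof. unfold NtoC; now rewrite plus_INR, RtoC_plus. Qed.

Lemma exp2pi_frac_neq_1 (z : C) (M j : nat) : (1 <= M)%nat -> exp2pi z <> 1 ->
  exp2pi ((z + Ci * NtoC j) / NtoC M) <> 1.
Proof.
intros HM Hz E; apply Hz.
assert (H := exp2pi_NtoC M _ E).
replace (NtoC M * ((z + Ci * NtoC j) / NtoC M)) with (z + NtoC j * Ci) in H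
  by (field; now apply NtoC_neq_0).
rewrite exp2pi_plus, (exp2pi_NtoC j Ci exp2pi_Ci), Cmult_1_r in H; exact H.
Qed.

(** Iterated duplication. Powers of 2 are cofinal, which suffices for the limit, and the induction
    replaces a computation with roots of unity. *)
Lemma ccoth_multiplication (z : C) (m : nat) : exp2pi z <> 1 ->
  NtoC (2 ^ m) * ccoth z
  = csum (fun j => ccoth ((z + Ci * NtoC j) / NtoC (2 ^ m))) (2 ^ m).
Proof.
intros Hz; induction m as [|m IH].
- simpl; unfold NtoC; simpl.
  replace ((z + Ci * 1) / 1) with (z + Ci) by field.
  rewrite ccoth_period; ring.
- simpl Nat.pow; rewrite Nat.add_0_r, csum_append, <- csum_plus.
  set (M := (2 ^ m)%nat) in *.
  assert (HM : (1 <= M)%nat) by (apply Nat.neq_0_lt_0, Nat.pow_nonzero; lia).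
  assert (HM0 := NtoC_neq_0 M HM).
  rewrite (csum_ext _ (fun j => 2 * ccoth ((z + Ci * NtoC j) / NtoC M))).
  + rewrite csum_scal, <- IH, NtoC_plus; ring.
  + intros j _.
    rewrite <- (ccoth_double _ (exp2pi_frac_neq_1 z M j HM Hz)).
    rewrite !NtoC_plus.
    replace (NtoC M + NtoC M) with (2 * NtoC M) by ring.
    f_equal; f_equal; field; exact HM0.
Qed.

Lemma exp2pi_opp (z : C) : exp2pi (- z) * exp2pi z = 1.
Proof.
rewrite <- exp2pi_plus; replace (- z + z) with (RtoC 0) by ring; apply exp2pi_0.
Qed.

Lemma ccoth_pair_denom (a b : C) :
  (exp2pi a - 1) * (exp2pi a - 1) + exp2pi a * (2 - (exp2pi b + exp2pi (- b)))
  = (exp2pi (a + b) - 1) * (exp2pi (a - b) - 1).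
Proof.
change (a - b) with (a + - b); rewrite !(exp2pi_plus a).
assert (Hb := exp2pi_opp b).
transitivity (exp2pi a * exp2pi a * (exp2pi (- b) * exp2pi b)
  - exp2pi a * (exp2pi b + exp2pi (- b)) + 1); [rewrite Hb; ring|ring].
Qed.

(** Taking the shifts [b] and [- b] together puts the factor [exp2pi a - 1] into the numerator. It
    is small for [a = z / M], and this gives the paired terms a quadratic decay that the single ones
    lack. *)
Lemma ccoth_pair (a b : C) : exp2pi (a + b) <> 1 -> exp2pi (a - b) <> 1 ->
  ccoth (a + b) + ccoth (a - b)
  = 2 * (exp2pi a - 1) * (exp2pi a + 1)
    / ((exp2pi a - 1) * (exp2pi a - 1)
       + exp2pi a * (2 - (exp2pi b + exp2pi (- b)))).
Proof.
intros H1 H2; rewrite ccoth_pair_denom; unfold ccoth.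
apply Cminus_eq_contra in H1; apply Cminus_eq_contra in H2.
replace (2 * (exp2pi a - 1) * (exp2pi a + 1))
  with ((exp2pi (a + b) + 1) * (exp2pi (a - b) - 1) + (exp2pi (a - b) + 1) * (exp2pi (a + b) - 1)).
- field; auto.
- change (a - b) with (a + - b); rewrite !(exp2pi_plus a).
  transitivity (2 * (exp2pi a * exp2pi a * (exp2pi (- b) * exp2pi b)) - 2); [ring|].
  rewrite exp2pi_opp; ring.
Qed.

Lemma exp2pi_imag_pair (t : R) :
  2 - (exp2pi (Ci * RtoC t) + exp2pi (- (Ci * RtoC t)))
  = RtoC (4 * (sin (PI * t) * sin (PI * t))).
Proof.
replace (- (Ci * RtoC t)) with (Ci * RtoC (- t)) by (rewrite RtoC_opp; ring).
rewrite !exp2pi_imag.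
replace (2 * PI * - t)%R with (- (2 * PI * t))%R by ring.
rewrite cos_neg, sin_neg.
replace (2 * PI * t)%R with (2 * (PI * t))%R by ring.
rewrite cos_2a_sin; unfold RtoC, Cminus, Copp, Cplus; simpl; f_equal; ring.
Qed.

Lemma sin_ge_half (b : R) : (0 <= b <= PI / 2)%R -> (b / 2 <= sin b)%R.
Proof.
intros [Hb Hb2].
assert (HP := PI_4).
assert (H := pre_sin_bound b 0 Hb ltac:(lra)).
destruct H as [H _].
unfold sin_approx, sin_term in H; simpl in H.
(* [b - b^3 / 6 >= b / 2] holds as soon as [b² <= 3], which [17 / 10] ensures; the bound on [PI] is
   a partial sum of the Leibniz series. *)
assert (HPI : (b <= 17 / 10)%R).
{ assert (HPI2 := PI2_3_2).
  assert (PI <= 34 / 10)%R; [|lra].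
  generalize PI_ineq; intros HI; specialize (HI 4%nat); destruct HI as [_ HI].
  unfold tg_alt, PI_tg in HI; simpl in HI; lra. }
nra.
Qed.

(** * Partial fractions of the hyperbolic cotangent *)

Definition coth_pair_term (z : C) (M j : nat) : C :=
  ccoth (z / NtoC M + Ci * RtoC (INR j / INR M))
  + ccoth (z / NtoC M - Ci * RtoC (INR j / INR M)).

Lemma frac_split (z : C) (M j : nat) : (1 <= M)%nat ->
  (z + Ci * NtoC j) / NtoC M = z / NtoC M + Ci * RtoC (INR j / INR M).
Proof.
intros HM; assert (H := INR_ge_1 M HM).
rewrite RtoC_div by lra; fold (NtoC j) (NtoC M).
field; now apply NtoC_neq_0.
Qed.

Lemma frac_split_opp (z : C) (M j : nat) : (1 <= M)%nat ->
  (z - Ci * NtoC j) / NtoC M = z / NtoC M - Ci * RtoC (INR j / INR M).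
Proof.
intros HM; assert (H := INR_ge_1 M HM).
rewrite RtoC_div by lra; fold (NtoC j) (NtoC M).
field; now apply NtoC_neq_0.
Qed.

Lemma exp2pi_frac_opp_neq_1 (z : C) (M j : nat) : (1 <= M)%nat -> exp2pi z <> 1 ->
  exp2pi ((z - Ci * NtoC j) / NtoC M) <> 1.
Proof.
intros HM Hz E; apply Hz; assert (H := exp2pi_NtoC M _ E).
replace (NtoC M * ((z - Ci * NtoC j) / NtoC M)) with (z - Ci * NtoC j) in H
  by (field; now apply NtoC_neq_0).
replace z with ((z - Ci * NtoC j) + NtoC j * Ci) by ring.
rewrite exp2pi_plus, H, (exp2pi_NtoC j Ci exp2pi_Ci); ring.
Qed.

Lemma coth_pair_term_denom (z : C) (M j : nat) : (1 <= M)%nat -> exp2pi z <> 1 ->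
  (exp2pi (z / NtoC M) - 1) * (exp2pi (z / NtoC M) - 1)
  + exp2pi (z / NtoC M)
    * RtoC (4 * (sin (PI * (INR j / INR M)) * sin (PI * (INR j / INR M)))) <> 0.
Proof.
intros HM Hz; rewrite <- exp2pi_imag_pair, ccoth_pair_denom.
rewrite <- frac_split, <- frac_split_opp by exact HM.
apply Cmult_neq_0; apply Cminus_eq_contra;
  [now apply exp2pi_frac_neq_1|now apply exp2pi_frac_opp_neq_1].
Qed.

Lemma coth_pair_term_formula (z : C) (M j : nat) : (1 <= M)%nat -> exp2pi z <> 1 ->
  coth_pair_term z M j
  = 2 * (exp2pi (z / NtoC M) - 1) * (exp2pi (z / NtoC M) + 1)
    / ((exp2pi (z / NtoC M) - 1) * (exp2pi (z / NtoC M) - 1)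
       + exp2pi (z / NtoC M)
         * RtoC (4 * (sin (PI * (INR j / INR M)) * sin (PI * (INR j / INR M))))).
Proof.
intros HM Hz; unfold coth_pair_term.
rewrite ccoth_pair, exp2pi_imag_pair; [reflexivity| |].
- rewrite <- frac_split by exact HM; now apply exp2pi_frac_neq_1.
- rewrite <- frac_split_opp by exact HM; now apply exp2pi_frac_opp_neq_1.
Qed.

(** [2 * PI <= 8] and the factor 3 of [Cexp_order_1] give 24; the hypothesis keeps the exponent
    below [1 / 6]. *)
Lemma exp2pi_frac_bound (z : C) (M : nat) : (1 <= M)%nat -> (48 * Cmod z <= INR M)%R ->
  (Cmod (exp2pi (z / NtoC M) - 1) <= 24 * Cmod z / INR M
   /\ Cmod (exp2pi (z / NtoC M) - 1) <= 1 / 2)%R.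
Proof.
intros HM Hz; assert (H1 := INR_ge_1 M HM).
assert (HP := PI_4); assert (HP0 := PI_RGT_0); assert (Hz0 := Cmod_ge_0 z).
assert (Hu : (Cmod (RtoC (2 * PI) * (z / NtoC M)) <= 8 * Cmod z / INR M)%R).
{ rewrite Cmod_mult, Cmod_R, Cmod_div, Cmod_NtoC by now apply NtoC_neq_0.
  rewrite Rabs_right by lra; unfold Rdiv; rewrite <- Rmult_assoc.
  apply Rmult_le_compat_r; [left; apply Rinv_0_lt_compat; lra|].
  apply Rmult_le_compat_r; lra. }
assert (Hb : (8 * Cmod z / INR M <= 1 / 6)%R).
{ apply Rmult_le_reg_r with (INR M); [lra|].
  unfold Rdiv; rewrite Rmult_assoc, Rinv_l; lra. }
assert (He := Cexp_order_1 (RtoC (2 * PI) * (z / NtoC M)) ltac:(lra)).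
fold (exp2pi (z / NtoC M)) in He.
split; [|lra].
replace (24 * Cmod z / INR M)%R with (3 * (8 * Cmod z / INR M))%R by (field; lra); lra.
Qed.

(** Put [q = j / M] and [e = exp2pi (z / M)], with [M = 2 h]. The denominator is at least
    [4 q² |e| - |e - 1|² >= q²], because [|e| >= 1 / 2] and [24 |z| <= j] gives [|e - 1| <= q]. The
    numerator is at most [2 (24 |z| / M) (5 / 2)], whence 120. *)
Lemma coth_pair_term_bound (z : C) (h j : nat) :
  exp2pi z <> 1 -> (1 <= j <= h)%nat -> (24 * Cmod z <= INR j)%R ->
  (Cmod (coth_pair_term z (2 * h) j)
   <= 120 * Cmod z * INR (2 * h) / (INR j * INR j))%R.
Proof.
intros Hz [Hj Hjh] Hjz.
rewrite coth_pair_term_formula by (assumption || lia).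
assert (Hj1 := INR_ge_1 j Hj).
assert (HM : (2 * INR j <= INR (2 * h))%R).
{ rewrite mult_INR; simpl (INR 2); apply Rmult_le_compat_l; [lra|now apply le_INR]. }
destruct (exp2pi_frac_bound z (2 * h)) as [He1 He2]; [lia|lra|].
set (M := INR (2 * h)) in *; set (e := exp2pi (z / NtoC (2 * h))) in *.
assert (HM0 : (0 < M)%R) by lra.
assert (Hsin : (INR j / M <= sin (PI * (INR j / M)))%R).
{ assert (H0 : (0 < INR j / M <= / 2)%R).
  { split; [apply Rdiv_lt_0_compat; lra|].
    apply Rmult_le_reg_r with M; [lra|]; unfold Rdiv; rewrite Rmult_assoc, Rinv_l; lra. }
  assert (HP := PI2_1); assert (HP0 := PI_RGT_0).
  assert (H := sin_ge_half (PI * (INR j / M)) ltac:(split; nra)).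
  assert (2 * (INR j / M) <= PI * (INR j / M))%R by (apply Rmult_le_compat_r; lra).
  lra. }
set (s := sin (PI * (INR j / M))) in *.
set (q := (INR j / M)%R) in *.
assert (Hq : (0 < q)%R) by (apply Rdiv_lt_0_compat; lra).
assert (Hz0 := Cmod_ge_0 z).
assert (He1' : (Cmod (e - 1) <= q)%R).
{ eapply Rle_trans; [exact He1|]; unfold q, Rdiv.
  apply Rmult_le_compat_r; [left; apply Rinv_0_lt_compat; lra|lra]. }
assert (Hel : (1 / 2 <= Cmod e)%R).
{ assert (H := Cmod_ge_minus 1 (e - 1)).
  replace (1 + (e - 1)) with e in H by ring; rewrite Cmod_1 in H; lra. }
assert (Heu : (Cmod (e + 1) <= 5 / 2)%R).
{ replace (e + 1) with ((e - 1) + RtoC 2) by ring.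
  eapply Rle_trans; [apply Cmod_triangle|]; rewrite Cmod_R, Rabs_right; lra. }
assert (Hden : (q * q <= Cmod ((e - 1) * (e - 1) + e * RtoC (4 * (s * s))))%R).
{ rewrite (Cplus_comm ((e - 1) * (e - 1))).
  eapply Rle_trans; [|apply Cmod_ge_minus].
  rewrite !Cmod_mult, Cmod_R.
  assert (Hss : (q * q <= s * s)%R) by nra.
  rewrite Rabs_right by nra.
  assert (H0 := Cmod_ge_0 (e - 1)).
  assert (Cmod (e - 1) * Cmod (e - 1) <= q * q)%R by nra.
  nra. }
assert (Hqq : (0 < q * q)%R) by nra.
assert (Hd0 : (e - 1) * (e - 1) + e * RtoC (4 * (s * s)) <> 0) by (apply Cmod_gt_0; lra).
rewrite Cmod_div by exact Hd0.
rewrite !Cmod_mult, Cmod_R, (Rabs_right 2) by lra.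
apply Rle_trans with (2 * (24 * Cmod z / M) * (5 / 2) / (q * q))%R.
- unfold Rdiv at 1 2; apply Rmult_le_compat.
  + assert (H0 := Cmod_ge_0 (e - 1)); assert (H1 := Cmod_ge_0 (e + 1)); nra.
  + left; apply Rinv_0_lt_compat; lra.
  + apply Rmult_le_compat; try lra; try apply Cmod_ge_0.
    assert (H0 := Cmod_ge_0 (e - 1)); lra.
  + apply Rinv_le_contravar; lra.
- apply Req_le; unfold q; field; lra.
Qed.

(** Among the [2 h] shifts, the last is a full period and gives the unshifted term, and [j] is
    paired with [2 h - j]. The midpoint [j = h] is its own partner, so half of its pair term is
    subtracted. *)
Lemma ccoth_pair_sum (z : C) (m : nat) : exp2pi z <> 1 ->
  let h := (2 ^ m)%nat in
  NtoC (2 * h) * ccoth z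
  = ccoth (z / NtoC (2 * h))
    + (csum (coth_pair_term z (2 * h)) h - coth_pair_term z (2 * h) h / 2).
Proof.
intros Hz h.
assert (Hh : (1 <= h)%nat) by (apply Nat.neq_0_lt_0, Nat.pow_nonzero; lia).
assert (E : (2 * h)%nat = (2 ^ S m)%nat) by reflexivity.
assert (H := ccoth_multiplication z (S m) Hz); rewrite <- E in H; clear E.
set (F := fun j => ccoth ((z + Ci * NtoC j) / NtoC (2 * h))) in H.
assert (Hb : forall j, (j <= 2 * h)%nat ->
  F (2 * h - j)%nat = ccoth (z / NtoC (2 * h) - Ci * RtoC (INR j / INR (2 * h)))).
{ intros j Hj; unfold F.
  rewrite <- frac_split_opp by lia; rewrite <- (ccoth_period ((z - _) / _)); f_equal.
  unfold NtoC at 1; rewrite minus_INR by lia; rewrite RtoC_minus.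
  fold (NtoC (2 * h)) (NtoC j); field; apply NtoC_neq_0; lia. }
assert (Hg : forall j, (j <= 2 * h)%nat ->
  coth_pair_term z (2 * h) j = F j + F (2 * h - j)%nat).
{ intros j Hj; rewrite Hb by exact Hj; unfold coth_pair_term, F.
  now rewrite frac_split by lia. }
rewrite H; clear H.
replace (2 * h)%nat with (S (2 * h - 1)) at 1 by lia; simpl csum.
replace (S (h + (h + 0) - 1)) with (2 * h)%nat by lia.
replace (h + (h + 0) - 1)%nat with (2 * h - 1)%nat by lia.
rewrite (csum_reflect F (2 * h - 1) (h - 1)) by lia.
replace (2 * h - 1 - (h - 1))%nat with h by lia.
replace (F (2 * h)%nat) with (ccoth (z / NtoC (2 * h))).
2:{ rewrite <- (ccoth_period (z / _)); unfold F; f_equal; field; apply NtoC_neq_0; lia. }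
rewrite (csum_ext (fun j => F (S (2 * h - 1) - j)%nat) (fun j => F (2 * h - j)%nat))
  by (intros j Hj; f_equal; lia).
rewrite (csum_ext (coth_pair_term z (2 * h)) (fun j => F j + F (2 * h - j)%nat))
  by (intros j Hj; apply Hg; lia).
rewrite csum_plus, Hg by lia.
replace (2 * h - h)%nat with h by lia.
destruct h as [|h']; [lia|].
replace (S h' - 1)%nat with h' by lia.
rewrite !csum_S.
replace (2 * S h' - S h')%nat with (S h') by lia.
field.
Qed.

(** Truncation at [J] costs an amount independent of [m]: this uniformity is the domination in the
    argument of Tannery. *)
Lemma ccoth_pair_sum_tail (z : C) (m J : nat) : exp2pi z <> 1 ->
  (1 <= J)%nat -> (24 * Cmod z <= INR J)%R -> (J <= 2 ^ m)%nat ->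
  (Cmod (ccoth (z / NtoC (2 * 2 ^ m)) / NtoC (2 * 2 ^ m)
         + csum (fun j => (coth_pair_term z (2 * 2 ^ m) j / NtoC (2 * 2 ^ m))%C) J
         - ccoth z) <= 120 * Cmod z / INR J)%R.
Proof.
intros Hz HJ HJz HJm.
assert (H := ccoth_pair_sum z m Hz); cbv zeta in H.
set (h := (2 ^ m)%nat) in *.
assert (HM0 : NtoC (2 * h) <> 0) by (apply NtoC_neq_0; lia).
assert (HJ1 := INR_ge_1 J HJ).
assert (Hh1 : (INR J <= INR h)%R) by now apply le_INR.
assert (HM : (0 < INR (2 * h))%R) by (apply lt_0_INR; lia).
replace (ccoth z) with (NtoC (2 * h) * ccoth z / NtoC (2 * h)) by (field; exact HM0).
rewrite H.
rewrite (csum_ext _ (fun j => / NtoC (2 * h) * coth_pair_term z (2 * h) j))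
  by (intros; unfold Cdiv; ring).
rewrite csum_scal.
set (g := coth_pair_term z (2 * h)) in *.
replace (ccoth (z / NtoC (2 * h)) / NtoC (2 * h) + / NtoC (2 * h) * csum g J -
  (ccoth (z / NtoC (2 * h)) + (csum g h - g h / 2)) / NtoC (2 * h))
  with ((g h / 2 - (csum g h - csum g J)) / NtoC (2 * h)) by (field; exact HM0).
rewrite Cmod_div, Cmod_NtoC by exact HM0.
set (K := (120 * Cmod z * INR (2 * h))%R).
assert (HK : (0 <= K)%R).
{ unfold K; assert (H0 := Cmod_ge_0 z); assert (0 <= 120 * Cmod z)%R by lra; nra. }
assert (H1 : (Cmod (csum g h - csum g J) <= K * (/ INR J - / INR h))%R).
{ apply Cmod_csum_tail; [lia|exact HK|].
  intros k Hk; apply coth_pair_term_bound; [exact Hz|lia|].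
  apply Rle_trans with (INR J); [exact HJz|apply le_INR; lia]. }
assert (H2 : (Cmod (g h) <= K / (INR h * INR h))%R).
{ apply coth_pair_term_bound; [exact Hz|lia|lra]. }
assert (H3 : (K / (INR h * INR h) <= K * / INR h)%R).
{ unfold Rdiv; apply Rmult_le_compat_l; [exact HK|].
  apply Rinv_le_contravar; nra. }
assert (H4 : (Cmod (g h / 2 - (csum g h - csum g J)) <= K * / INR J)%R).
{ eapply Rle_trans; [apply Cmod_minus_le|].
  rewrite Cmod_div, (Cmod_R 2), (Rabs_right 2) by (lra || (apply RtoC_neq_0; lra)).
  assert (H0 := Cmod_ge_0 (g h)); lra. }
apply Rmult_le_reg_r with (INR (2 * h)); [exact HM|].
unfold Rdiv at 1; rewrite Rmult_assoc, Rinv_l, Rmult_1_r by lra.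
replace (120 * Cmod z / INR J * INR (2 * h))%R with (K * / INR J)%R
  by (unfold K; field; lra).
exact H4.
Qed.

Lemma pow2_unbounded (m : nat) : (m <= 2 * 2 ^ m)%nat.
Proof. assert (H := Nat.pow_gt_lin_r 2 m ltac:(lia)); lia. Qed.

Lemma Clim_exp2pi_frac (z : C) :
  Clim (fun m => NtoC (2 * 2 ^ m) * (exp2pi (z / NtoC (2 * 2 ^ m)) - 1))
       (RtoC (2 * PI) * z).
Proof.
set (v := RtoC (2 * PI) * z).
destruct (archimed_div (Cmod v) (1 / 2)%R) as [N [_ HN]]; [lra|].
apply (Clim_of_rate _ _ (3 * (Cmod v * Cmod v)) (fun m => 2 * 2 ^ m)%nat N).
{ apply pow2_unbounded. }
intros m Hm.
assert (HM : (1 <= 2 * 2 ^ m)%nat) by (assert (H := Nat.pow_nonzero 2 m); lia).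
assert (HMm := pow2_unbounded m).
set (M := (2 * 2 ^ m)%nat) in *.
assert (H0 := NtoC_neq_0 M HM); assert (H1 := INR_ge_1 M HM).
assert (E : RtoC (2 * PI) * (z / NtoC M) = v / NtoC M) by (unfold v; field; exact H0).
unfold exp2pi; rewrite E.
assert (Hu : Cmod (v / NtoC M) = (Cmod v / INR M)%R)
  by (rewrite Cmod_div, Cmod_NtoC by exact H0; reflexivity).
assert (H := Cexp_order_2 (v / NtoC M)).
rewrite Hu in H; specialize (H ltac:(left; apply HN; lia)).
replace (NtoC M * (Cexp (v / NtoC M) - 1) - v)
  with (NtoC M * (Cexp (v / NtoC M) - 1 - v / NtoC M)) by (field; exact H0).
rewrite Cmod_mult, Cmod_NtoC.
apply Rle_trans with (INR M * (3 * (Cmod v / INR M * (Cmod v / INR M))))%R.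
- apply Rmult_le_compat_l; lra.
- apply Req_le; field; lra.
Qed.

Lemma Clim_inv_pow2 : Clim (fun m => / NtoC (2 * 2 ^ m)) 0.
Proof.
apply (Clim_of_rate _ _ 1 (fun m => 2 * 2 ^ m)%nat 0).
{ apply pow2_unbounded. }
intros m _.
assert (HM : (1 <= 2 * 2 ^ m)%nat) by (assert (H := Nat.pow_nonzero 2 m); lia).
set (M := (2 * 2 ^ m)%nat) in *.
replace (/ NtoC M - 0) with (/ NtoC M) by ring.
rewrite Cmod_inv, Cmod_NtoC by now apply NtoC_neq_0.
unfold Rdiv; lra.
Qed.

Lemma Clim_exp2pi_frac_1 (z : C) : Clim (fun m => exp2pi (z / NtoC (2 * 2 ^ m))) 1.
Proof.
replace (RtoC 1) with (0 * (RtoC (2 * PI) * z) + 1) by ring.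
eapply Clim_ext; [|apply Clim_plus;
  [apply Clim_mult; [apply Clim_inv_pow2|apply (Clim_exp2pi_frac z)]|apply Clim_const]].
intros m; cbv beta.
assert (HM : (1 <= 2 * 2 ^ m)%nat) by (assert (H := Nat.pow_nonzero 2 m); lia).
field; now apply NtoC_neq_0.
Qed.

Lemma Clim_sin_frac (j : nat) :
  Clim (fun m => NtoC (2 * 2 ^ m) * RtoC (sin (PI * (INR j / INR (2 * 2 ^ m)))))
       (RtoC (PI * INR j)).
Proof.
set (v := (PI * INR j)%R).
assert (Hv : (0 <= v)%R) by (apply Rmult_le_pos; [left; apply PI_RGT_0|apply pos_INR]).
apply (Clim_of_rate _ _ (v * (v * v)) (fun m => 2 * 2 ^ m)%nat 0).
{ apply pow2_unbounded. }
intros m _.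
assert (HM : (1 <= 2 * 2 ^ m)%nat) by (assert (H := Nat.pow_nonzero 2 m); lia).
set (M := (2 * 2 ^ m)%nat) in *; assert (H1 := INR_ge_1 M HM).
unfold NtoC; rewrite <- RtoC_mult, <- RtoC_minus, Cmod_R.
replace (PI * (INR j / INR M))%R with (v / INR M)%R by (unfold v; field; lra).
replace (INR M * sin (v / INR M) - v)%R with (INR M * (sin (v / INR M) - v / INR M))%R
  by (field; lra).
rewrite Rabs_mult, (Rabs_right (INR M)) by lra.
assert (H := sin_minus_id_bound (v / INR M)).
assert (Hd : (0 <= v / INR M)%R) by (apply Rdiv_le_0_compat; lra).
rewrite (Rabs_right (v / INR M)) in H by lra.
apply Rle_trans with (INR M * (v / INR M * (v / INR M * (v / INR M)) / 2))%R.
- apply Rmult_le_compat_l; lra.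
- replace (INR M * (v / INR M * (v / INR M * (v / INR M)) / 2))%R
    with (v * (v * v) / INR M * (/ INR M / 2))%R by (field; lra).
  assert (H2 : (0 < / INR M <= 1)%R).
  { split; [apply Rinv_0_lt_compat; lra|rewrite <- Rinv_1; apply Rinv_le_contravar; lra]. }
  assert (H3 : (0 <= v * (v * v) / INR M)%R)
    by (apply Rdiv_le_0_compat; [apply Rmult_le_pos; [|apply Rmult_le_pos]; exact Hv|lra]).
  nra.
Qed.

Lemma exp2pi_imag_nat (k : nat) : exp2pi (Ci * NtoC k) = 1.
Proof. rewrite Cmult_comm; apply exp2pi_NtoC, exp2pi_Ci. Qed.

Lemma exp2pi_neq_1_sqr (z : C) (k : nat) : exp2pi z <> 1 -> z * z + NtoC k * NtoC k <> 0.
Proof.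
intros Hz E; apply Hz.
assert (Hci : Ci * Ci = - (1)) by (apply injective_projections; simpl; ring).
assert (E' : (z - Ci * NtoC k) * (z + Ci * NtoC k) = 0).
{ transitivity (z * z - (Ci * Ci) * (NtoC k * NtoC k)); [ring|].
  rewrite Hci, <- E; ring. }
destruct (Ceq_dec (z - Ci * NtoC k) 0) as [H|H].
- replace z with (z - Ci * NtoC k + Ci * NtoC k) by ring.
  rewrite H, Cplus_0_l; apply exp2pi_imag_nat.
- destruct (Ceq_dec (z + Ci * NtoC k) 0) as [H'|H'].
  + assert (Hs : exp2pi (z + Ci * NtoC k) = 1) by (rewrite H'; apply exp2pi_0).
    now rewrite exp2pi_plus, exp2pi_imag_nat, Cmult_1_r in Hs.
  + exfalso; exact (Cmult_neq_0 _ _ H H' E').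
Qed.

(** For fixed [J], each pair term divided by [2 * 2 ^ m] tends to a multiple of its partial fraction
    as [m] grows, while the truncation error stays [O(1 / J)]. *)
Lemma ccoth_partial_fractions (z : C) : exp2pi z <> 1 ->
  Cser (fun k => 2 * z / (z * z + NtoC k * NtoC k)) (RtoC PI * ccoth z - 1 / z).
Proof.
intros Hz.
assert (HPI := PI_RGT_0).
assert (HPC : RtoC PI <> 0) by (apply RtoC_neq_0; lra).
assert (Hz0 : z <> 0) by (intros ->; apply Hz, exp2pi_0).
destruct (INR_unbounded (24 * Cmod z)) as [N HN].
apply (Cser_of_rate _ _ (PI * (120 * Cmod z)) (S N)); intros J HJ.
assert (HJ1 : (1 <= INR J)%R) by (apply INR_ge_1; lia).
assert (HJN : (24 * Cmod z <= INR J)%R)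
  by (apply Rle_trans with (INR N); [lra|apply le_INR; lia]).
assert (Hl : Clim (fun m => ccoth (z / NtoC (2 * 2 ^ m)) / NtoC (2 * 2 ^ m)
  + csum (fun j => coth_pair_term z (2 * 2 ^ m) j / NtoC (2 * 2 ^ m)) J)
  ((1 + 1) * / (RtoC (2 * PI) * z)
   + csum (fun j => 2 * (RtoC (2 * PI) * z) * (1 + 1)
      * / ((RtoC (2 * PI) * z) * (RtoC (2 * PI) * z)
           + 1 * (4 * (RtoC (PI * INR j) * RtoC (PI * INR j))))) J)).
{ apply Clim_plus.
  - eapply Clim_ext; [|apply Clim_mult; [apply Clim_plus; [apply (Clim_exp2pi_frac_1 z)|apply (Clim_const 1)]|
      apply Clim_inv; [|apply (Clim_exp2pi_frac z)]]].
    + intros m; unfold ccoth.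
      assert (HM : (1 <= 2 * 2 ^ m)%nat) by (assert (H := Nat.pow_nonzero 2 m); lia).
      assert (H0 := NtoC_neq_0 _ HM).
      assert (H1 : exp2pi (z / NtoC (2 * 2 ^ m)) - 1 <> 0).
      { apply Cminus_eq_contra.
        intros E; apply Hz; assert (H := exp2pi_NtoC (2 * 2 ^ m) _ E).
        replace (NtoC (2 * 2 ^ m) * (z / NtoC (2 * 2 ^ m))) with z in H
          by (field; exact H0); exact H. }
      field; auto.
    + apply Cmult_neq_0; [apply RtoC_neq_0; lra|exact Hz0].
  - apply (Clim_csum (fun j m => coth_pair_term z (2 * 2 ^ m) j / NtoC (2 * 2 ^ m))); intros j Hj.
    eapply Clim_ext; [|apply Clim_mult; [apply Clim_mult; [apply Clim_mult;
       [apply (Clim_const 2)|apply (Clim_exp2pi_frac z)]|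
       apply Clim_plus; [apply (Clim_exp2pi_frac_1 z)|apply (Clim_const 1)]]|
       apply Clim_inv; [|apply Clim_plus; [apply Clim_mult; apply (Clim_exp2pi_frac z)|
         apply Clim_mult; [apply (Clim_exp2pi_frac_1 z)|
           apply Clim_mult; [apply (Clim_const 4)|apply Clim_mult; apply (Clim_sin_frac j)]]]]]].
    + intros m; cbv beta.
      assert (HM : (1 <= 2 * 2 ^ m)%nat) by (assert (H := Nat.pow_nonzero 2 m); lia).
      assert (H0 := NtoC_neq_0 _ HM).
      rewrite coth_pair_term_formula by assumption.
      assert (Hd := coth_pair_term_denom z _ j HM Hz).
      set (M := NtoC (2 * 2 ^ m)) in *; set (e := exp2pi (z / M)) in *.
      rewrite !RtoC_mult in *.
      set (s := RtoC (sin _)) in *.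
      (* Numerator and denominator are scaled by powers of [M] so that only [e], [M * (e - 1)] and
         [M * s] occur, whose limits are known. *)
      replace (M * (e - 1) * (M * (e - 1)) + e * (4 * (M * s * (M * s))))
        with (M * M * ((e - 1) * (e - 1) + e * (4 * (s * s)))) by ring.
      field; auto.
    + replace (RtoC (2 * PI) * z * (RtoC (2 * PI) * z)
         + 1 * (4 * (RtoC (PI * INR j) * RtoC (PI * INR j))))
        with (4 * (RtoC PI * RtoC PI) * (z * z + NtoC j * NtoC j))
        by (rewrite !RtoC_mult; unfold NtoC; ring).
      repeat apply Cmult_neq_0; try exact HPC;
        [apply RtoC_neq_0; lra|now apply exp2pi_neq_1_sqr]. }
assert (Hb := Clim_bound _ _ (ccoth z) (120 * Cmod z / INR J) J Hl
  (fun m Hm => ccoth_pair_sum_tail z m J Hz ltac:(lia) HJN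
     ltac:(assert (H := Nat.pow_gt_lin_r 2 m ltac:(lia)); lia))).
replace (csum (fun k => 2 * z / (z * z + NtoC k * NtoC k)) J - (RtoC PI * ccoth z - 1 / z))
  with (RtoC PI * ((1 + 1) * / (RtoC (2 * PI) * z)
   + csum (fun j => 2 * (RtoC (2 * PI) * z) * (1 + 1)
      * / ((RtoC (2 * PI) * z) * (RtoC (2 * PI) * z)
           + 1 * (4 * (RtoC (PI * INR j) * RtoC (PI * INR j))))) J - ccoth z)).
- rewrite Cmod_mult, Cmod_R, Rabs_right by lra.
  replace (PI * (120 * Cmod z) / INR J)%R with (PI * (120 * Cmod z / INR J))%R by (field; lra).
  apply Rmult_le_compat_l; lra.
- rewrite (csum_ext (fun k => 2 * z / (z * z + NtoC k * NtoC k))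
    (fun k => RtoC PI * (2 * (RtoC (2 * PI) * z) * (1 + 1)
      * / ((RtoC (2 * PI) * z) * (RtoC (2 * PI) * z)
           + 1 * (4 * (RtoC (PI * INR k) * RtoC (PI * INR k))))))).
  + rewrite (csum_scal (RtoC PI)), RtoC_mult; field; auto.
  + intros k Hk.
    replace (RtoC (2 * PI) * z * (RtoC (2 * PI) * z)
         + 1 * (4 * (RtoC (PI * INR k) * RtoC (PI * INR k))))
      with (4 * (RtoC PI * RtoC PI) * (z * z + NtoC k * NtoC k))
      by (rewrite !RtoC_mult; unfold NtoC; ring).
    assert (H := exp2pi_neq_1_sqr z k Hz).
    rewrite !RtoC_mult; field; auto.
Qed.

(** * Derivatives along a path *)

(** Componentwise, so that the real mean value theorem applies. *)
Definition is_Cderive (F : R -> C) (t : R) (l : C) : Prop :=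
  is_derive (fun s => Re (F s)) t (Re l) /\ is_derive (fun s => Im (F s)) t (Im l).

Lemma is_Cderive_const (c : C) (t : R) : is_Cderive (fun _ => c) t 0.
Proof. split; exact (is_derive_const _ t). Qed.

Lemma is_Cderive_plus (F G : R -> C) (t : R) (l m : C) :
  is_Cderive F t l -> is_Cderive G t m -> is_Cderive (fun s => F s + G s) t (l + m).
Proof.
intros [F1 F2] [G1 G2]; split.
- exact (is_derive_plus _ _ t _ _ F1 G1).
- exact (is_derive_plus _ _ t _ _ F2 G2).
Qed.

Lemma is_Cderive_minus (F G : R -> C) (t : R) (l m : C) :
  is_Cderive F t l -> is_Cderive G t m -> is_Cderive (fun s => F s - G s) t (l - m).
Proof.
intros [F1 F2] [G1 G2]; split.
- exact (is_derive_minus _ _ t _ _ F1 G1).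
- exact (is_derive_minus _ _ t _ _ F2 G2).
Qed.

Lemma is_Cderive_mult (F G : R -> C) (t : R) (l m : C) :
  is_Cderive F t l -> is_Cderive G t m ->
  is_Cderive (fun s => F s * G s) t (l * G t + F t * m).
Proof.
intros [F1 F2] [G1 G2]; split.
- replace (Re (l * G t + F t * m)) with
    (Re l * Re (G t) + Re (F t) * Re m - (Im l * Im (G t) + Im (F t) * Im m))%R
    by (unfold Cplus, Cmult, Re, Im; simpl; ring).
  exact (is_derive_minus _ _ t _ _
    (is_derive_mult _ _ t _ _ F1 G1 Rmult_comm) (is_derive_mult _ _ t _ _ F2 G2 Rmult_comm)).
- replace (Im (l * G t + F t * m)) with
    (Re l * Im (G t) + Re (F t) * Im m + (Im l * Re (G t) + Im (F t) * Re m))%R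
    by (unfold Cplus, Cmult, Re, Im; simpl; ring).
  exact (is_derive_plus _ _ t _ _
    (is_derive_mult _ _ t _ _ F1 G2 Rmult_comm) (is_derive_mult _ _ t _ _ F2 G1 Rmult_comm)).
Qed.

Lemma is_Cderive_inv (F : R -> C) (t : R) (l : C) :
  F t <> 0 -> is_Cderive F t l -> is_Cderive (fun s => / F s) t (- l / (F t * F t)).
Proof.
intros H0 [F1 F2].
set (N := fun s => (Re (F s) * Re (F s) + Im (F s) * Im (F s))%R).
assert (HN0 : N t <> 0%R).
{ intros E; apply H0; unfold N in E; apply injective_projections; simpl.
  - fold (Re (F t)); nra.
  - fold (Im (F t)); nra. }
assert (HN : is_derive N t (Re l * Re (F t) + Re (F t) * Re l
   + (Im l * Im (F t) + Im (F t) * Im l))%R).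
{ exact (is_derive_plus _ _ t _ _
    (is_derive_mult _ _ t _ _ F1 F1 Rmult_comm) (is_derive_mult _ _ t _ _ F2 F2 Rmult_comm)). }
apply is_derive_inv in HN; [|exact HN0].
assert (E1 : forall s, (Re (F s) * / N s)%R = Re (/ F s)).
{ intros s; unfold N, Cinv, Re, Im; simpl; unfold Rdiv; f_equal; f_equal; ring. }
assert (E2 : forall s, (- (Im (F s)) * / N s)%R = Im (/ F s)).
{ intros s; unfold N, Cinv, Re, Im; simpl; unfold Rdiv; f_equal; f_equal; ring. }
assert (HF2 : F t * F t <> 0) by now apply Cmult_neq_0.
assert (HNC : - l / (F t * F t)
  = - l * (Cconj (F t) * Cconj (F t)) / RtoC (N t * N t)).
{ assert (E : RtoC (N t) = F t * Cconj (F t)).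
  { unfold N, RtoC, Cmult, Cconj, Re, Im; simpl; f_equal; ring. }
  rewrite RtoC_mult, E.
  assert (Hc : Cconj (F t) <> 0).
  { intros Ec; apply HN0; apply RtoC_inj; rewrite E, Ec; ring. }
  field; auto. }
rewrite HNC; unfold Cdiv; rewrite <- RtoC_inv by nra.
split.
- apply (is_derive_ext (fun s => Re (F s) * / N s)%R); [exact E1|].
  evar_last; [exact (is_derive_mult _ _ t _ _ F1 HN Rmult_comm)|].
  unfold plus, mult; simpl; unfold Cplus, Cmult, Cconj, Copp, Re, Im in *; simpl.
  unfold N, Re, Im in *; simpl in *; field; exact HN0.
- apply (is_derive_ext (fun s => - Im (F s) * / N s)%R); [exact E2|].
  evar_last; [exact (is_derive_mult _ _ t _ _ (is_derive_opp _ _ _ F2) HN Rmult_comm)|].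
  unfold plus, mult, opp; simpl; unfold Cplus, Cmult, Cconj, Copp, Re, Im in *; simpl.
  unfold N, Re, Im in *; simpl in *; field; exact HN0.
Qed.

Lemma is_Cderive_csum (F : nat -> R -> C) (l : nat -> C) (t : R) (n : nat) :
  (forall k, (1 <= k <= n)%nat -> is_Cderive (F k) t (l k)) ->
  is_Cderive (fun s => csum (fun k => F k s) n) t (csum l n).
Proof.
induction n as [|n IH]; intros H; simpl; [apply is_Cderive_const|].
apply is_Cderive_plus; [apply IH; intros; apply H; lia|apply H; lia].
Qed.

Lemma is_Cderive_Cexp (c : C) (t : R) :
  is_Cderive (fun s => Cexp (c * RtoC s)) t (c * Cexp (c * RtoC t)).
Proof.
destruct c as [a b].
assert (E : forall s : R, Cexp ((a, b) * RtoC s)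
  = ((exp (a * s) * cos (b * s))%R, (exp (a * s) * sin (b * s))%R)).
{ intros s; unfold Cexp; simpl.
  replace (a * s - b * 0)%R with (a * s)%R by ring.
  now replace (a * 0 + b * s)%R with (b * s)%R by ring. }
rewrite E; split.
- apply (is_derive_ext (fun s => exp (a * s) * cos (b * s))%R).
  + intros s; now rewrite E.
  + simpl; auto_derive; [exact I|ring].
- apply (is_derive_ext (fun s => exp (a * s) * sin (b * s))%R).
  + intros s; now rewrite E.
  + simpl; auto_derive; [exact I|ring].
Qed.

(** The mean value theorem is applied to both components, at different intermediate points; hence
    the factor 2. *)
Lemma Cmean_value_bound (F F' : R -> C) (T B : R) : (0 <= T <= 1)%R ->
  (forall t, (0 <= t <= T)%R -> is_Cderive F t (F' t)) ->
  (forall t, (0 <= t <= T)%R -> (Cmod (F' t) <= B)%R) ->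
  (Cmod (F T - F 0%R) <= 2 * B)%R.
Proof.
intros HT HF HB.
assert (HB0 : (0 <= B)%R).
{ eapply Rle_trans; [apply Cmod_ge_0|apply (HB 0%R); lra]. }
eapply Rle_trans; [apply Cmod_le_Re_Im|].
destruct (MVT_gen (fun s => Re (F s)) 0 T (fun s => Re (F' s))) as [c1 [Hc1 E1]].
{ intros x; rewrite Rmin_left, Rmax_right by lra; intros Hx; apply (HF x); lra. }
{ intros x; rewrite Rmin_left, Rmax_right by lra; intros Hx.
  apply continuity_pt_filterlim, (ex_derive_continuous (fun s => Re (F s))).
  exists (Re (F' x)); apply (HF x); lra. }
destruct (MVT_gen (fun s => Im (F s)) 0 T (fun s => Im (F' s))) as [c2 [Hc2 E2]].
{ intros x; rewrite Rmin_left, Rmax_right by lra; intros Hx; apply (HF x); lra. }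
{ intros x; rewrite Rmin_left, Rmax_right by lra; intros Hx.
  apply continuity_pt_filterlim, (ex_derive_continuous (fun s => Im (F s))).
  exists (Im (F' x)); apply (HF x); lra. }
rewrite Rmin_left, Rmax_right in Hc1, Hc2 by lra.
change (Re (F T - F 0%R)) with (Re (F T) - Re (F 0))%R.
change (Im (F T - F 0%R)) with (Im (F T) - Im (F 0))%R.
rewrite E1, E2, !Rabs_mult, Rminus_0_r, (Rabs_right T) by lra.
assert (H1 := re_le_Cmod (F' c1)); assert (H2 := im_le_Cmod (F' c2)).
assert (H3 := HB c1 Hc1); assert (H4 := HB c2 Hc2).
assert (H5 := Rabs_pos (Re (F' c1))); assert (H6 := Rabs_pos (Im (F' c2))).
nra.
Qed.

(** * Linear forms: telescoping and lower bounds *)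

(** For consecutive values [q], [p = q + b] of the linear form,
    [1 / (p q) = (1 / b) (1 / q - 1 / p)] telescopes, and [1 / p² - 1 / (p q) = - b / (p² q)] is one
    order smaller. *)
Lemma inv_sqr_telescope (a b : C) (n : nat) : b <> 0 ->
  (forall k, a + b * NtoC k <> 0) ->
  csum (fun k => / ((a + b * NtoC k) * (a + b * NtoC k))) n
  = / b * (/ a - / (a + b * NtoC n))
    + csum (fun k => - b / ((a + b * NtoC k) * (a + b * NtoC k)
                            * (a + b * NtoC (pred k)))) n.
Proof.
intros Hb Hp; induction n as [|n IH].
- simpl; unfold NtoC; simpl; replace (a + b * 0) with a by ring; ring.
- rewrite !csum_S, IH; simpl pred.
  assert (H1 := Hp (S n)); assert (H0 := Hp n).
  rewrite NtoC_S in *.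
  set (p := a + b * NtoC n) in *.
  replace (a + b * (NtoC n + 1)) with (p + b) in * by (unfold p; ring).
  assert (Ha : a <> 0).
  { intros E; apply (Hp 0%nat); rewrite E; unfold NtoC; simpl; ring. }
  field; auto.
Qed.

Lemma inv_cube_bound (b p q : C) (A X Y : R) : (0 < X)%R -> (0 < Y)%R ->
  (Cmod b <= A)%R -> (X <= Cmod p)%R -> (Y <= Cmod q)%R ->
  (Cmod (- b / (p * p * q)) <= A / (X * X * Y))%R.
Proof.
intros HX HY Hb Hp Hq.
assert (Hp0 : p <> 0) by (apply Cmod_gt_0; lra).
assert (Hq0 : q <> 0) by (apply Cmod_gt_0; lra).
rewrite Cmod_div, !Cmod_mult, Cmod_opp by (repeat apply Cmult_neq_0; assumption).
assert (HXX : (0 < X * X)%R) by nra.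
assert (Hpp : (X * X <= Cmod p * Cmod p)%R) by nra.
unfold Rdiv; apply Rmult_le_compat; [apply Cmod_ge_0| |exact Hb|].
- left; apply Rinv_0_lt_compat; apply Rmult_lt_0_compat; lra.
- apply Rinv_le_contravar; [apply Rmult_lt_0_compat; lra|].
  apply Rmult_le_compat; lra.
Qed.

Definition is_unit_imag (s : C) : Prop := s = Ci \/ s = - Ci.

(* Quantitative form of [0 < Re al], with constants that stay fixed along a path. *)
Definition sectorial (al : C) (d A : R) : Prop :=
  (0 < d <= 1)%R /\ (1 <= A)%R /\ (Cmod al <= A)%R /\
  forall s, is_unit_imag s -> forall n r : nat,
    (d * (INR n + INR r) <= Cmod (al * NtoC n + s * NtoC r))%R.

Lemma Cmod_unit_imag (s : C) : is_unit_imag s -> Cmod s = 1%R.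
Proof. intros [->| ->]; [|rewrite Cmod_opp]; apply Cmod_Ci. Qed.

(** With [p = al n + s r], the real part gives [rho n <= |p|], and then [r <= |p| + A n]. Adding
    [rho n] and [rho r] yields [rho (n + r) <= (1 + rho + A) |p|]. *)
Lemma sectorial_of_Re (al : C) (rho A : R) : (0 < rho <= 1)%R -> (1 <= A)%R ->
  (rho <= Re al)%R -> (Cmod al <= A)%R -> sectorial al (rho / (1 + rho + A)) A.
Proof.
intros Hr HA Hre Hm; split; [|split; [exact HA|split; [exact Hm|]]].
- split; [apply Rdiv_lt_0_compat; lra|].
  apply Rmult_le_reg_r with (1 + rho + A)%R; [lra|].
  unfold Rdiv; rewrite Rmult_assoc, Rinv_l by lra; lra.
- intros s Hs n r.
  set (p := al * NtoC n + s * NtoC r).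
  assert (Hn := pos_INR n); assert (Hrr := pos_INR r).
  assert (H1 : (rho * INR n <= Cmod p)%R).
  { eapply Rle_trans; [|apply re_le_Cmod].
    eapply Rle_trans; [|apply Rle_abs].
    replace (Re p) with (Re al * INR n)%R.
    - apply Rmult_le_compat_r; lra.
    - unfold p, NtoC; destruct Hs as [->| ->]; unfold Re, Ci, RtoC; simpl; ring. }
  assert (H2 : (INR r <= Cmod p + A * INR n)%R).
  { assert (H := Cmod_minus_le p (al * NtoC n)).
    replace (p - al * NtoC n) with (s * NtoC r) in H by (unfold p; ring).
    rewrite !Cmod_mult, (Cmod_unit_imag s Hs), !Cmod_NtoC in H.
    assert (Cmod al * INR n <= A * INR n)%R by (apply Rmult_le_compat_r; lra).
    lra. }
  apply Rmult_le_reg_r with (1 + rho + A)%R; [lra|].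
  replace (rho / (1 + rho + A) * (INR n + INR r) * (1 + rho + A))%R
    with (rho * (INR n + INR r))%R by (field; lra).
  nra.
Qed.

Lemma unit_imag_sqr (s : C) : is_unit_imag s -> s * s = - (1).
Proof. intros [->| ->]; apply injective_projections; simpl; ring. Qed.

Lemma unit_imag_neq_0 (s : C) : is_unit_imag s -> s <> 0.
Proof. intros H; apply Cmod_gt_0; rewrite (Cmod_unit_imag s H); lra. Qed.

Lemma sectorial_neq_0 (al : C) (d A : R) (s : C) (n r : nat) :
  sectorial al d A -> is_unit_imag s -> (1 <= n + r)%nat ->
  al * NtoC n + s * NtoC r <> 0.
Proof.
intros [Hd [_ [_ H]]] Hs Hnr; apply Cmod_gt_0.
eapply Rlt_le_trans; [|apply H; exact Hs].
rewrite <- plus_INR; apply Rmult_lt_0_compat; [lra|].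
apply lt_0_INR; lia.
Qed.

Lemma sectorial_alpha_neq_0 (al : C) (d A : R) : sectorial al d A -> al <> 0.
Proof.
intros H E; apply (sectorial_neq_0 al d A Ci 1 0 H); [now left|lia|].
rewrite E; unfold NtoC; simpl; ring.
Qed.

Definition psi (al : C) (n r : nat) : C :=
  al / (al * al * (NtoC n * NtoC n) + NtoC r * NtoC r).

(** The derivative of [psi] with respect to [ln al]. With [p] and [q] the two linear factors of the
    form, [2 n psi = 1 / p + 1 / q]: the factor [al] in [psi] is there to leave only inverse
    squares. *)
Definition dpsi (al : C) (n r : nat) : C :=
  - (al / 2) * (/ ((al * NtoC n + Ci * NtoC r) * (al * NtoC n + Ci * NtoC r))
                + / ((al * NtoC n + - Ci * NtoC r) * (al * NtoC n + - Ci * NtoC r))).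

Lemma quad_factor (al u v : C) :
  al * al * (u * u) + v * v = (al * u + Ci * v) * (al * u + - Ci * v).
Proof.
transitivity (al * al * (u * u) - (Ci * Ci) * (v * v)); [|ring].
rewrite (unit_imag_sqr Ci (or_introl eq_refl)); ring.
Qed.

Lemma is_Cderive_psi (al : R -> C) (c : C) (t : R) (d A : R) (n r : nat) :
  (1 <= n + r)%nat -> sectorial (al t) d A -> is_Cderive al t (c * al t) ->
  is_Cderive (fun s => psi (al s) n r) t (c * dpsi (al t) n r).
Proof.
intros Hnr Hs Ha.
assert (Hp := sectorial_neq_0 (al t) d A Ci n r Hs (or_introl eq_refl) Hnr).
assert (Hq := sectorial_neq_0 (al t) d A (- Ci) n r Hs (or_intror eq_refl) Hnr).
assert (Hf := quad_factor (al t) (NtoC n) (NtoC r)).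
assert (H0 : al t * al t * (NtoC n * NtoC n) + NtoC r * NtoC r <> 0)
  by (rewrite Hf; now apply Cmult_neq_0).
unfold psi, Cdiv.
assert (H := is_Cderive_mult _ _ t _ _ Ha
  (is_Cderive_inv (fun s => al s * al s * (NtoC n * NtoC n) + NtoC r * NtoC r) t _ H0
    (is_Cderive_plus _ _ t _ _
      (is_Cderive_mult _ _ t _ _ (is_Cderive_mult _ _ t _ _ Ha Ha)
         (is_Cderive_const (NtoC n * NtoC n) t))
      (is_Cderive_const (NtoC r * NtoC r) t)))).
cbv beta in H.
match type of H with is_Cderive _ _ ?x => replace (c * dpsi (al t) n r) with x; [exact H|] end.
clear H; rewrite Hf; unfold dpsi.
assert (Hc : Ci * Ci = - (1)) by (apply unit_imag_sqr; now left).
set (p := al t * NtoC n + Ci * NtoC r) in *.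
set (q := al t * NtoC n + - Ci * NtoC r) in *.
replace (((c * al t * al t + al t * (c * al t)) * (NtoC n * NtoC n)
   + al t * al t * 0 + 0)) with (c * ((p + q) * (p + q)) / 2)
  by (unfold p, q; field).
field; auto.
Qed.

(** * Telescoped derivatives of the lattice sums *)

Lemma Cmod_inv_le (z : C) (x : R) : (0 < x)%R -> (x <= Cmod z)%R -> (Cmod (/ z) <= / x)%R.
Proof.
intros Hx H; rewrite Cmod_inv by (apply Cmod_gt_0; lra).
now apply Rinv_le_contravar.
Qed.

(** Both edges are telescoped from the corner [k = R0] to [N]. The corner values combine through [1
    / (al (s + al)) + 1 / (s (s + al)) = 1 / (al s)]. The 4 counts two cubic error sums and two
    values at [N], the latter small because [R0 * R0 <= N]. *)
Lemma dpsi_edge_sigma (al s : C) (d A : R) (R0 N : nat) :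
  sectorial al d A -> is_unit_imag s -> (1 <= R0)%nat -> (R0 * R0 <= N)%nat ->
  let S1 := fun k => / ((s * NtoC R0 + al * NtoC k) * (s * NtoC R0 + al * NtoC k)) in
  let S2 := fun k => / ((al * NtoC R0 + s * NtoC k) * (al * NtoC R0 + s * NtoC k)) in
  (Cmod ((csum S1 N - csum S1 R0) + (csum S2 N - csum S2 R0) - / (al * s * NtoC R0))
   <= 4 * A / (d * d * d) / (INR R0 * INR R0))%R.
Proof.
intros Hs Hi HR HN S1 S2.
assert (Hal := sectorial_alpha_neq_0 al d A Hs).
assert (Hs0 := unit_imag_neq_0 s Hi).
assert (Hsec := Hs); destruct Hsec as [Hd [HA [Hm Hlow]]].
assert (HR1 := INR_ge_1 R0 HR).
assert (HRN : (R0 <= N)%nat) by nia.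
assert (HRR : (INR R0 * INR R0 <= INR N)%R) by (rewrite <- mult_INR; now apply le_INR).
assert (HN1 : (1 <= INR N)%R) by (apply INR_ge_1; lia).
assert (Hp1 : forall k, s * NtoC R0 + al * NtoC k <> 0).
{ intros k; rewrite Cplus_comm; apply (sectorial_neq_0 al d A); auto; lia. }
assert (Hp2 : forall k, al * NtoC R0 + s * NtoC k <> 0).
{ intros k; apply (sectorial_neq_0 al d A); auto; lia. }
assert (Hl1 : forall k, (d * (INR k + INR R0) <= Cmod (s * NtoC R0 + al * NtoC k))%R).
{ intros k; rewrite Cplus_comm; now apply Hlow. }
assert (Hl2 : forall k, (d * (INR R0 + INR k) <= Cmod (al * NtoC R0 + s * NtoC k))%R).
{ intros k; now apply Hlow. }
unfold S1, S2; rewrite !inv_sqr_telescope by assumption.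
set (e1 := fun k => - al / ((s * NtoC R0 + al * NtoC k) * (s * NtoC R0 + al * NtoC k)
   * (s * NtoC R0 + al * NtoC (pred k)))).
set (e2 := fun k => - s / ((al * NtoC R0 + s * NtoC k) * (al * NtoC R0 + s * NtoC k)
   * (al * NtoC R0 + s * NtoC (pred k)))).
assert (HR0 := NtoC_neq_0 R0 HR).
set (K := (A / (d * d * d) / INR R0)%R).
assert (Hddd : (0 < d * d * d)%R) by (repeat apply Rmult_lt_0_compat; lra).
assert (HK : (0 <= K)%R) by (unfold K; repeat apply Rdiv_le_0_compat; lra).
assert (Hcubes : forall k, (R0 < k <= N)%nat ->
  (A / (d * INR k * (d * INR k) * (d * INR R0)) = K / (INR k)²)%R).
{ intros k Hk; assert (H := INR_ge_1 k ltac:(lia)); unfold K, Rsqr; field; lra. }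
assert (Hpred : forall k, (R0 < k <= N)%nat -> (INR R0 <= INR (pred k) + INR R0)%R).
{ intros k Hk; assert (H := pos_INR (pred k)); lra. }
assert (He1 : (Cmod (csum e1 N - csum e1 R0) <= K * (/ INR R0 - / INR N))%R).
{ apply Cmod_csum_tail; [lia|exact HK|]; intros k Hk.
  assert (H := INR_ge_1 k ltac:(lia)); rewrite <- Hcubes by exact Hk.
  apply inv_cube_bound; [nra|nra|exact Hm| |].
  - eapply Rle_trans; [|apply Hl1]; apply Rmult_le_compat_l; lra.
  - eapply Rle_trans; [|apply Hl1]; apply Rmult_le_compat_l; [lra|now apply Hpred]. }
assert (He2 : (Cmod (csum e2 N - csum e2 R0) <= K * (/ INR R0 - / INR N))%R).
{ apply Cmod_csum_tail; [lia|exact HK|]; intros k Hk.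
  assert (H := INR_ge_1 k ltac:(lia)); rewrite <- Hcubes by exact Hk.
  apply inv_cube_bound; [nra|nra|rewrite (Cmod_unit_imag s Hi); exact HA| |].
  - eapply Rle_trans; [|apply Hl2]; apply Rmult_le_compat_l; lra.
  - eapply Rle_trans; [|apply Hl2]; apply Rmult_le_compat_l; [lra|].
    specialize (Hpred k Hk); lra. }
assert (Hc : (s + al) <> 0).
{ intros E; apply (Hp1 R0); replace (s * NtoC R0 + al * NtoC R0) with ((s + al) * NtoC R0) by ring.
  rewrite E; ring. }
replace (/ al * (/ (s * NtoC R0) - / (s * NtoC R0 + al * NtoC N)) + csum e1 N -
   (/ al * (/ (s * NtoC R0) - / (s * NtoC R0 + al * NtoC R0)) + csum e1 R0) +
   (/ s * (/ (al * NtoC R0) - / (al * NtoC R0 + s * NtoC N)) + csum e2 N -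
    (/ s * (/ (al * NtoC R0) - / (al * NtoC R0 + s * NtoC R0)) + csum e2 R0)) -
   / (al * s * NtoC R0))
  with ((csum e1 N - csum e1 R0) + (csum e2 N - csum e2 R0)
     - (/ al * / (s * NtoC R0 + al * NtoC N) + / s * / (al * NtoC R0 + s * NtoC N))).
2:{ replace (s * NtoC R0 + al * NtoC R0) with ((s + al) * NtoC R0) by ring.
    replace (al * NtoC R0 + s * NtoC R0) with ((s + al) * NtoC R0) by ring.
    assert (H1 := Hp1 N); assert (H2 := Hp2 N); field; repeat split; auto. }
assert (Hinv : (0 < / d)%R) by (apply Rinv_0_lt_compat; lra).
assert (Hi1 : (Cmod (/ al * / (s * NtoC R0 + al * NtoC N)) <= / d * / (d * INR N))%R).
{ rewrite Cmod_mult; apply Rmult_le_compat; try apply Cmod_ge_0.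
  - apply Cmod_inv_le; [lra|].
    assert (H := Hlow s Hi 1%nat 0%nat); unfold NtoC in H; simpl in H.
    replace (al * 1 + s * 0) with al in H by ring; lra.
  - apply Cmod_inv_le; [apply Rmult_lt_0_compat; lra|].
    eapply Rle_trans; [|apply Hl1]; apply Rmult_le_compat_l; lra. }
assert (Hi2 : (Cmod (/ s * / (al * NtoC R0 + s * NtoC N)) <= / d * / (d * INR N))%R).
{ rewrite Cmod_mult; apply Rmult_le_compat; try apply Cmod_ge_0.
  - apply Cmod_inv_le; [lra|rewrite (Cmod_unit_imag s Hi); lra].
  - apply Cmod_inv_le; [apply Rmult_lt_0_compat; lra|].
    eapply Rle_trans; [|apply Hl2]; apply Rmult_le_compat_l; lra. }
assert (Hfin : (/ d * / (d * INR N) <= A / (d * d * d) / (INR R0 * INR R0))%R).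
{ replace (/ d * / (d * INR N))%R with (/ (d * d) * / INR N)%R by (field; lra).
  unfold Rdiv; apply Rmult_le_compat.
  - left; apply Rinv_0_lt_compat; nra.
  - left; apply Rinv_0_lt_compat; lra.
  - apply Rle_trans with (1 * / (d * d * d))%R.
    + rewrite Rmult_1_l; apply Rinv_le_contravar; [exact Hddd|nra].
    + apply Rmult_le_compat_r; [left; apply Rinv_0_lt_compat|]; lra.
  - apply Rinv_le_contravar; [nra|exact HRR]. }
assert (HKR : (K * (/ INR R0 - / INR N) <= A / (d * d * d) / (INR R0 * INR R0))%R).
{ replace (A / (d * d * d) / (INR R0 * INR R0))%R with (K * / INR R0)%R by (unfold K; field; lra).
  assert (0 < / INR N)%R by (apply Rinv_0_lt_compat; lra).
  apply Rmult_le_compat_l; lra. }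
eapply Rle_trans; [apply Cmod_minus_le|].
eapply Rle_trans; [apply Rplus_le_compat; apply Cmod_triangle|].
replace (4 * A / (d * d * d) / (INR R0 * INR R0))%R
  with (4 * (A / (d * d * d) / (INR R0 * INR R0)))%R by (field; lra).
lra.
Qed.

(** What telescoping over [r] leaves, up to sign, of row [n = k] of the antisymmetrised [dpsi]:
    values on the two sides of the square of side [R0]. *)
Definition edge (al : C) (R0 k : nat) : C :=
  NtoC R0 * psi al k R0 + NtoC R0 * psi al R0 k.

Definition dedge (al : C) (R0 k : nat) : C :=
  NtoC R0 * dpsi al k R0 + NtoC R0 * dpsi al R0 k.

(* The boundary terms of the two telescoped sums cancel at the corner [k = R0]. *)
Lemma dedge_bound (al : C) (d A : R) (R0 N : nat) :
  sectorial al d A -> (1 <= R0)%nat -> (R0 * R0 <= N)%nat ->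
  (Cmod (csum (dedge al R0) N - csum (dedge al R0) R0)
   <= 4 * (A * A) / (d * d * d) / INR R0)%R.
Proof.
intros Hs HR HN.
assert (H1 := dpsi_edge_sigma al Ci d A R0 N Hs (or_introl eq_refl) HR HN).
assert (H2 := dpsi_edge_sigma al (- Ci) d A R0 N Hs (or_intror eq_refl) HR HN).
cbv zeta in H1, H2.
assert (Hal := sectorial_alpha_neq_0 al d A Hs).
assert (HR0 := NtoC_neq_0 R0 HR).
set (S1 := fun k => / ((Ci * NtoC R0 + al * NtoC k) * (Ci * NtoC R0 + al * NtoC k))) in *.
set (S2 := fun k => / ((al * NtoC R0 + Ci * NtoC k) * (al * NtoC R0 + Ci * NtoC k))) in *.
set (S3 := fun k => / ((- Ci * NtoC R0 + al * NtoC k) * (- Ci * NtoC R0 + al * NtoC k))) in *.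
set (S4 := fun k => / ((al * NtoC R0 + - Ci * NtoC k) * (al * NtoC R0 + - Ci * NtoC k))) in *.
assert (E : forall n, csum (dedge al R0) n
  = - (al * NtoC R0 / 2) * (csum S1 n + csum S2 n + csum S3 n + csum S4 n)).
{ intros n; rewrite <- !csum_plus, <- csum_scal; apply csum_ext; intros k Hk.
  unfold dedge, dpsi, S1, S2, S3, S4.
  rewrite (Cplus_comm (Ci * NtoC R0)), (Cplus_comm (- Ci * NtoC R0)).
  unfold Cdiv; ring. }
rewrite !E.
set (X1 := csum S1 N - csum S1 R0 + (csum S2 N - csum S2 R0) - / (al * Ci * NtoC R0)) in *.
set (X2 := csum S3 N - csum S3 R0 + (csum S4 N - csum S4 R0) - / (al * - Ci * NtoC R0)) in *.
replace (- (al * NtoC R0 / 2) * (csum S1 N + csum S2 N + csum S3 N + csum S4 N) -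
   - (al * NtoC R0 / 2) * (csum S1 R0 + csum S2 R0 + csum S3 R0 + csum S4 R0))
  with (- (al * NtoC R0 / 2) * (X1 + X2)).
2:{ unfold X1, X2; field; repeat split; auto; exact Ci_nz. }
destruct Hs as [Hd [HA [Hm _]]].
assert (HR1 := INR_ge_1 R0 HR).
rewrite Cmod_mult, Cmod_opp, Cmod_div, Cmod_mult, Cmod_NtoC, Cmod_R, (Rabs_right 2)
  by (lra || (apply RtoC_neq_0; lra)).
assert (H3 := Cmod_triangle X1 X2).
assert (Hddd : (0 < d * d * d)%R) by (repeat apply Rmult_lt_0_compat; lra).
set (K := (4 * A / (d * d * d) / (INR R0 * INR R0))%R) in *.
apply Rle_trans with (A * INR R0 / 2 * (2 * K))%R.
- apply Rmult_le_compat; [|apply Cmod_ge_0| |lra].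
  + assert (H := Cmod_ge_0 al); assert (0 <= Cmod al * INR R0)%R by nra; lra.
  + assert (Cmod al * INR R0 <= A * INR R0)%R by (apply Rmult_le_compat_r; lra); lra.
- apply Req_le; unfold K; field; lra.
Qed.

(** The two telescoped sums start from the same value [1 / (al s n)], which cancels in the
    difference. The remaining [R0 < n] cubic errors are each at most [A / (d n)^3]. *)
Lemma dpsi_row_sigma (al s : C) (d A : R) (R0 n : nat) :
  sectorial al d A -> is_unit_imag s -> (1 <= R0 < n)%nat ->
  (Cmod (csum (fun r => (/ ((al * NtoC n + s * NtoC r) * (al * NtoC n + s * NtoC r)))%C) R0
         - csum (fun r => (/ ((s * NtoC n + al * NtoC r) * (s * NtoC n + al * NtoC r)))%C) R0
         - (- (/ s * / (al * NtoC n + s * NtoC R0))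
            + / al * / (s * NtoC n + al * NtoC R0)))
   <= 2 * A / (d * d * d) / (INR n)²)%R.
Proof.
intros Hs Hi HR.
assert (Hal := sectorial_alpha_neq_0 al d A Hs).
assert (Hs0 := unit_imag_neq_0 s Hi).
assert (Hsec := Hs); destruct Hsec as [Hd [HA [Hm Hlow]]].
assert (Hn1 : (1 <= INR n)%R) by (apply INR_ge_1; lia).
assert (HRn : (INR R0 <= INR n)%R) by (apply le_INR; lia).
assert (Hn0 : NtoC n <> 0) by (apply NtoC_neq_0; lia).
assert (Hp1 : forall k, s * NtoC n + al * NtoC k <> 0).
{ intros k; rewrite Cplus_comm; apply (sectorial_neq_0 al d A); auto; lia. }
assert (Hp2 : forall k, al * NtoC n + s * NtoC k <> 0).
{ intros k; apply (sectorial_neq_0 al d A); auto; lia. }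
assert (Hl1 : forall k, (d * INR n <= Cmod (s * NtoC n + al * NtoC k))%R).
{ intros k; rewrite Cplus_comm; eapply Rle_trans; [|now apply Hlow].
  assert (H := pos_INR k); apply Rmult_le_compat_l; lra. }
assert (Hl2 : forall k, (d * INR n <= Cmod (al * NtoC n + s * NtoC k))%R).
{ intros k; eapply Rle_trans; [|now apply Hlow].
  assert (H := pos_INR k); apply Rmult_le_compat_l; lra. }
rewrite !inv_sqr_telescope by assumption.
set (e1 := fun k => - s / ((al * NtoC n + s * NtoC k) * (al * NtoC n + s * NtoC k)
   * (al * NtoC n + s * NtoC (pred k)))).
set (e2 := fun k => - al / ((s * NtoC n + al * NtoC k) * (s * NtoC n + al * NtoC k)
   * (s * NtoC n + al * NtoC (pred k)))).
set (K := (A / (d * INR n * (d * INR n) * (d * INR n)))%R).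
assert (Hdn : (0 < d * INR n)%R) by nra.
assert (He1 : (Cmod (csum e1 R0) <= INR R0 * K)%R).
{ apply Cmod_csum_le; intros k Hk; apply inv_cube_bound; auto.
  rewrite (Cmod_unit_imag s Hi); exact HA. }
assert (He2 : (Cmod (csum e2 R0) <= INR R0 * K)%R).
{ apply Cmod_csum_le; intros k Hk; apply inv_cube_bound; auto. }
assert (HK : (0 <= K)%R).
{ unfold K; apply Rdiv_le_0_compat; [lra|]; repeat apply Rmult_lt_0_compat; lra. }
replace (/ s * (/ (al * NtoC n) - / (al * NtoC n + s * NtoC R0)) + csum e1 R0 -
   (/ al * (/ (s * NtoC n) - / (s * NtoC n + al * NtoC R0)) + csum e2 R0) -
   (- (/ s * / (al * NtoC n + s * NtoC R0)) + / al * / (s * NtoC n + al * NtoC R0)))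
  with (csum e1 R0 - csum e2 R0).
2:{ assert (H1 := Hp1 R0); assert (H2 := Hp2 R0); field; repeat split; auto. }
eapply Rle_trans; [apply Cmod_minus_le|].
apply Rle_trans with (2 * (INR n * K))%R.
- assert (INR R0 * K <= INR n * K)%R by (apply Rmult_le_compat_r; lra); lra.
- apply Req_le; unfold K, Rsqr; field; lra.
Qed.

(** Adding the contributions of [s = Ci] and [s = - Ci] recombines the inverse linear forms at
    [r = R0] into values of [psi], so that the derivative of a sum of [psi] is again expressed by
    [psi]. *)
Lemma dpsi_row_bound (al : C) (d A : R) (R0 n : nat) :
  sectorial al d A -> (1 <= R0 < n)%nat ->
  (Cmod (csum (fun r => (dpsi al n r - dpsi al r n)%C) R0 + edge al R0 n)
   <= 2 * (A * A) / (d * d * d) / (INR n)²)%R.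
Proof.
intros Hs HR.
assert (H1 := dpsi_row_sigma al Ci d A R0 n Hs (or_introl eq_refl) HR).
assert (H2 := dpsi_row_sigma al (- Ci) d A R0 n Hs (or_intror eq_refl) HR).
assert (Hal := sectorial_alpha_neq_0 al d A Hs).
set (T1 := fun r => / ((al * NtoC n + Ci * NtoC r) * (al * NtoC n + Ci * NtoC r))) in *.
set (T2 := fun r => / ((Ci * NtoC n + al * NtoC r) * (Ci * NtoC n + al * NtoC r))) in *.
set (T3 := fun r => / ((al * NtoC n + - Ci * NtoC r) * (al * NtoC n + - Ci * NtoC r))) in *.
set (T4 := fun r => / ((- Ci * NtoC n + al * NtoC r) * (- Ci * NtoC n + al * NtoC r))) in *.
assert (E : csum (fun r => dpsi al n r - dpsi al r n) R0
  = - (al / 2) * ((csum T1 R0 - csum T2 R0) + (csum T3 R0 - csum T4 R0))).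
{ rewrite <- !csum_minus, <- csum_plus, <- csum_scal; apply csum_ext; intros r Hr.
  unfold dpsi, T1, T2, T3, T4.
  rewrite (Cplus_comm (Ci * NtoC n)), (Cplus_comm (- Ci * NtoC n)); ring. }
rewrite E.
set (X1 := csum T1 R0 - csum T2 R0 - (- (/ Ci * / (al * NtoC n + Ci * NtoC R0))
   + / al * / (Ci * NtoC n + al * NtoC R0))) in *.
set (X2 := csum T3 R0 - csum T4 R0 - (- (/ - Ci * / (al * NtoC n + - Ci * NtoC R0))
   + / al * / (- Ci * NtoC n + al * NtoC R0))) in *.
replace (- (al / 2) * (csum T1 R0 - csum T2 R0 + (csum T3 R0 - csum T4 R0)) + edge al R0 n)
  with (- (al / 2) * (X1 + X2)).
2:{ unfold X1, X2, edge, psi; rewrite !quad_factor.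
    assert (G1 := sectorial_neq_0 al d A Ci n R0 Hs (or_introl eq_refl) ltac:(lia)).
    assert (G2 := sectorial_neq_0 al d A (- Ci) n R0 Hs (or_intror eq_refl) ltac:(lia)).
    assert (G3 := sectorial_neq_0 al d A Ci R0 n Hs (or_introl eq_refl) ltac:(lia)).
    assert (G4 := sectorial_neq_0 al d A (- Ci) R0 n Hs (or_intror eq_refl) ltac:(lia)).
    rewrite (Cplus_comm (Ci * NtoC n)), (Cplus_comm (- Ci * NtoC n)).
    field; repeat split; auto; exact Ci_nz. }
destruct Hs as [Hd [HA [Hm _]]].
assert (Hn1 : (1 <= INR n)%R) by (apply INR_ge_1; lia).
rewrite Cmod_mult, Cmod_opp, Cmod_div, Cmod_R, (Rabs_right 2)
  by (lra || (apply RtoC_neq_0; lra)).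
assert (H3 := Cmod_triangle X1 X2).
assert (Hddd : (0 < d * d * d)%R) by (repeat apply Rmult_lt_0_compat; lra).
set (K := (2 * A / (d * d * d) / (INR n)²)%R) in *.
apply Rle_trans with (A / 2 * (2 * K))%R.
- apply Rmult_le_compat; [|apply Cmod_ge_0|lra|lra].
  assert (H := Cmod_ge_0 al); lra.
- apply Req_le; unfold K, Rsqr; field; lra.
Qed.

(** * The edge sum at [al = 1], compared with the arctangent *)

Lemma csum_telescope (g : nat -> C) (n : nat) :
  csum (fun k => g k - g (pred k)) n = g n - g 0%nat.
Proof.
induction n as [|n IH]; [simpl; ring|].
rewrite csum_S, IH; simpl pred; ring.
Qed.

Lemma atan_le_id (x : R) : (0 <= x)%R -> (0 <= atan x <= x)%R.
Proof.
intros Hx.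
destruct (MVT_gen atan 0 x (fun y => / (1 + y²))%R) as [c [Hc E]].
- intros y _; apply is_derive_atan.
- intros y _; apply continuity_pt_filterlim, (ex_derive_continuous atan).
  eexists; apply is_derive_atan.
- rewrite atan_0, !Rminus_0_r in E; rewrite E.
  assert (H0 := Rle_0_sqr c).
  assert (H : (0 < / (1 + c²) <= 1)%R).
  { split; [apply Rinv_0_lt_compat; lra|].
    rewrite <- Rinv_1 at 2; apply Rinv_le_contravar; lra. }
  nra.
Qed.

(** The first term is the derivative of [atan (x / R0)] at [x = k]; the mean value theorem moves it
    to a point of [[k - 1, k]]. As [k >= 2], that point is at least [k / 2], and
    [k (2 k) / (k² (k² / 4))] gives 8. *)
Lemma atan_step (R0 k : nat) : (1 <= R0 < k)%nat ->
  (Rabs (INR R0 / (INR k * INR k + INR R0 * INR R0)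
         - (atan (INR k / INR R0) - atan (INR (pred k) / INR R0))) <= 8 / (INR k)²)%R.
Proof.
intros HR.
assert (HR1 : (1 <= INR R0)%R) by (apply INR_ge_1; lia).
assert (Hk : (INR R0 + 1 <= INR k)%R) by (rewrite <- S_INR; apply le_INR; lia).
assert (Hpk : INR (pred k) = (INR k - 1)%R).
{ destruct k as [|k]; [lia|]; simpl pred; rewrite S_INR; ring. }
rewrite Hpk.
destruct (MVT_gen atan ((INR k - 1) / INR R0) (INR k / INR R0) (fun y => / (1 + y²))%R)
  as [c [Hc E]].
- intros y _; apply is_derive_atan.
- intros y _; apply continuity_pt_filterlim, (ex_derive_continuous atan).
  eexists; apply is_derive_atan.
- assert (Hle : ((INR k - 1) / INR R0 <= INR k / INR R0)%R).
  { unfold Rdiv; apply Rmult_le_compat_r; [left; apply Rinv_0_lt_compat; lra|lra]. }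
  rewrite Rmin_left, Rmax_right in Hc by exact Hle.
  rewrite E.
  set (x := (c * INR R0)%R).
  assert (Hx : (INR k - 1 <= x <= INR k)%R).
  { unfold x; split.
    - replace (INR k - 1)%R with ((INR k - 1) / INR R0 * INR R0)%R by (field; lra).
      apply Rmult_le_compat_r; lra.
    - apply Rle_trans with (INR k / INR R0 * INR R0)%R;
        [apply Rmult_le_compat_r; lra|right; field; lra]. }
  replace c with (x / INR R0)%R by (unfold x; field; lra).
  set (r := INR R0) in *; set (n := INR k) in *.
  assert (H1 : (n * n / 4 <= x * x)%R) by nra.
  assert (Hx2 : (x * x <= n * n)%R) by nra.
  assert (Hx3 : (n * n - x * x <= 2 * n)%R) by nra.
  replace (r / (n * n + r * r) - / (1 + (x / r)²) * (n / r - (n - 1) / r))%R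
    with (- (r * (n * n - x * x) / ((n * n + r * r) * (x * x + r * r))))%R
    by (unfold Rsqr; field; repeat split; nra).
  rewrite Rabs_Ropp, Rabs_right.
  + apply Rle_trans with (n * (2 * n) / ((n * n) * (n * n / 4)))%R.
    * unfold Rdiv at 1 2; apply Rmult_le_compat.
      -- apply Rmult_le_pos; lra.
      -- left; apply Rinv_0_lt_compat, Rmult_lt_0_compat; nra.
      -- apply Rmult_le_compat; lra.
      -- apply Rinv_le_contravar; [apply Rmult_lt_0_compat; nra|].
         apply Rmult_le_compat; nra.
    * apply Req_le; unfold Rsqr; field; lra.
  + apply Rle_ge, Rdiv_le_0_compat; [apply Rmult_le_pos; lra|apply Rmult_lt_0_compat; nra].
Qed.

Lemma edge_1 (R0 k : nat) : (1 <= R0)%nat -> edge 1 R0 k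
  = RtoC (2 * (INR R0 / (INR k * INR k + INR R0 * INR R0))).
Proof.
intros HR; assert (HR1 := INR_ge_1 R0 HR); assert (Hk := pos_INR k).
assert (H : (INR k * INR k + INR R0 * INR R0)%R <> 0%R) by nra.
unfold edge, psi, NtoC.
replace (1 * 1 * (RtoC (INR k) * RtoC (INR k)) + RtoC (INR R0) * RtoC (INR R0))
  with (RtoC (INR k * INR k + INR R0 * INR R0)) by (rewrite RtoC_plus, !RtoC_mult; ring).
replace (1 * 1 * (RtoC (INR R0) * RtoC (INR R0)) + RtoC (INR k) * RtoC (INR k))
  with (RtoC (INR k * INR k + INR R0 * INR R0)) by (rewrite RtoC_plus, !RtoC_mult; ring).
rewrite RtoC_mult, RtoC_div by exact H.
field; now apply RtoC_neq_0.
Qed.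

(** The sum is close to [2 atan (N / R0) - 2 atan 1], hence to [PI - PI / 2]. The errors of
    [atan_step], doubled, account for 16, and [2 atan (R0 / N) <= 2 / R0] for the remaining 2. *)
Lemma edge_1_bound (R0 N : nat) : (1 <= R0)%nat -> (R0 * R0 <= N)%nat ->
  (Cmod (csum (edge 1 R0) N - csum (edge 1 R0) R0 - RtoC (PI / 2)) <= 18 / INR R0)%R.
Proof.
intros HR HN.
assert (HR1 := INR_ge_1 R0 HR).
assert (HRN : (R0 <= N)%nat) by nia.
assert (HRR : (INR R0 * INR R0 <= INR N)%R) by (rewrite <- mult_INR; now apply le_INR).
set (g := fun k => RtoC (2 * atan (INR k / INR R0))).
set (e := fun k => edge 1 R0 k - (g k - g (pred k))).
assert (He : (Cmod (csum e N - csum e R0) <= 16 * (/ INR R0 - / INR N))%R).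
{ apply Cmod_csum_tail; [lia|lra|]; intros k Hk; unfold e, g.
  rewrite edge_1 by exact HR; rewrite <- !RtoC_minus, Cmod_R.
  assert (H := atan_step R0 k ltac:(lia)).
  match goal with |- (Rabs ?x <= _)%R => replace x with
    (2 * (INR R0 / (INR k * INR k + INR R0 * INR R0)
         - (atan (INR k / INR R0) - atan (INR (pred k) / INR R0))))%R by ring end.
  rewrite Rabs_mult, (Rabs_right 2) by lra.
  replace (16 / (INR k)²)%R with (2 * (8 / (INR k)²))%R by (unfold Rdiv; ring).
  lra. }
assert (Hce : forall n, csum e n = csum (edge 1 R0) n - (g n - g 0%nat)).
{ intros n; unfold e; rewrite csum_minus, csum_telescope; reflexivity. }
assert (Ha : atan (INR N / INR R0) = (PI / 2 - atan (INR R0 / INR N))%R).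
{ replace (INR R0 / INR N)%R with (/ (INR N / INR R0))%R by (field; nra).
  rewrite atan_inv; [ring|apply Rdiv_lt_0_compat; nra]. }
assert (Hb := atan_le_id (INR R0 / INR N) ltac:(apply Rdiv_le_0_compat; nra)).
assert (Hc : (INR R0 / INR N <= / INR R0)%R).
{ apply Rmult_le_reg_r with (INR N); [nra|].
  unfold Rdiv; rewrite Rmult_assoc, Rinv_l, Rmult_1_r by nra.
  apply Rmult_le_reg_l with (INR R0); [lra|].
  rewrite <- Rmult_assoc, Rinv_r by lra; lra. }
replace (csum (edge 1 R0) N - csum (edge 1 R0) R0 - RtoC (PI / 2))
  with ((csum e N - csum e R0) + RtoC (- (2 * atan (INR R0 / INR N)))).
2:{ rewrite !Hce.
    replace (g R0) with (RtoC (PI / 2)).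
    - replace (g N) with (RtoC PI + RtoC (- (2 * atan (INR R0 / INR N)))).
      + replace (RtoC PI) with (RtoC (PI / 2) + RtoC (PI / 2))
          by (rewrite <- RtoC_plus; f_equal; field).
        ring.
      + unfold g; rewrite Ha, <- RtoC_plus; f_equal; field.
    - unfold g; replace (INR R0 / INR R0)%R with 1%R by (field; lra).
      rewrite atan_1; f_equal; field. }
eapply Rle_trans; [apply Cmod_triangle|].
rewrite Cmod_R, Rabs_Ropp, Rabs_right by lra.
assert (0 < / INR N)%R by (apply Rinv_0_lt_compat; nra).
unfold Rdiv; lra.
Qed.

(** * Polar form and the path from 1 to [al] *)

(** The double angle formulas read this off the fact that [Csqrt] squares to its argument. *)
Lemma Cpolar (z : C) :
  (Cmod z * cos (Carg z) = Re z /\ Cmod z * sin (Carg z) = Im z)%R.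
Proof.
assert (H := proj1 Csqrt_determination z).
assert (Hm := sqrt_sqrt (Cmod z) (Cmod_ge_0 z)).
assert (H1 := f_equal Re H); assert (H2 := f_equal Im H).
unfold Csqrt, Cmult, Re, Im in H1, H2; simpl fst in H1, H2; simpl snd in H1, H2.
replace (Carg z) with (2 * (Carg z / 2))%R at 1 2 by field.
rewrite cos_2a, sin_2a, <- Hm; unfold Re, Im; split; nra.
Qed.

Lemma Cexp_Cln (z : C) : z <> 0 -> Cexp (Cln z) = z.
Proof.
intros Hz; apply Cmod_gt_0 in Hz; destruct (Cpolar z) as [H1 H2].
unfold Cexp, Cln; simpl; rewrite exp_ln, H1, H2 by exact Hz; now destruct z.
Qed.

Lemma Carg_right_half_plane (z : C) : (0 < Re z)%R -> (Rabs (Carg z) < PI / 2)%R.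
Proof.
intros Hz.
assert (Hm : (0 < Cmod z)%R).
{ assert (H := re_le_Cmod z); assert (H0 := Rle_abs (Re z)); lra. }
assert (H1 : (0 < Re z / Cmod z)%R) by now apply Rdiv_lt_0_compat.
assert (H2 : (Re z / Cmod z <= 1)%R).
{ apply Rmult_le_reg_r with (Cmod z); [exact Hm|].
  unfold Rdiv; rewrite Rmult_assoc, Rinv_l by lra.
  assert (H := re_le_Cmod z); assert (H0 := Rle_abs (Re z)); lra. }
assert (H3 := acos_bound (Re z / Cmod z)).
assert (H4 : (acos (Re z / Cmod z) < PI / 2)%R).
{ destruct (Rlt_or_le (acos (Re z / Cmod z)) (PI / 2)) as [|H]; [assumption|].
  assert (Hc := cos_le_0 _ H ltac:(assert (HP := PI_RGT_0); lra)).
  rewrite cos_acos in Hc by lra; lra. }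
unfold Carg; destruct (Rlt_dec (Im z) 0); [rewrite Rabs_Ropp|]; rewrite Rabs_right; lra.
Qed.

(** Along the path the modulus is [|al|^t] and the argument is [t] times that of [al]. Thus the real
    part never falls below [exp (- |L|) cos |th|], and the modulus never exceeds [exp |L|]. *)
Lemma sectorial_path (al : C) : (0 < Re al)%R ->
  exists d A, forall t, (0 <= t <= 1)%R -> sectorial (Cexp (Cln al * RtoC t)) d A.
Proof.
intros Hre.
assert (Harg := Carg_right_half_plane al Hre).
set (L := ln (Cmod al)); set (th := Carg al) in *.
assert (HP := PI_RGT_0).
assert (Hcos : (0 < cos (Rabs th))%R).
{ apply cos_gt_0; [assert (H := Rabs_pos th)|]; lra. }
set (A := exp (Rabs L)).
assert (HA : (1 <= A)%R).
{ unfold A; rewrite <- exp_0; destruct (Rabs_pos L) as [H|H];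
    [left; now apply exp_increasing|rewrite <- H; lra]. }
set (rho := (exp (- Rabs L) * cos (Rabs th))%R).
assert (He1 : (0 < exp (- Rabs L) <= 1)%R).
{ split; [apply exp_pos|].
  rewrite <- exp_0; destruct (Rabs_pos L) as [H|H];
    [left; apply exp_increasing; lra|rewrite <- H, Ropp_0; lra]. }
assert (Hrho : (0 < rho <= 1)%R).
{ assert (H := COS_bound (Rabs th)); unfold rho; split; nra. }
exists (rho / (1 + rho + A))%R, A; intros t Ht.
assert (HRe : Re (Cln al * RtoC t) = (L * t)%R) by (unfold Cln, L, Re; simpl; ring).
assert (HIm : Im (Cln al * RtoC t) = (th * t)%R) by (unfold Cln, th, Im; simpl; ring).
assert (HLt : (Rabs (L * t) <= Rabs L)%R).
{ rewrite Rabs_mult, (Rabs_right t) by lra.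
  assert (H := Rabs_pos L); nra. }
assert (Hmon : forall x y, (x <= y)%R -> (exp x <= exp y)%R).
{ intros x y [H| ->]; [left; now apply exp_increasing|lra]. }
apply sectorial_of_Re; try assumption.
- unfold Cexp; rewrite HRe, HIm; unfold Re; simpl fst; unfold rho.
  apply Rmult_le_compat; try lra.
  + apply Hmon; apply Rabs_le_between in HLt; lra.
  + assert (Htt : (Rabs (th * t) <= Rabs th)%R).
    { rewrite Rabs_mult, (Rabs_right t) by lra.
      assert (H := Rabs_pos th); nra. }
    assert (E : cos (th * t) = cos (Rabs (th * t))).
    { unfold Rabs; destruct (Rcase_abs (th * t)); [now rewrite cos_neg|reflexivity]. }
    rewrite E; apply cos_decr_1; try apply Rabs_pos; lra.
- rewrite Cmod_Cexp, HRe; apply Hmon; apply Rabs_le_between in HLt; lra.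
Qed.

(** The square [n, r <= R0], where the antisymmetric summand adds up to 0, is subtracted explicitly
    so that every row bounded later has [n > R0]. *)
Definition rect (g : nat -> nat -> C) (R0 N : nat) : C :=
  csum (fun n => csum (fun r => g n r - g r n) R0) N
  - csum (fun n => csum (fun r => g n r - g r n) R0) R0.

(* Along the path [al = exp (l t)] from 1, where the sum vanishes by symmetry, the
   derivative telescopes to the edge sum, which tends to [PI / 2] for every [t]. *)
Lemma psi_rect_bound (al : C) : (0 < Re al)%R ->
  exists B, (0 <= B)%R /\ forall R0 N, (1 <= R0)%nat -> (R0 * R0 <= N)%nat ->
  (Cmod (rect (psi al) R0 N + RtoC (PI / 2) * Cln al) <= B / INR R0)%R.
Proof.
intros Hre.
destruct (sectorial_path al Hre) as [d [A Hsec]].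
assert (Hal : al <> 0).
{ intros E; rewrite E in Hre; simpl in Hre; lra. }
set (l := Cln al) in *; set (path := fun t => Cexp (l * RtoC t)).
assert (Hpath1 : path 1%R = al).
{ unfold path; rewrite Cmult_1_r; now apply Cexp_Cln. }
assert (Hpath0 : path 0%R = 1) by (unfold path; rewrite Cmult_0_r; apply Cexp_0).
destruct (Hsec 0%R ltac:(lra)) as [Hd [HA _]].
assert (Hddd : (0 < d * d * d)%R) by (repeat apply Rmult_lt_0_compat; lra).
set (K := ((A * A) / (d * d * d))%R).
assert (HK : (0 <= K)%R) by (unfold K; apply Rdiv_le_0_compat; nra).
assert (Hl := Cmod_ge_0 l).
(* The mean value bound is used twice, for the edge sum inside and for [rect] outside; 18 is the
   error at [al = 1]. *)
set (B := (2 * (Cmod l * (2 * K + 2 * (Cmod l * (4 * K)) + 18)))%R).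
exists B; split; [unfold B; nra|].
intros R0 N HR HN.
assert (HR1 := INR_ge_1 R0 HR).
assert (HRN : (R0 <= N)%nat) by nia.
assert (HRi : (0 < / INR R0)%R) by (apply Rinv_0_lt_compat; lra).
assert (Hder : forall t n r, (0 <= t <= 1)%R -> (1 <= n + r)%nat ->
  is_Cderive (fun s => psi (path s) n r) t (l * dpsi (path t) n r)).
{ intros t n r Ht Hnr; apply (is_Cderive_psi path l t d A); [exact Hnr|now apply Hsec|].
  apply is_Cderive_Cexp. }
(* The edge sum is near [PI / 2] at [t = 0], and its own derivative is [O(1 / R0)] by
   [dedge_bound]. *)
assert (Hedge : forall t, (0 <= t <= 1)%R ->
  (Cmod (csum (edge (path t) R0) N - csum (edge (path t) R0) R0 - RtoC (PI / 2))
   <= (2 * (Cmod l * (4 * K)) + 18) / INR R0)%R).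
{ intros t Ht.
  assert (H0 := edge_1_bound R0 N HR HN).
  assert (Hmv : (Cmod ((csum (edge (path t) R0) N - csum (edge (path t) R0) R0)
      - (csum (edge (path 0%R) R0) N - csum (edge (path 0%R) R0) R0))
    <= 2 * (Cmod l * (4 * K / INR R0)))%R).
  { apply (Cmean_value_bound
      (fun s => csum (edge (path s) R0) N - csum (edge (path s) R0) R0)
      (fun s => l * (csum (dedge (path s) R0) N - csum (dedge (path s) R0) R0))); [exact Ht| |].
    - intros s Hs.
      replace (l * (csum (dedge (path s) R0) N - csum (dedge (path s) R0) R0))
        with (csum (fun k => l * dedge (path s) R0 k) N
              - csum (fun k => l * dedge (path s) R0 k) R0)
        by (rewrite !csum_scal; ring).
      assert (He : forall k, is_Cderive (fun s => edge (path s) R0 k) s (l * dedge (path s) R0 k)).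
      { intros k; unfold edge, dedge.
        replace (l * (NtoC R0 * dpsi (path s) k R0 + NtoC R0 * dpsi (path s) R0 k))
          with ((0 * psi (path s) k R0 + NtoC R0 * (l * dpsi (path s) k R0))
                + (0 * psi (path s) R0 k + NtoC R0 * (l * dpsi (path s) R0 k))) by ring.
        apply is_Cderive_plus; apply (is_Cderive_mult (fun _ => NtoC R0));
          try apply is_Cderive_const; apply Hder; (lra || lia). }
      apply is_Cderive_minus; apply (is_Cderive_csum (fun k s => edge (path s) R0 k)); intros; apply He.
    - intros s Hs; rewrite Cmod_mult; apply Rmult_le_compat_l; [exact Hl|].
      eapply Rle_trans; [apply (dedge_bound (path s) d A R0 N); [apply Hsec; lra|exact HR|exact HN]|].
      apply Req_le; unfold K; field; lra. }
  rewrite Hpath0 in Hmv.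
  eapply Rle_trans; [apply (Cmod_dist _ (csum (edge 1 R0) N - csum (edge 1 R0) R0))|].
  unfold Rdiv in *; lra. }
assert (Hrow : forall t, (0 <= t <= 1)%R ->
  (Cmod (rect (dpsi (path t)) R0 N
     + (csum (edge (path t) R0) N - csum (edge (path t) R0) R0)) <= 2 * K / INR R0)%R).
{ intros t Ht; unfold rect.
  set (g := fun n => csum (fun r => dpsi (path t) n r - dpsi (path t) r n) R0).
  replace (csum g N - csum g R0 + (csum (edge (path t) R0) N - csum (edge (path t) R0) R0))
    with (csum (fun n => g n + edge (path t) R0 n) N - csum (fun n => g n + edge (path t) R0 n) R0)
    by (rewrite !csum_plus; ring).
  eapply Rle_trans; [apply (Cmod_csum_tail _ (2 * K)%R)|].
  - lia.
  - lra.
  - intros n Hn.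
    eapply Rle_trans; [apply (dpsi_row_bound (path t) d A R0 n); [apply Hsec; lra|lia]|].
    apply Req_le; unfold K, Rsqr; field.
    assert (1 <= INR n)%R by (apply INR_ge_1; lia); split; lra.
  - assert (0 < / INR N)%R by (apply Rinv_0_lt_compat, lt_0_INR; lia).
    unfold Rdiv; apply Rmult_le_compat_l; lra. }
assert (Hsym : rect (psi (path 0%R)) R0 N = 0).
{ rewrite Hpath0; unfold rect.
  assert (E : forall n, csum (fun r => psi 1 n r - psi 1 r n) R0 = 0).
  { intros n.
    rewrite (csum_ext _ (fun r => 0 * 0)).
    - rewrite csum_scal; ring.
    - intros r _; unfold psi.
      replace (1 * 1 * (NtoC r * NtoC r) + NtoC n * NtoC n)
        with (1 * 1 * (NtoC n * NtoC n) + NtoC r * NtoC r) by ring; ring. }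
  rewrite (csum_ext _ (fun r => 0 * 0)) by (intros; rewrite E; ring).
  rewrite (csum_ext (fun n => csum (fun r => psi 1 n r - psi 1 r n) R0) (fun r => 0 * 0) R0)
    by (intros; rewrite E; ring).
  rewrite !csum_scal; ring. }
(* The linear function of slope [(PI / 2) l] compensates the derivative of [rect], leaving one of
   size [O(1 / R0)]. *)
assert (Hmv : (Cmod ((rect (psi (path 1%R)) R0 N + RtoC (PI / 2) * (l * RtoC 1))
    - (rect (psi (path 0%R)) R0 N + RtoC (PI / 2) * (l * RtoC 0)))
  <= 2 * (Cmod l * ((2 * K + 2 * (Cmod l * (4 * K)) + 18) / INR R0)))%R).
{ apply (Cmean_value_bound
      (fun s => rect (psi (path s)) R0 N + RtoC (PI / 2) * (l * RtoC s))
      (fun s => l * (rect (dpsi (path s)) R0 N + RtoC (PI / 2)))); [lra| |].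
  - intros s Hs.
    replace (l * (rect (dpsi (path s)) R0 N + RtoC (PI / 2)))
      with ((csum (fun n => csum (fun r => l * dpsi (path s) n r - l * dpsi (path s) r n) R0) N
             - csum (fun n => csum (fun r => l * dpsi (path s) n r - l * dpsi (path s) r n) R0) R0)
            + l * RtoC (PI / 2)).
    + apply is_Cderive_plus.
      * unfold rect; apply is_Cderive_minus;
          apply (is_Cderive_csum (fun n s => csum (fun r => psi (path s) n r - psi (path s) r n) R0));
          intros n Hn; apply (is_Cderive_csum (fun r s => psi (path s) n r - psi (path s) r n));
          intros r Hr; apply is_Cderive_minus; apply Hder; (lra || lia).
      * split.
        -- apply (is_derive_ext (fun s => Re (RtoC (PI / 2) * l) * s)%R).
           ++ intros u; unfold Re, RtoC, Cmult; simpl; ring.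
           ++ auto_derive; [exact I|unfold Re, RtoC, Cmult; simpl; ring].
        -- apply (is_derive_ext (fun s => Im (RtoC (PI / 2) * l) * s)%R).
           ++ intros u; unfold Im, RtoC, Cmult; simpl; ring.
           ++ auto_derive; [exact I|unfold Im, RtoC, Cmult; simpl; ring].
    + assert (E : forall M, csum (fun n => csum (fun r => l * dpsi (path s) n r - l * dpsi (path s) r n) R0) M
        = l * csum (fun n => csum (fun r => dpsi (path s) n r - dpsi (path s) r n) R0) M).
      { intros M; rewrite <- csum_scal; apply csum_ext; intros n _.
        rewrite <- csum_scal; apply csum_ext; intros r _; ring. }
      rewrite !E; unfold rect; ring.
  - intros s Hs; rewrite Cmod_mult; apply Rmult_le_compat_l; [exact Hl|].
    assert (H1 := Hrow s Hs); assert (H2 := Hedge s Hs).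
    set (e := csum (edge (path s) R0) N - csum (edge (path s) R0) R0) in *.
    replace (rect (dpsi (path s)) R0 N + RtoC (PI / 2))
      with ((rect (dpsi (path s)) R0 N + e) - (e - RtoC (PI / 2))) by ring.
    eapply Rle_trans; [apply Cmod_minus_le|].
    unfold Rdiv in *; lra. }
rewrite Hsym, Hpath1 in Hmv.
replace (rect (psi al) R0 N + RtoC (PI / 2) * l)
  with (rect (psi al) R0 N + RtoC (PI / 2) * (l * RtoC 1) - (0 + RtoC (PI / 2) * (l * RtoC 0)))
  by ring.
eapply Rle_trans; [exact Hmv|].
apply Req_le; unfold B; field; lra.
Qed.

(** * Change of the order of summation in quadratic lattice sums *)

Lemma quad_lower (al : C) : (0 < Re al)%R ->
  exists d, (0 < d)%R /\ forall n r : nat,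
    (d * ((INR n + INR r) * (INR n + INR r))
     <= Cmod (al * al * (NtoC n * NtoC n) + NtoC r * NtoC r))%R.
Proof.
intros Hre; destruct (sectorial_path al Hre) as [d [A H]].
specialize (H 1%R ltac:(lra)).
rewrite Cmult_1_r, Cexp_Cln in H by (intros E; rewrite E in Hre; simpl in Hre; lra).
destruct H as [Hd [_ [_ Hlow]]].
exists (d * d)%R; split; [nra|]; intros n r.
rewrite quad_factor, Cmod_mult.
assert (H1 := Hlow Ci (or_introl eq_refl) n r).
assert (H2 := Hlow (- Ci) (or_intror eq_refl) n r).
assert (Hn := pos_INR n); assert (Hr := pos_INR r).
replace (d * d * ((INR n + INR r) * (INR n + INR r)))%R
  with (d * (INR n + INR r) * (d * (INR n + INR r)))%R by ring.
apply Rmult_le_compat; nra.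
Qed.

Lemma quad_lower2 (al be : C) : be <> 0 -> (0 < Re (al / be))%R ->
  exists d, (0 < d)%R /\ forall n k : nat,
    (d * ((INR n + INR k) * (INR n + INR k))
     <= Cmod (al * al * (NtoC n * NtoC n) + be * be * (NtoC k * NtoC k)))%R.
Proof.
intros Hb Hre; destruct (quad_lower (al / be) Hre) as [d [Hd H]].
assert (Hbm := proj1 (Cmod_gt_0 be) Hb).
exists (Cmod be * Cmod be * d)%R; split; [apply Rmult_lt_0_compat; nra|]; intros n k.
replace (al * al * (NtoC n * NtoC n) + be * be * (NtoC k * NtoC k))
  with (be * be * (al / be * (al / be) * (NtoC n * NtoC n) + NtoC k * NtoC k))
  by (field; exact Hb).
rewrite !(Cmod_mult (be * be)), Cmod_mult, Rmult_assoc.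
apply Rmult_le_compat_l; [nra|apply H].
Qed.

(** For large [n + k] the shift [c] is at most half of the lower bound of the form; finitely many
    pairs remain. *)
Lemma inv_shift_bound (Q : nat -> nat -> C) (c : C) (d : R) : (0 < d)%R ->
  (forall n k : nat, (d * ((INR n + INR k) * (INR n + INR k)) <= Cmod (Q n k))%R) ->
  (forall n k, (1 <= n)%nat -> (1 <= k)%nat -> Q n k + c <> 0) ->
  exists B, (0 <= B)%R /\ forall n k, (1 <= n)%nat -> (1 <= k)%nat ->
    (Cmod (/ (Q n k + c)) <= B / ((INR n + INR k) * (INR n + INR k)))%R.
Proof.
intros Hd HQ H0.
destruct (archimed_div (2 * Cmod c / d) 1) as [M [HM1 HM]]; [lra|].
destruct (bounded_of_eventually_bounded
  (fun n k => Cmod (/ (Q n k + c)) * ((INR n + INR k) * (INR n + INR k)))%R M (2 / d))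
  as [B [HB0 HB]].
- intros n k Hn Hk Hnk.
  assert (H1 := INR_ge_1 n Hn); assert (H2 := INR_ge_1 k Hk).
  specialize (HM (n + k)%nat Hnk); rewrite plus_INR in HM.
  set (s := (INR n + INR k)%R) in *.
  assert (Hs : (2 <= s)%R) by (unfold s; lra).
  assert (Hc : (2 * Cmod c <= d * (s * s))%R).
  { assert (H : (2 * Cmod c / d < s)%R).
    { apply Rmult_lt_reg_r with (/ s)%R; [apply Rinv_0_lt_compat; lra|].
      rewrite Rinv_r by lra; exact HM. }
    assert (H' : (2 * Cmod c < s * d)%R).
    { apply Rmult_lt_reg_r with (/ d)%R; [now apply Rinv_0_lt_compat|].
      replace (s * d * / d)%R with s by (field; lra); exact H. }
    assert (0 <= d * s * (s - 1))%R by (repeat apply Rmult_le_pos; lra); lra. }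
  assert (Hl : (d * (s * s) / 2 <= Cmod (Q n k + c))%R).
  { assert (H := Cmod_ge_minus (Q n k) c); assert (H' := HQ n k); fold s in H'; lra. }
  assert (Hss : (0 < s * s)%R) by nra.
  assert (Hp : (0 < d * (s * s) / 2)%R) by nra.
  apply Rle_trans with (/ (d * (s * s) / 2) * (s * s))%R.
  + apply Rmult_le_compat_r; [lra|now apply Cmod_inv_le].
  + apply Req_le; field; lra.
- exists B; split; [exact HB0|]; intros n k Hn Hk.
  assert (H1 := INR_ge_1 n Hn); assert (H2 := INR_ge_1 k Hk).
  assert (Hs : (0 < (INR n + INR k) * (INR n + INR k))%R) by nra.
  apply Rmult_le_reg_r with ((INR n + INR k) * (INR n + INR k))%R; [exact Hs|].
  unfold Rdiv; rewrite Rmult_assoc, Rinv_l, Rmult_1_r by lra.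
  now apply HB.
Qed.

(** The difference is [(c' - c)] over the product of the two denominators. Its order 4 is summable
    over a plane lattice, while the order 2 of either inverse is not. *)
Lemma inv_shift_diff_bound (Q : nat -> nat -> C) (c c' : C) (d : R) : (0 < d)%R ->
  (forall n k : nat, (d * ((INR n + INR k) * (INR n + INR k)) <= Cmod (Q n k))%R) ->
  (forall n k, (1 <= n)%nat -> (1 <= k)%nat -> Q n k + c <> 0) ->
  (forall n k, (1 <= n)%nat -> (1 <= k)%nat -> Q n k + c' <> 0) ->
  exists B, (0 <= B)%R /\ forall n k, (1 <= n)%nat -> (1 <= k)%nat ->
    (Cmod (/ (Q n k + c) - / (Q n k + c'))
     <= B / (((INR n + INR k) * (INR n + INR k)) * ((INR n + INR k) * (INR n + INR k))))%R.
Proof.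
intros Hd HQ H H'.
destruct (inv_shift_bound Q c d Hd HQ H) as [B [HB0 HB]].
destruct (inv_shift_bound Q c' d Hd HQ H') as [B' [HB0' HB']].
exists (Cmod (c' - c) * (B * B'))%R; split.
{ apply Rmult_le_pos; [apply Cmod_ge_0|nra]. }
intros n k Hn Hk.
assert (H1 := INR_ge_1 n Hn); assert (H2 := INR_ge_1 k Hk).
set (s := ((INR n + INR k) * (INR n + INR k))%R).
assert (Hs : (0 < s)%R) by (unfold s; nra).
replace (/ (Q n k + c) - / (Q n k + c'))
  with ((c' - c) * (/ (Q n k + c) * / (Q n k + c'))) by (field; auto).
rewrite !Cmod_mult.
apply Rle_trans with (Cmod (c' - c) * (B / s * (B' / s)))%R.
- apply Rmult_le_compat_l; [apply Cmod_ge_0|].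
  apply Rmult_le_compat; try apply Cmod_ge_0; [now apply HB|now apply HB'].
- apply Req_le; field; lra.
Qed.

Lemma inv_sqr_sum_le (B n k : R) : (0 <= B)%R -> (1 <= n)%R -> (1 <= k)%R ->
  (B / (((n + k) * (n + k)) * ((n + k) * (n + k))) <= B / (n² * k²))%R.
Proof.
intros HB Hn Hk; unfold Rdiv; apply Rmult_le_compat_l; [exact HB|].
assert (H1 : (1 <= n²)%R) by (unfold Rsqr; nra).
assert (H2 : (1 <= k²)%R) by (unfold Rsqr; nra).
apply Rinv_le_contravar; [nra|].
apply Rmult_le_compat; unfold Rsqr in *; nra.
Qed.

(** The partial sum of [kap] up to [R0] is a limit of sums over rectangles [N] by [R0]. There [h]
    may be replaced by [psi / al], the case [c = 0], at a cost [O(1 / R0)], and [psi_rect_bound]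
    applies. *)
Lemma Cser_order_defect (al c : C) (kap : nat -> C) : (0 < Re al)%R ->
  let h := fun n r => / (al * al * (NtoC n * NtoC n) + NtoC r * NtoC r + c) in
  (forall n r, (1 <= n)%nat -> (1 <= r)%nat ->
     al * al * (NtoC n * NtoC n) + NtoC r * NtoC r + c <> 0) ->
  (forall r, (1 <= r)%nat -> Cser (fun n => h n r - h r n) (kap r)) ->
  Cser kap (- (RtoC PI / (2 * al)) * Cln al).
Proof.
intros Hre h H0 Hkap.
assert (Hal : al <> 0) by (intros E; rewrite E in Hre; simpl in Hre; lra).
assert (Ham := proj1 (Cmod_gt_0 al) Hal).
destruct (quad_lower al Hre) as [d [Hd HQ]].
destruct (inv_shift_diff_bound _ c 0 d Hd HQ H0) as [B1 [HB1 Hdiff]].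
{ intros n k Hn Hk E; assert (H := HQ n k).
  rewrite Cplus_0_r in E; rewrite E, Cmod_0 in H.
  assert (H1 := INR_ge_1 n Hn); assert (H2 := INR_ge_1 k Hk).
  assert (0 < d * ((INR n + INR k) * (INR n + INR k)))%R by (apply Rmult_lt_0_compat; nra).
  lra. }
destruct (psi_rect_bound al Hre) as [B2 [HB2 Hrect]].
assert (Hd4 : forall n r, (1 <= r)%nat -> (1 <= n)%nat -> forall m, (m = n \/ m = r)%nat ->
   (1 <= m)%nat ->
   (B1 / ((INR n + INR r) * (INR n + INR r) * ((INR n + INR r) * (INR n + INR r)))
    <= B1 / ((INR m * INR m) * (INR m * INR m)))%R).
{ intros n r Hr Hn m Hm Hm1.
  assert (H1 := INR_ge_1 n Hn); assert (H2 := INR_ge_1 r Hr); assert (H3 := INR_ge_1 m Hm1).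
  assert (H4 : (INR m <= INR n + INR r)%R) by (destruct Hm; subst m; lra).
  assert (H5 : (INR m * INR m <= (INR n + INR r) * (INR n + INR r))%R)
    by (apply Rmult_le_compat; lra).
  unfold Rdiv; apply Rmult_le_compat_l; [exact HB1|].
  apply Rinv_le_contravar; [apply Rmult_lt_0_compat; nra|].
  apply Rmult_le_compat; nra. }
apply (Cser_of_rate _ _ (2 * B1 + B2 / Cmod al) 1); intros R0 HR.
assert (HR1 := INR_ge_1 R0 HR).
assert (Hs : Cser (fun n => csum (fun r => h n r - h r n) R0) (csum kap R0)).
{ apply (Cser_csum (fun n r => h n r - h r n)); intros r Hr; apply Hkap; lia. }
apply (Clim_bound _ _ _ _ (R0 * R0) Hs); intros N HN.
assert (HRN : (R0 <= N)%nat) by nia.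
(* Antisymmetry on the square: only [n > R0] contributes. *)
assert (Hsq : csum (fun n => csum (fun r => h n r - h r n) R0) R0 = 0).
{ rewrite (csum_ext _ (fun n => csum (fun r => h n r) R0 - csum (fun r => h r n) R0))
    by (intros; apply csum_minus).
  rewrite csum_minus, (csum_swap (fun n r => h r n)); ring. }
set (h0 := psi al).
assert (Eh : forall n r, h0 n r = al * / (al * al * (NtoC n * NtoC n) + NtoC r * NtoC r + 0)).
{ intros n r; unfold h0, psi; rewrite Cplus_0_r; reflexivity. }
set (g := fun n => csum (fun r => (h n r - h r n) - / al * (h0 n r - h0 r n)) R0).
assert (Hg : (Cmod (csum g N - csum g R0) <= 2 * B1 / INR R0)%R).
{ eapply Rle_trans; [apply (Cmod_csum_tail g (2 * B1)%R)|].
  - lia.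
  - lra.
  - intros n Hn; unfold g.
    assert (Hn1 : (1 <= INR n)%R) by (apply INR_ge_1; lia).
    assert (HRn : (INR R0 <= INR n)%R) by (apply le_INR; lia).
    set (D := (B1 / ((INR n * INR n) * (INR n * INR n)))%R).
    assert (HD : (0 <= D)%R).
    { unfold D; apply Rdiv_le_0_compat; [exact HB1|apply Rmult_lt_0_compat; nra]. }
    (* Row [n] has [R0 < n] terms, each at most [2 * B1 / n^4]. *)
    apply Rle_trans with (INR R0 * (2 * D))%R.
    + apply Cmod_csum_le; intros r Hr.
      replace (h n r - h r n - / al * (h0 n r - h0 r n))
        with ((h n r - / (al * al * (NtoC n * NtoC n) + NtoC r * NtoC r + 0))
              - (h r n - / (al * al * (NtoC r * NtoC r) + NtoC n * NtoC n + 0))).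
      * eapply Rle_trans; [apply Cmod_minus_le|].
        assert (G1 := Hdiff n r ltac:(lia) ltac:(lia)).
        assert (G2 := Hdiff r n ltac:(lia) ltac:(lia)).
        assert (G3 := Hd4 n r ltac:(lia) ltac:(lia) n ltac:(auto) ltac:(lia)).
        assert (G4 := Hd4 r n ltac:(lia) ltac:(lia) n ltac:(auto) ltac:(lia)).
        fold (h n r) in G1; fold (h r n) in G2; fold D in G3, G4; lra.
      * rewrite !Eh.
        set (u := / (al * al * (NtoC n * NtoC n) + NtoC r * NtoC r + 0)).
        set (v := / (al * al * (NtoC r * NtoC r) + NtoC n * NtoC n + 0)).
        field; exact Hal.
    + apply Rle_trans with (INR n * (2 * D))%R; [apply Rmult_le_compat_r; lra|].
      replace (2 * B1 / (INR n)²)%R with (INR n * INR n * (INR n * INR n) * (2 * D) / (INR n)²)%R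
        by (unfold D, Rsqr; field; lra).
      replace (INR n * INR n * (INR n * INR n) * (2 * D) / (INR n)²)%R
        with (INR n * INR n * (2 * D))%R by (unfold Rsqr; field; lra).
      apply Rmult_le_compat_r; nra.
  - assert (0 < / INR N)%R by (apply Rinv_0_lt_compat, lt_0_INR; lia).
    unfold Rdiv; apply Rmult_le_compat_l; lra. }
assert (Eg : csum (fun n => csum (fun r => h n r - h r n) R0) N
   = (csum g N - csum g R0) + / al * rect h0 R0 N).
{ assert (E : forall M, csum g M = csum (fun n => csum (fun r => h n r - h r n) R0) M
     - / al * csum (fun n => csum (fun r => h0 n r - h0 r n) R0) M).
  { intros M; rewrite <- csum_scal, <- csum_minus; apply csum_ext; intros n _.
    rewrite <- csum_scal; unfold g; apply csum_minus. }
  rewrite !E, Hsq; unfold rect; ring. }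
rewrite Eg.
replace (csum g N - csum g R0 + / al * rect h0 R0 N - - (RtoC PI / (2 * al)) * Cln al)
  with ((csum g N - csum g R0) + / al * (rect h0 R0 N + RtoC (PI / 2) * Cln al)).
2:{ rewrite RtoC_div by lra; field; exact Hal. }
eapply Rle_trans; [apply Cmod_triangle|].
rewrite Cmod_mult, Cmod_inv by exact Hal.
assert (HF := Hrect R0 N HR HN); fold h0 in HF.
replace ((2 * B1 + B2 / Cmod al) / INR R0)%R
  with (2 * B1 / INR R0 + / Cmod al * (B2 / INR R0))%R by (field; lra).
apply Rplus_le_compat; [exact Hg|].
apply Rmult_le_compat_l; [left; now apply Rinv_0_lt_compat|exact HF].
Qed.

Lemma inv_quad_summable (al c : C) (r : nat) : (0 < Re al)%R -> (1 <= r)%nat ->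
  let h := fun n r => / (al * al * (NtoC n * NtoC n) + NtoC r * NtoC r + c) in
  (forall n r, (1 <= n)%nat -> (1 <= r)%nat ->
     al * al * (NtoC n * NtoC n) + NtoC r * NtoC r + c <> 0) ->
  exists l, Cser (fun n => h n r - h r n) l.
Proof.
intros Hre Hr h H0.
destruct (quad_lower al Hre) as [d [Hd HQ]].
destruct (inv_shift_bound _ c d Hd HQ H0) as [B [HB0 HB]].
apply (Cser_abs _ (2 * B)); [lra|]; intros n Hn.
assert (G1 := HB n r Hn Hr); assert (G2 := HB r n Hr Hn).
fold (h n r) in G1; fold (h r n) in G2.
assert (H1 := INR_ge_1 n Hn); assert (H2 := INR_ge_1 r Hr).
eapply Rle_trans; [apply Cmod_minus_le|].
rewrite (Rplus_comm (INR r)) in G2.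
assert (H : (B / ((INR n + INR r) * (INR n + INR r)) <= B / (INR n)²)%R).
{ unfold Rdiv; apply Rmult_le_compat_l; [exact HB0|].
  apply Rinv_le_contravar; unfold Rsqr; nra. }
unfold Rdiv in *; lra.
Qed.

(* Subtracting two shifts [c], [c'] makes the double series absolutely
   convergent, so that Fubini applies although neither half is summable. *)
Lemma Cser_swap_cancel (al be c c' : C) (u v u' v' : nat -> C) :
  be <> 0 -> (0 < Re (al / be))%R ->
  let H := fun c n k => / (al * al * (NtoC n * NtoC n) + be * be * (NtoC k * NtoC k) + c) in
  (forall n k, (1 <= n)%nat -> (1 <= k)%nat ->
     al * al * (NtoC n * NtoC n) + be * be * (NtoC k * NtoC k) + c <> 0) ->
  (forall n k, (1 <= n)%nat -> (1 <= k)%nat ->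
     al * al * (NtoC n * NtoC n) + be * be * (NtoC k * NtoC k) + c' <> 0) ->
  (forall n, (1 <= n)%nat -> Cser (fun k => H c n k) (u n)) ->
  (forall n, (1 <= n)%nat -> Cser (fun k => H c' n k) (u' n)) ->
  (forall n, (1 <= n)%nat -> Cser (fun k => H c k n) (v n)) ->
  (forall n, (1 <= n)%nat -> Cser (fun k => H c' k n) (v' n)) ->
  Cser (fun n => (u n - u' n) - (v n - v' n)) 0.
Proof.
intros Hb Hre H H0 H0' Hu Hu' Hv Hv'.
destruct (quad_lower2 al be Hb Hre) as [d [Hd HQ]].
destruct (inv_shift_diff_bound _ c c' d Hd HQ H0 H0') as [B [HB0 HB]].
set (a := fun n k => H c n k - H c' n k).
assert (Ha : forall n k, (1 <= n)%nat -> (1 <= k)%nat ->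
  (Cmod (a n k) <= B / ((INR n)² * (INR k)²))%R).
{ intros n k Hn Hk; eapply Rle_trans; [apply (HB n k Hn Hk)|].
  apply inv_sqr_sum_le; [exact HB0|now apply INR_ge_1|now apply INR_ge_1]. }
assert (Hrow : forall n, (1 <= n)%nat -> Cser (a n) (u n - u' n)).
{ intros n Hn; apply Cser_minus; auto. }
assert (Hcol : forall k, (1 <= k)%nat -> Cser (fun n => a n k) (v k - v' k)).
{ intros k Hk; unfold a; apply (Cser_minus (fun n => H c n k) (fun n => H c' n k)); auto. }
assert (HL : exists L, Cser (fun n => u n - u' n) L).
{ apply (Cser_abs _ (2 * B)); [lra|]; intros n Hn.
  assert (H1 := INR_ge_1 n Hn).
  assert (Hn2 : (0 < (INR n)²)%R) by (unfold Rsqr; nra).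
  apply (Cser_bound _ _ _ 0 (Hrow n Hn)); intros N _.
  replace (2 * B / (INR n)²)%R with (2 * (B / (INR n)²))%R by (field; lra).
  apply Cmod_csum_inv_sqr; [apply Rdiv_le_0_compat; lra|].
  intros k Hk; eapply Rle_trans; [now apply Ha|].
  assert (H2 := INR_ge_1 k Hk); apply Req_le; unfold Rsqr in *; field; split; nra. }
destruct HL as [L HL].
replace (RtoC 0) with (L - L) by ring.
apply Cser_minus; [exact HL|].
exact (Cser_Fubini a (fun n => u n - u' n) (fun k => v k - v' k) L B HB0 Ha Hrow Hcol HL).
Qed.

(** * Half-plane conditions forced by convergence *)

Lemma pigeonhole (n : nat) (b : nat -> nat) : (forall i, (i <= n)%nat -> (b i < n)%nat) ->
  exists i j, (i < j <= n)%nat /\ b i = b j.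
Proof.
revert b; induction n as [|n IH]; intros b Hb; [specialize (Hb 0%nat); lia|].
destruct (classic (exists i, (i <= n)%nat /\ b i = b (S n))) as [[i [Hi E]]|Hno].
{ exists i, (S n); split; [lia|exact E]. }
assert (Hne : forall i, (i <= n)%nat -> b i <> b (S n)).
{ intros i Hi E; apply Hno; now exists i. }
set (g := fun i => if (b i <? b (S n))%nat then b i else pred (b i)).
destruct (IH g) as [i [j [Hij E]]].
- intros i Hi; unfold g.
  assert (H1 := Hb i ltac:(lia)); assert (H2 := Hb (S n) ltac:(lia)); assert (H3 := Hne i Hi).
  destruct (Nat.ltb_spec (b i) (b (S n))); lia.
- exists i, j; split; [lia|].
  assert (H1 := Hne i ltac:(lia)); assert (H2 := Hne j ltac:(lia)).
  unfold g in E.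
  destruct (Nat.ltb_spec (b i) (b (S n))), (Nat.ltb_spec (b j) (b (S n))); lia.
Qed.

(** Two of the [N + 1] fractional parts of [0, t, ..., N t] share one of [N] boxes of width
    [1 / N]. *)
Lemma Dirichlet_approximation (t : R) (N : nat) : (1 <= N)%nat ->
  exists (q : nat) (p : Z), (1 <= q <= N)%nat /\ (Rabs (INR q * t - IZR p) <= / INR N)%R.
Proof.
intros HN; assert (HN1 := INR_ge_1 N HN).
set (fr := fun j => (INR j * t - IZR (Int_part (INR j * t)))%R).
assert (Hfr : forall j, (0 <= fr j < 1)%R).
{ intros j; unfold fr; destruct (base_Int_part (INR j * t)); lra. }
set (z := fun j => Int_part (INR N * fr j)).
assert (Hz : forall j, (IZR (z j) <= INR N * fr j < IZR (z j) + 1)%R).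
{ intros j; unfold z; destruct (base_Int_part (INR N * fr j)); lra. }
assert (Hz0 : forall j, (0 <= z j < Z.of_nat N)%Z).
{ intros j; specialize (Hz j); specialize (Hfr j).
  assert (0 <= INR N * fr j < INR N)%R by nra.
  split.
  - apply Z.lt_succ_r, lt_IZR; rewrite succ_IZR; simpl; lra.
  - apply lt_IZR; rewrite <- INR_IZR_INZ; lra. }
destruct (pigeonhole N (fun j => Z.to_nat (z j))) as [i [j [Hij E]]].
- intros i _; specialize (Hz0 i); lia.
- assert (E' : z i = z j) by (assert (H1 := Hz0 i); assert (H2 := Hz0 j); lia).
  exists (j - i)%nat, (Int_part (INR j * t) - Int_part (INR i * t))%Z; split; [lia|].
  rewrite minus_INR, minus_IZR by lia.
  replace ((INR j - INR i) * t - (IZR (Int_part (INR j * t)) - IZR (Int_part (INR i * t))))%R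
    with (fr j - fr i)%R by (unfold fr; ring).
  assert (H1 := Hz i); assert (H2 := Hz j); rewrite E' in H1.
  assert (Hd : (Rabs (INR N * (fr j - fr i)) <= 1)%R) by (apply Rabs_le; split; lra).
  rewrite Rabs_mult, (Rabs_right (INR N)) in Hd by lra.
  apply Rmult_le_reg_l with (INR N); [lra|]; rewrite Rinv_r by lra; exact Hd.
Qed.

(** Large denominators are needed even for rational [t]. Approximation at level [Q^3] leaves room:
    if the denominator [q] is below [Q], multiplying by [Q] gives an error at most
    [1 / Q² <= 1 / (q Q)]. *)
Lemma Dirichlet_large (t : R) (Q : nat) : (1 <= Q)%nat ->
  exists (r : nat) (m : Z), (Q <= r)%nat /\ (Rabs (INR r * t - IZR m) <= / INR r)%R.
Proof.
intros HQ; assert (HQ1 := INR_ge_1 Q HQ).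
destruct (Dirichlet_approximation t (Q * (Q * Q))) as [q [p [Hq Hp]]]; [nia|].
assert (Hq1 : (1 <= INR q)%R) by (apply INR_ge_1; lia).
destruct (Nat.le_gt_cases Q q) as [H|H].
- exists q, p; split; [exact H|].
  eapply Rle_trans; [exact Hp|]; apply Rinv_le_contravar; [lra|apply le_INR; lia].
- exists (q * Q)%nat, (p * Z.of_nat Q)%Z; split; [nia|].
  rewrite mult_IZR, <- INR_IZR_INZ, mult_INR.
  replace (INR q * INR Q * t - IZR p * INR Q)%R with ((INR q * t - IZR p) * INR Q)%R by ring.
  rewrite Rabs_mult, (Rabs_right (INR Q)) by lra.
  rewrite !mult_INR in Hp.
  assert (HqQ : (INR q <= INR Q)%R) by (apply le_INR; lia).
  apply Rle_trans with (/ (INR Q * (INR Q * INR Q)) * INR Q)%R.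
  + apply Rmult_le_compat_r; lra.
  + replace (/ (INR Q * (INR Q * INR Q)) * INR Q)%R with (/ (INR Q * INR Q))%R by (field; lra).
    apply Rinv_le_contravar; nra.
Qed.

(** * The terms of [f] along a row *)

Lemma Csqrt_Re_nonneg (z : C) : (0 <= Re (Csqrt z))%R.
Proof.
unfold Csqrt, Re; simpl; apply Rmult_le_pos; [apply sqrt_pos|].
assert (H := acos_bound (fst z / Cmod z)); assert (HP := PI_RGT_0).
apply cos_ge_0; unfold Carg, Re; destruct (Rlt_dec (Im z) 0); lra.
Qed.

(** [(s - r) (s + r) = c], and [|s + r| >= r] because a principal root has nonnegative real part. *)
Lemma sqrt_determination_near_nat (sq : C -> C) (c : C) : sqrt_determination sq ->
  exists N, (1 <= N)%nat /\ forall r, (N <= r)%nat ->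
    (Cmod (sq (NtoC r * NtoC r + c)%C - NtoC r) <= Cmod c / INR r)%R.
Proof.
intros [Hs [M HM]].
destruct (INR_unbounded (M + Cmod c)) as [N HN].
exists (S N); split; [lia|]; intros r Hr.
assert (Hr1 : (1 <= INR r)%R) by (apply INR_ge_1; lia).
assert (HrN : (INR N <= INR r)%R) by (apply le_INR; lia).
assert (Hbig : (M < Cmod (NtoC r * NtoC r + c))%R).
{ assert (H := Cmod_ge_minus (NtoC r * NtoC r) c).
  rewrite Cmod_mult, Cmod_NtoC in H; nra. }
assert (E := Hs (NtoC r * NtoC r + c)).
rewrite (HM _ Hbig) in *.
set (s := Csqrt (NtoC r * NtoC r + c)) in *.
assert (Hre : (0 <= Re s)%R) by apply Csqrt_Re_nonneg.
assert (Hsum : (INR r <= Cmod (s + NtoC r))%R).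
{ eapply Rle_trans; [|apply re_le_Cmod].
  eapply Rle_trans; [|apply Rle_abs].
  change (Re (s + NtoC r)) with (Re s + INR r)%R; lra. }
assert (E2 : (s - NtoC r) * (s + NtoC r) = c).
{ transitivity (s * s - NtoC r * NtoC r); [ring|rewrite E; ring]. }
apply (f_equal Cmod) in E2; rewrite Cmod_mult in E2.
apply Rmult_le_reg_r with (INR r); [lra|].
unfold Rdiv; rewrite Rmult_assoc, Rinv_l, Rmult_1_r, <- E2 by lra.
apply Rmult_le_compat_l; [apply Cmod_ge_0|exact Hsum].
Qed.

Lemma Cser_terms (a : nat -> C) (l : C) : Cser a l ->
  forall eps, (0 < eps)%R -> exists N, forall n, (N <= n)%nat -> (Cmod (a n) < eps)%R.
Proof.
intros H eps He; destruct (H (eps / 2)%R) as [N HN]; [lra|].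
exists (S N); intros [|n] Hn; [lia|].
assert (H1 := HN n ltac:(lia)); assert (H2 := HN (S n) ltac:(lia)).
replace (a (S n)) with ((csum a (S n) - l) - (csum a n - l)) by (simpl; ring).
eapply Rle_lt_trans; [apply Cmod_minus_le|lra].
Qed.

(** The block from [n + 1] to [2 n] lowers the real part by at least [e / 2], whereas two partial
    sums within [e / 4] of the limit differ by less. *)
Lemma Cser_harmonic_absurd (a : nat -> C) (l : C) (N : nat) (e : R) : (0 < e)%R ->
  (forall r, (N <= r)%nat -> (Re (a r) <= - (e / INR r))%R) -> ~ Cser a l.
Proof.
intros He Ha Hl.
destruct (Hl (e / 4)%R) as [N' HN']; [lra|].
set (n := S (max N N')).
assert (Hn1 : (1 <= INR n)%R) by (apply INR_ge_1; unfold n; lia).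
assert (H : forall k, (k <= n)%nat ->
  (Re (csum a (n + k)) - Re (csum a n) <= - (INR k * (e / (2 * INR n))))%R).
{ induction k as [|k IH]; intros Hk.
  - rewrite Nat.add_0_r; simpl INR; lra.
  - rewrite Nat.add_succ_r, csum_S, S_INR.
    assert (IH' := IH ltac:(lia)).
    assert (Hr := Ha (S (n + k)) ltac:(unfold n; lia)).
    assert (Hle : (e / (2 * INR n) <= e / INR (S (n + k)))%R).
    { unfold Rdiv; apply Rmult_le_compat_l; [lra|].
      apply Rinv_le_contravar; [apply lt_0_INR; lia|].
      replace (2 * INR n)%R with (INR (2 * n)) by (rewrite mult_INR; reflexivity).
      apply le_INR; lia. }
    change (Re (csum a (n + k) + a (S (n + k))))
      with (Re (csum a (n + k)) + Re (a (S (n + k))))%R.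
    lra. }
specialize (H n ltac:(lia)).
replace (INR n * (e / (2 * INR n)))%R with (e / 2)%R in H by (field; lra).
assert (H1 := HN' (n + n)%nat ltac:(unfold n; lia)).
assert (H2 := HN' n ltac:(unfold n; lia)).
assert (H3 := Cmod_dist (csum a (n + n)) l (csum a n)).
rewrite (Cmod_minus_sym l) in H3.
assert (H4 := re_le_Cmod (csum a (n + n) - csum a n)).
change (Re (csum a (n + n) - csum a n)) with (Re (csum a (n + n)) - Re (csum a n))%R in H4.
apply Rabs_le_between in H4; lra.
Qed.

Lemma exp2pi_imag_Z (m : Z) : exp2pi (Ci * RtoC (IZR m)) = 1.
Proof.
destruct (Z.le_ge_cases 0 m) as [H|H].
- rewrite <- (Z2Nat.id m H), <- INR_IZR_INZ; apply exp2pi_imag_nat.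
- assert (E := exp2pi_opp (Ci * RtoC (IZR m))).
  replace (- (Ci * RtoC (IZR m))) with (Ci * NtoC (Z.to_nat (- m))) in E.
  + rewrite exp2pi_imag_nat, Cmult_1_l in E; exact E.
  + unfold NtoC; rewrite INR_IZR_INZ, Z2Nat.id by lia.
    rewrite opp_IZR, RtoC_opp; ring.
Qed.

Lemma eventually_INR_gt (B : R) (N : nat) : exists Q, (N <= Q)%nat /\ (1 <= Q)%nat /\
  forall r, (Q <= r)%nat -> (B < INR r)%R.
Proof.
destruct (INR_unbounded B) as [N' HN'].
exists (S (max N N')); repeat split; [lia|lia|]; intros r Hr.
apply Rlt_le_trans with (INR N'); [exact HN'|apply le_INR; lia].
Qed.

(* On the line [Re y = 0] the factor [exp (2 PI y s) - 1] comes within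
   [O(1 / r)] of zero infinitely often, by Dirichlet's theorem. *)
Lemma imaginary_rate_absurd (y c l : C) (s : nat -> C) (N : nat) :
  Re y = 0%R ->
  (forall r, (N <= r)%nat -> (Cmod (s r - NtoC r) <= Cmod c / INR r)%R) ->
  (forall r, (1 <= r)%nat -> s r * (exp2pi (y * s r) - 1) <> 0) ->
  ~ Cser (fun r => 1 / (s r * (exp2pi (y * s r) - 1))) l.
Proof.
intros Hy Hs H0 Hl.
set (t := Im y).
assert (Ey : y = Ci * RtoC t).
{ unfold t; destruct y as [y1 y2]; simpl in Hy; subst y1.
  apply injective_projections; simpl; ring. }
assert (HP := PI_RGT_0).
assert (Hc := Cmod_ge_0 c); assert (Hy0 := Cmod_ge_0 y).
set (B := (2 * PI * (1 + Cmod y * Cmod c))%R).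
assert (HB : (0 < B)%R) by (unfold B; apply Rmult_lt_0_compat; nra).
(* Below, [|s r| <= 2 r] and the other factor is at most [3 B / r], so the denominator never exceeds
   [6 * B] at the chosen [r]. *)
destruct (Cser_terms _ l Hl (/ (6 * B))%R) as [N1 HN1]; [apply Rinv_0_lt_compat; lra|].
destruct (eventually_INR_gt (2 * B + Cmod c) (max N N1)) as [Q [HQN [HQ1 HQ]]].
destruct (Dirichlet_large t Q HQ1) as [r [m [HrQ Hrm]]].
specialize (HQ r HrQ); specialize (HN1 r ltac:(lia)); specialize (Hs r ltac:(lia)).
specialize (H0 r ltac:(lia)).
assert (Hr1 : (1 <= INR r)%R) by (apply INR_ge_1; lia).
assert (HRi : (0 < / INR r)%R) by (apply Rinv_0_lt_compat; lra).
(* The exponent reduced by the period [Ci * m]: a Diophantine error plus the deviation of the root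
   from [r], both [O(1 / r)]. *)
set (u := RtoC (2 * PI) * (Ci * RtoC (INR r * t - IZR m) + y * (s r - NtoC r))).
assert (Hu : (Cmod u <= B / INR r)%R).
{ unfold u; rewrite Cmod_mult, Cmod_R, Rabs_right by lra.
  replace (B / INR r)%R with (2 * PI * (/ INR r + Cmod y * (Cmod c / INR r)))%R
    by (unfold B; field; lra).
  apply Rmult_le_compat_l; [lra|].
  eapply Rle_trans; [apply Cmod_triangle|]; rewrite !Cmod_mult, Cmod_Ci, Cmod_R, Rmult_1_l.
  apply Rplus_le_compat; [exact Hrm|apply Rmult_le_compat_l; lra]. }
assert (E : exp2pi (y * s r) = Cexp u).
{ replace (y * s r) with ((Ci * RtoC (INR r * t - IZR m) + y * (s r - NtoC r))
     + Ci * RtoC (IZR m)).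
  - rewrite exp2pi_plus, exp2pi_imag_Z, Cmult_1_r; reflexivity.
  - rewrite RtoC_minus, RtoC_mult; fold (NtoC r); rewrite Ey; ring. }
assert (Hhalf : (B / INR r <= 1 / 2)%R).
{ apply Rmult_le_reg_r with (INR r); [lra|].
  unfold Rdiv; rewrite Rmult_assoc, Rinv_l; lra. }
assert (HE := Cexp_order_1 u ltac:(lra)); rewrite <- E in HE.
assert (Hsr : (Cmod (s r) <= 2 * INR r)%R).
{ replace (s r) with ((s r - NtoC r) + NtoC r) by ring.
  eapply Rle_trans; [apply Cmod_triangle|]; rewrite Cmod_NtoC.
  assert (Cmod c / INR r <= Cmod c)%R; [|lra].
  unfold Rdiv; rewrite <- (Rmult_1_r (Cmod c)) at 2; apply Rmult_le_compat_l; [lra|].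
  rewrite <- Rinv_1; apply Rinv_le_contravar; lra. }
assert (Hprod : (Cmod (s r * (exp2pi (y * s r) - 1)) <= 6 * B)%R).
{ rewrite Cmod_mult.
  apply Rle_trans with (2 * INR r * (3 * (B / INR r)))%R.
  - apply Rmult_le_compat; try apply Cmod_ge_0; lra.
  - apply Req_le; field; lra. }
cbv beta in HN1; rewrite Cmod_div, Cmod_1 in HN1 by exact H0.
assert (Hlow : (/ (6 * B) <= / Cmod (s r * (exp2pi (y * s r) - 1)))%R).
{ apply Rinv_le_contravar; [now apply Cmod_gt_0|exact Hprod]. }
unfold Rdiv in HN1; lra.
Qed.

Lemma Re_inv_near_minus_1 (v : C) : (Cmod (v + 1) <= 1 / 4)%R -> (Re (/ v) <= - (2 / 5))%R.
Proof.
intros Hv.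
assert (H1 := re_le_Cmod (v + 1)); assert (H2 := im_le_Cmod (v + 1)).
destruct v as [a b]; unfold Re, Im in *; simpl in *.
assert (Ha : (Rabs (a + 1) <= 1 / 4)%R) by lra.
assert (Hb : (Rabs (b + 0) <= 1 / 4)%R) by lra.
apply Rabs_le_between in Ha; apply Rabs_le_between in Hb.
assert (Hd : (0 < a * (a * 1) + b * (b * 1))%R) by nra.
apply Rmult_le_reg_r with (a * (a * 1) + b * (b * 1))%R; [exact Hd|].
unfold Rdiv at 1; rewrite Rmult_assoc, Rinv_l, Rmult_1_r by lra.
nra.
Qed.

(** The exponential tends to 0 and [s r] is close to [r], so the terms behave like [- 1 / r], and
    the harmonic series diverges. *)
Lemma negative_rate_absurd (y c l : C) (s : nat -> C) (N : nat) :
  (Re y < 0)%R ->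
  (forall r, (N <= r)%nat -> (Cmod (s r - NtoC r) <= Cmod c / INR r)%R) ->
  (forall r, (1 <= r)%nat -> s r * (exp2pi (y * s r) - 1) <> 0) ->
  ~ Cser (fun r => 1 / (s r * (exp2pi (y * s r) - 1))) l.
Proof.
intros Hy Hs H0.
assert (HP := PI2_1); assert (Hc := Cmod_ge_0 c); assert (Hy0 := Cmod_ge_0 y).
set (rho := (- Re y)%R).
assert (Hrho : (0 < rho)%R) by (unfold rho; lra).
(* 7 makes the exponential at most [1 / 8], and 18 makes the relative error of the root at most
   [1 / 18]; then [(1 / 18) (9 / 8) + 1 / 8 <= 1 / 4]. *)
destruct (eventually_INR_gt ((7 + Cmod y * Cmod c) / rho + 18 * Cmod c) N) as [Q [HQN [HQ1 HQ]]].
apply (Cser_harmonic_absurd _ l Q (2 / 5)); [lra|]; intros r Hr.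
specialize (HQ r Hr); specialize (Hs r ltac:(lia)); specialize (H0 r ltac:(lia)).
assert (Hr1 : (1 <= INR r)%R) by (apply INR_ge_1; lia).
assert (Hr0 := NtoC_neq_0 r ltac:(lia)).
assert (Hcr : (Cmod c / INR r <= Cmod c)%R).
{ unfold Rdiv; rewrite <- (Rmult_1_r (Cmod c)) at 2; apply Rmult_le_compat_l; [lra|].
  rewrite <- Rinv_1; apply Rinv_le_contravar; lra. }
assert (Hyc : (0 <= Cmod y * Cmod c)%R) by nra.
assert (Hbig1 : (7 + Cmod y * Cmod c <= rho * INR r)%R).
{ assert (H : ((7 + Cmod y * Cmod c) / rho < INR r)%R) by lra.
  apply (Rmult_lt_compat_r rho) in H; [|exact Hrho].
  unfold Rdiv in H; rewrite Rmult_assoc, Rinv_l in H; lra. }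
assert (Hbig2 : (18 * Cmod c <= INR r)%R).
{ assert (0 <= (7 + Cmod y * Cmod c) / rho)%R by (apply Rdiv_le_0_compat; lra); lra. }
assert (HE : (Cmod (exp2pi (y * s r)) <= 1 / 8)%R).
{ unfold exp2pi; rewrite Cmod_Cexp, re_scal_l.
  assert (HRe : (Re (y * s r) <= - 7)%R).
  { replace (y * s r) with (y * NtoC r + y * (s r - NtoC r)) by ring.
    change (Re (y * NtoC r + y * (s r - NtoC r)))
      with (Re (y * NtoC r) + Re (y * (s r - NtoC r)))%R.
    unfold NtoC at 1; rewrite re_scal_r.
    assert (H := re_le_Cmod (y * (s r - NtoC r))); rewrite Cmod_mult in H.
    assert (H' := Rle_abs (Re (y * (s r - NtoC r)))).
    assert (Cmod y * Cmod (s r - NtoC r) <= Cmod y * Cmod c)%R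
      by (apply Rmult_le_compat_l; lra).
    unfold rho in *; lra. }
  set (x := (2 * PI * Re (y * s r))%R).
  assert (Hx : (x <= - 7)%R) by (unfold x; nra).
  assert (H1 := exp_ineq1_le (- x)).
  assert (H2 : (exp x * exp (- x) = 1)%R) by (rewrite <- exp_plus, Rplus_opp_r; apply exp_0).
  assert (H3 := exp_pos x); nra. }
set (e := exp2pi (y * s r)) in *.
assert (Hfac : s r <> 0 /\ e - 1 <> 0).
{ split; intros E; apply H0; rewrite E; ring. }
destruct Hfac as [Hs0 He0].
replace (1 / (s r * (e - 1))) with (/ (s r / NtoC r * (e - 1)) * RtoC (/ INR r)).
2:{ rewrite RtoC_inv by lra; fold (NtoC r); field; auto. }
rewrite re_scal_r.
replace (- (2 / 5 / INR r))%R with (- (2 / 5) * / INR r)%R by (unfold Rdiv; ring).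
apply Rmult_le_compat_r; [left; apply Rinv_0_lt_compat; lra|].
apply Re_inv_near_minus_1.
replace (s r / NtoC r * (e - 1) + 1) with ((s r - NtoC r) / NtoC r * (e - 1) + e)
  by (field; exact Hr0).
eapply Rle_trans; [apply Cmod_triangle|].
rewrite Cmod_mult, Cmod_div, Cmod_NtoC by exact Hr0.
assert (H1 : (Cmod (s r - NtoC r) / INR r <= 1 / 18)%R).
{ apply Rmult_le_reg_r with (INR r); [lra|].
  unfold Rdiv at 1; rewrite Rmult_assoc, Rinv_l by lra; lra. }
assert (H2 : (Cmod (e - 1) <= 9 / 8)%R).
{ eapply Rle_trans; [apply Cmod_minus_le|]; rewrite Cmod_1; lra. }
assert (H3 := Cmod_ge_0 (e - 1)).
assert (H4 : (0 <= Cmod (s r - NtoC r) / INR r)%R)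
  by (apply Rdiv_le_0_compat; [apply Cmod_ge_0|lra]).
nra.
Qed.

(** The row [n = 1] decides: its radicand is [r² + c] with [c = x² + w²], and the signs [Re y < 0]
    and [Re y = 0] both contradict its convergence. *)
Lemma f_converges_Re_pos (sq : C -> C) (x y w : C) :
  sqrt_determination sq -> f_converges sq x y w -> (0 < Re y)%R.
Proof.
intros Hsq [H0 [Hrow _]].
specialize (Hrow 1%nat ltac:(lia)); apply ex_Cseries1_Cser in Hrow.
set (c := x * x + w * w).
destruct (sqrt_determination_near_nat sq c Hsq) as [N [_ HN]].
set (s := fun r => sq (radicand x w 1 r)).
assert (Es : forall r, s r = sq (NtoC r * NtoC r + c)).
{ intros r; unfold s, radicand, Csq, c, NtoC; f_equal; simpl; ring. }
assert (Ed : forall r, f_denom sq x y w 1 r = s r * (exp2pi (y * s r) - 1)).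
{ intros r; unfold f_denom, exp2pi, s; f_equal; f_equal; f_equal; ring. }
assert (Hs : forall r, (N <= r)%nat -> (Cmod (s r - NtoC r) <= Cmod c / INR r)%R).
{ intros r Hr; rewrite Es; now apply HN. }
assert (Hd : forall r, (1 <= r)%nat -> s r * (exp2pi (y * s r) - 1) <> 0).
{ intros r Hr; rewrite <- Ed; now apply H0. }
assert (Hser : Cser (fun r => 1 / (s r * (exp2pi (y * s r) - 1)))
  (Cseries1 (fun r => 1 / f_denom sq x y w 1 r))).
{ apply (Cser_ext (fun r => 1 / f_denom sq x y w 1 r)); [|exact Hrow]; intros r Hr; now rewrite Ed. }
destruct (Rtotal_order (Re y) 0) as [H|[H|H]]; [exfalso|exfalso|exact H].
- exact (negative_rate_absurd y c _ s N H Hs Hd Hser).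
- exact (imaginary_rate_absurd y c _ s N H Hs Hd Hser).
Qed.

(** * Decay of the terms of [f] *)

(* The principal root of a positive combination of [x^2] and [1] lies in the
   cone spanned by [x] and [1]. *)
Lemma sqrt_cone (x s : C) (n r : R) : (0 < Re x)%R -> (0 <= Re s)%R -> (0 < n)%R -> (0 < r)%R ->
  s * s = x * x * (RtoC n * RtoC n) + RtoC r * RtoC r ->
  exists lam mu, (0 <= lam)%R /\ (0 <= mu)%R /\ s = RtoC lam * x + RtoC mu.
Proof.
intros Hx Hs Hn Hr E.
destruct x as [a b], s as [u v].
assert (E1 := f_equal Re E); assert (E2 := f_equal Im E); clear E.
unfold Re, Im in *; simpl in *.
assert (E1' : (u * u - v * v = (a * a - b * b) * (n * n) + r * r)%R) by (ring_simplify in E1; ring_simplify; lra).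
assert (E2' : (u * v = a * b * (n * n))%R) by (ring_simplify in E2; ring_simplify; lra).
clear E1 E2.
assert (Hnn : (0 < n * n)%R) by nra.
assert (Hu : (0 < u)%R).
{ destruct Hs as [H|H]; [exact H|exfalso]; subst u.
  assert (Hb : b = 0%R).
  { assert (H : (a * b * (n * n) = 0)%R) by lra.
    apply Rmult_integral in H; destruct H as [H|H]; [|lra].
    apply Rmult_integral in H; destruct H; lra. }
  subst b; nra. }
(* Imaginary parts ask for [lam * b = v], and [u * v = a * b * (n * n)] suggests this [lam]; real
   parts then give [mu]. *)
exists (a * (n * n) / u)%R, (u - a * (n * n) / u * a)%R.
assert (Hl : (0 <= a * (n * n) / u)%R) by (apply Rdiv_le_0_compat; nra).
split; [exact Hl|split].
- assert (Hv : v = (a * b * (n * n) / u)%R) by (rewrite <- E2'; field; lra).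
  (* This identity yields the sign of [u² - a² n²], which is that of [mu]. *)
  assert (Hprod : ((u * u - a * a * (n * n)) * (u * u + b * b * (n * n)) = u * u * (r * r))%R).
  { assert (H : (v * u = a * b * (n * n))%R) by lra.
    assert (H2 : (v * v * (u * u) = a * b * (n * n) * (a * b * (n * n)))%R)
      by (rewrite <- H; ring).
    nra. }
  assert (Hpos : (0 < u * u + b * b * (n * n))%R) by nra.
  assert (Hge : (0 <= u * u - a * a * (n * n))%R).
  { apply Rmult_le_reg_r with (u * u + b * b * (n * n))%R; [exact Hpos|].
    rewrite Hprod, Rmult_0_l; nra. }
  replace (u - a * (n * n) / u * a)%R with ((u * u - a * a * (n * n)) / u)%R by (field; lra).
  now apply Rdiv_le_0_compat.
- apply injective_projections; simpl; [ring|].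
  ring_simplify.
  replace v with (a * b * (n * n) / u)%R by (rewrite <- E2'; field; lra).
  field; lra.
Qed.

(** The real part of the product with [y] is linear on the cone, so it is enough to compare it with
    the modulus on the generators [x] and [1]; the generator [x] is where [Re (x * y)] enters. *)
Lemma sqrt_cone_Re (x y s : C) (n r : R) :
  (0 < Re x)%R -> (0 < Re y)%R -> (0 < Re (x * y))%R -> (0 <= Re s)%R ->
  (0 < n)%R -> (0 < r)%R -> s * s = x * x * (RtoC n * RtoC n) + RtoC r * RtoC r ->
  (Rmin (Re (x * y) / Cmod x) (Re y) * Cmod s <= Re (y * s))%R.
Proof.
intros Hx Hy Hxy Hs Hn Hr E.
destruct (sqrt_cone x s n r Hx Hs Hn Hr E) as [lam [mu [Hl [Hmu ->]]]].
assert (Hxm : (0 < Cmod x)%R).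
{ assert (H := re_le_Cmod x); assert (H0 := Rle_abs (Re x)); lra. }
set (m := Rmin (Re (x * y) / Cmod x) (Re y)).
assert (Hm1 : (m * Cmod x <= Re (x * y))%R).
{ apply Rle_trans with (Re (x * y) / Cmod x * Cmod x)%R.
  - apply Rmult_le_compat_r; [lra|apply Rmin_l].
  - apply Req_le; field; lra. }
assert (Hm2 : (m <= Re y)%R) by apply Rmin_r.
assert (Hm0 : (0 < m)%R) by (apply Rmin_pos; [now apply Rdiv_lt_0_compat|exact Hy]).
replace (y * (RtoC lam * x + RtoC mu)) with (RtoC lam * (x * y) + RtoC mu * y) by ring.
change (Re (RtoC lam * (x * y) + RtoC mu * y))
  with (Re (RtoC lam * (x * y)) + Re (RtoC mu * y))%R.
rewrite !re_scal_l.
apply Rle_trans with (m * (lam * Cmod x + mu))%R.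
- apply Rmult_le_compat_l; [lra|].
  eapply Rle_trans; [apply Cmod_triangle|].
  rewrite Cmod_mult, !Cmod_R, !Rabs_right by lra; lra.
- nra.
Qed.

(** From [exp X >= (1 + X / 4)^4]. A fourth power of [n + r] is what beats [n² r²]. *)
Lemma exp_minus_1_ge_pow4 (X : R) : (0 <= X)%R ->
  ((X / 4 * (X / 4)) * (X / 4 * (X / 4)) <= exp X - 1)%R.
Proof.
intros HX.
assert (H := exp_ineq1_le (X / 4)).
assert (E : exp X = ((exp (X / 4) * exp (X / 4)) * (exp (X / 4) * exp (X / 4)))%R)
  by (rewrite <- !exp_plus; f_equal; field).
set (q := (X / 4)%R) in *.
assert (Hq : (0 <= q)%R) by (unfold q; lra).
assert (H2 : ((1 + q) * (1 + q) <= exp q * exp q)%R) by (apply Rmult_le_compat; lra).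
assert (H3 : (1 + q * q <= (1 + q) * (1 + q))%R) by nra.
assert (Hqq : (0 <= q * q)%R) by nra.
assert (H4 : ((1 + q * q) * (1 + q * q)
  <= exp q * exp q * (exp q * exp q))%R) by (apply Rmult_le_compat; lra).
rewrite E; nra.
Qed.

(** The root [s] is compared with the principal root [s0] of the radicand without [w²], to which the
    cone estimate applies. Since [(s - s0) (s + s0) = w²] and [Re (s + s0)] is bounded below,
    [s - s0] is bounded, and [Re (y * s)] keeps half of the linear growth of [Re (y * s0)]. *)
Lemma f_term_decay (sq : C -> C) (x y w : C) :
  sqrt_determination sq -> (0 < Re x)%R -> (0 < Re y)%R -> (0 < Re (x * y))%R ->
  (forall n r, (1 <= n)%nat -> (1 <= r)%nat -> f_denom sq x y w n r <> 0) ->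
  exists B, (0 <= B)%R /\ forall n r, (1 <= n)%nat -> (1 <= r)%nat ->
    (Cmod (1 / f_denom sq x y w n r) <= B / ((INR n)² * (INR r)²))%R.
Proof.
intros [Hsq [M HM]] Hx Hy Hxy H0.
destruct (quad_lower x Hx) as [d [Hd HQ]].
assert (Hxm : (0 < Cmod x)%R).
{ assert (H := re_le_Cmod x); assert (H' := Rle_abs (Re x)); lra. }
set (m := Rmin (Re (x * y) / Cmod x) (Re y)).
assert (Hm : (0 < m)%R) by (apply Rmin_pos; [now apply Rdiv_lt_0_compat|exact Hy]).
(* The cone constant with [1] in place of [y], which bounds [Re s0] itself from below. *)
set (m1 := Rmin (Re (x * 1) / Cmod x) (Re 1)).
assert (Hx1 : (0 < Re (x * 1))%R) by (rewrite Cmult_1_r; exact Hx).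
assert (Hre1 : (0 < Re 1)%R) by (simpl; lra).
assert (Hm1 : (0 < m1)%R) by (apply Rmin_pos; [now apply Rdiv_lt_0_compat|exact Hre1]).
set (d1 := sqrt d).
assert (Hd1 : (0 < d1)%R) by now apply sqrt_lt_R0.
assert (Hdd : (d1 * d1 = d)%R) by (apply sqrt_sqrt; lra).
set (W := (Cmod (w * w) / (m1 * d1))%R).
assert (Hm1d1 : (0 < m1 * d1)%R) by nra.
assert (HW : (0 <= W)%R) by (apply Rdiv_le_0_compat; [apply Cmod_ge_0|exact Hm1d1]).
set (de := (m * d1 / 2)%R).
assert (Hmd1 : (0 < m * d1)%R) by nra.
assert (Hde : (0 < de)%R) by (unfold de; lra).
(* The first two summands make the root principal, the third absorbs [y * (s - s0)], and the last
   gives [|s| >= 1]. *)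
destruct (eventually_INR_gt (Rabs M / d + Cmod (w * w) / d + Cmod y * W / de + (1 + W) / d1) 0)
  as [Q [_ [HQ1 HQb]]].
destruct (bounded_of_eventually_bounded
  (fun n r => Cmod (1 / f_denom sq x y w n r) * ((INR n)² * (INR r)²))%R Q
  (256 / ((de * de) * (de * de)))) as [B [HB0 HB]].
- intros n r Hn Hr Hnr.
  specialize (HQb (n + r)%nat Hnr); rewrite plus_INR in HQb.
  assert (Hn1 := INR_ge_1 n Hn); assert (Hr1 := INR_ge_1 r Hr).
  set (t := (INR n + INR r)%R) in *.
  assert (Ht : (2 <= t)%R) by (unfold t; lra).
  assert (G1 : (0 <= Rabs M / d)%R) by (apply Rdiv_le_0_compat; [apply Rabs_pos|lra]).
  assert (G2 : (0 <= Cmod (w * w) / d)%R) by (apply Rdiv_le_0_compat; [apply Cmod_ge_0|lra]).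
  assert (G3 : (0 <= Cmod y * W / de)%R).
  { apply Rdiv_le_0_compat; [apply Rmult_le_pos; [apply Cmod_ge_0|lra]|lra]. }
  assert (G4 : (0 <= (1 + W) / d1)%R) by (apply Rdiv_le_0_compat; lra).
  assert (F1 : (Rabs M + Cmod (w * w) <= d * t)%R).
  { apply Rle_trans with ((Rabs M / d + Cmod (w * w) / d) * d)%R.
    - apply Req_le; field; lra.
    - rewrite (Rmult_comm d); apply Rmult_le_compat_r; lra. }
  assert (F2 : (Cmod y * W <= de * t)%R).
  { apply Rle_trans with (Cmod y * W / de * de)%R.
    - apply Req_le; field; lra.
    - rewrite (Rmult_comm de); apply Rmult_le_compat_r; lra. }
  assert (F3 : (1 + W <= d1 * t)%R).
  { apply Rle_trans with ((1 + W) / d1 * d1)%R.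
    - apply Req_le; field; lra.
    - rewrite (Rmult_comm d1); apply Rmult_le_compat_r; lra. }
  clear HQb G1 G2 G3 G4.
  set (z := x * x * (NtoC n * NtoC n) + NtoC r * NtoC r).
  assert (Hz : (d * (t * t) <= Cmod z)%R) by apply HQ.
  assert (Erad : radicand x w n r = z + w * w) by (unfold radicand, Csq, z; ring).
  assert (Hbig : (M < Cmod (z + w * w))%R).
  { assert (H := Cmod_ge_minus z (w * w)); assert (H' := Rle_abs M).
    assert (H'' : (d * t * 2 <= d * (t * t))%R).
    { replace (d * (t * t))%R with (d * t * t)%R by ring.
      apply Rmult_le_compat_l; nra. }
    assert (0 < d * t)%R by nra.
    lra. }
  set (s0 := Csqrt z).
  assert (Es0 : s0 * s0 = z) by apply Csqrt_determination.
  assert (Hs0 : (0 <= Re s0)%R) by apply Csqrt_Re_nonneg.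
  assert (Hs0m : (d1 * t <= Cmod s0)%R).
  { assert (E : (Cmod s0 * Cmod s0 = Cmod z)%R) by (rewrite <- Cmod_mult, Es0; reflexivity).
    apply Rsqr_incr_0; [|nra|apply Cmod_ge_0].
    unfold Rsqr; rewrite E; nra. }
  set (s := sq (radicand x w n r)).
  assert (Es : s * s = z + w * w) by (unfold s; rewrite Hsq; exact Erad).
  assert (Hs : (0 <= Re s)%R).
  { unfold s; rewrite HM by (rewrite Erad; exact Hbig); apply Csqrt_Re_nonneg. }
  assert (C1 : (m1 * Cmod s0 <= Re s0)%R).
  { assert (H := sqrt_cone_Re x 1 s0 (INR n) (INR r) Hx Hre1 Hx1 Hs0 ltac:(lra) ltac:(lra) Es0).
    rewrite Cmult_1_l in H; exact H. }
  assert (C2 : (m * Cmod s0 <= Re (y * s0))%R).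
  { exact (sqrt_cone_Re x y s0 (INR n) (INR r) Hx Hy Hxy Hs0 ltac:(lra) ltac:(lra) Es0). }
  assert (Hsum : (m1 * d1 <= Cmod (s + s0))%R).
  { eapply Rle_trans; [|apply re_le_Cmod].
    eapply Rle_trans; [|apply Rle_abs].
    change (Re (s + s0)) with (Re s + Re s0)%R.
    assert (m1 * (d1 * t) <= m1 * Cmod s0)%R by (apply Rmult_le_compat_l; lra).
    assert (m1 * d1 * 1 <= m1 * d1 * t)%R by (apply Rmult_le_compat_l; lra).
    lra. }
  assert (Hdiff : (Cmod (s - s0) <= W)%R).
  { assert (E : (s - s0) * (s + s0) = w * w).
    { transitivity (s * s - s0 * s0); [ring|rewrite Es, Es0; ring]. }
    apply (f_equal Cmod) in E; rewrite Cmod_mult in E.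
    apply Rmult_le_reg_r with (m1 * d1)%R; [exact Hm1d1|].
    unfold W; replace (Cmod (w * w) / (m1 * d1) * (m1 * d1))%R with (Cmod (w * w)) by (field; lra).
    rewrite <- E; apply Rmult_le_compat_l; [apply Cmod_ge_0|exact Hsum]. }
  assert (Hsm : (1 <= Cmod s)%R).
  { assert (H := Cmod_ge_minus s0 (s - s0)).
    replace (s0 + (s - s0)) with s in H by ring; lra. }
  assert (HRe : (de * t <= Re (y * s))%R).
  { replace (y * s) with (y * s0 + y * (s - s0)) by ring.
    change (Re (y * s0 + y * (s - s0))) with (Re (y * s0) + Re (y * (s - s0)))%R.
    assert (H := re_le_Cmod (y * (s - s0))); rewrite Cmod_mult in H.
    apply Rabs_le_between in H.
    assert (Cmod y * Cmod (s - s0) <= Cmod y * W)%R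
      by (apply Rmult_le_compat_l; [apply Cmod_ge_0|lra]).
    assert (m * (d1 * t) <= m * Cmod s0)%R by (apply Rmult_le_compat_l; lra).
    replace (de * t)%R with (m * (d1 * t) - de * t)%R by (unfold de; field).
    lra. }
  set (X := (de * t)%R) in *.
  assert (HX : (0 < X)%R) by (unfold X; nra).
  set (q := (X / 4 * (X / 4) * (X / 4 * (X / 4)))%R).
  assert (Hq : (0 < q)%R) by (unfold q; repeat apply Rmult_lt_0_compat; lra).
  assert (HE : (q <= Cmod (Cexp (RtoC (2 * PI) * y * s) - 1))%R).
  { assert (H := Cmod_ge_minus (Cexp (RtoC (2 * PI) * y * s)) (- (1))).
    rewrite Cmod_opp, Cmod_1, Cmod_Cexp in H.
    replace (RtoC (2 * PI) * y * s) with (RtoC (2 * PI) * (y * s)) in * by ring.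
    rewrite re_scal_l in H.
    assert (HP := PI2_1).
    assert (Hexp : (exp X <= exp (2 * PI * Re (y * s)))%R).
    { destruct (Rle_lt_or_eq_dec X (2 * PI * Re (y * s))) as [G|G].
      - apply Rle_trans with (1 * Re (y * s))%R; [lra|].
        apply Rmult_le_compat_r; lra.
      - left; now apply exp_increasing.
      - rewrite G; lra. }
    assert (H4 := exp_minus_1_ge_pow4 X ltac:(lra)); fold q in H4.
    unfold Cminus; lra. }
  assert (Hden : (q <= Cmod (f_denom sq x y w n r))%R).
  { unfold f_denom; fold s; rewrite Cmod_mult.
    apply Rle_trans with (1 * q)%R; [lra|].
    apply Rmult_le_compat; lra. }
  rewrite Cmod_div, Cmod_1 by (now apply H0).
  apply Rle_trans with (/ q * (t * t * (t * t)))%R.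
  + unfold Rdiv; rewrite Rmult_1_l; apply Rmult_le_compat.
    * left; apply Rinv_0_lt_compat; lra.
    * apply Rmult_le_pos; apply Rle_0_sqr.
    * now apply Rinv_le_contravar.
    * apply Rmult_le_compat; try apply Rle_0_sqr; unfold Rsqr, t; nra.
  + apply Req_le; unfold q, X; field; lra.
- exists B; split; [exact HB0|]; intros n r Hn Hr.
  assert (Hn1 := INR_ge_1 n Hn); assert (Hr1 := INR_ge_1 r Hr).
  assert (H : (0 < (INR n)² * (INR r)²)%R) by (unfold Rsqr; apply Rmult_lt_0_compat; nra).
  apply Rmult_le_reg_r with ((INR n)² * (INR r)²)%R; [exact H|].
  unfold Rdiv; rewrite Rmult_assoc, Rinv_l, Rmult_1_r by lra.
  now apply HB.
Qed.

Lemma f_swap (sq : C -> C) (x y w : C) :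
  sqrt_determination sq -> (0 < Re x)%R -> (0 < Re (x * y))%R -> f_converges sq x y w ->
  (forall r, (1 <= r)%nat -> exists l, Cser (fun n => 1 / f_denom sq x y w n r) l) /\
  (forall v, (forall r, (1 <= r)%nat -> Cser (fun n => 1 / f_denom sq x y w n r) (v r)) ->
     Cser v (f sq x y w)).
Proof.
intros Hsq Hx Hxy Hc.
assert (Hy := f_converges_Re_pos sq x y w Hsq Hc).
destruct Hc as [H0 [Hrow Hout]].
destruct (f_term_decay sq x y w Hsq Hx Hy Hxy H0) as [B [HB0 HB]].
split.
- intros r Hr; apply (Cser_abs _ B HB0); intros n Hn.
  eapply Rle_trans; [now apply HB|].
  assert (Hn1 := INR_ge_1 n Hn); assert (Hr1 := INR_ge_1 r Hr).
  unfold Rdiv; apply Rmult_le_compat_l; [exact HB0|].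
  assert (1 <= (INR r)²)%R by (unfold Rsqr; nra).
  assert (1 <= (INR n)²)%R by (unfold Rsqr; nra).
  apply Rinv_le_contravar; nra.
- intros v Hv.
  apply (Cser_Fubini (fun n r => 1 / f_denom sq x y w n r)
    (fun n => Cseries1 (fun r => 1 / f_denom sq x y w n r)) v _ B HB0 HB).
  + intros n Hn; apply ex_Cseries1_Cser, Hrow, Hn.
  + exact Hv.
  + apply ex_Cseries1_Cser; exact Hout.
Qed.

(** * The eight-term identity *)

Lemma Cser_Cseries1_ex (a : nat -> C) : (exists l, Cser a l) -> Cser a (Cseries1 a).
Proof. intros [l H]; now rewrite (Cser_Cseries1 a l H). Qed.

Lemma f_denom_exp2pi (sq : C -> C) (x y w : C) (n r : nat) :
  f_denom sq x y w n r
  = sq (radicand x w n r) * (exp2pi (y * sq (radicand x w n r)) - 1).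
Proof. unfold f_denom, exp2pi; f_equal; f_equal; f_equal; ring. Qed.

Lemma f_denom_sqrt_neq_0 (sq : C -> C) (x y w : C) (n r : nat) :
  f_denom sq x y w n r <> 0 -> sq (radicand x w n r) <> 0.
Proof. intros H E; apply H; unfold f_denom; rewrite E; ring. Qed.

Lemma radicand_neq_0 (sq : C -> C) (x y w : C) (n r : nat) :
  sqrt_determination sq -> f_denom sq x y w n r <> 0 -> radicand x w n r <> 0.
Proof.
intros [Hsq _] H; rewrite <- (Hsq (radicand x w n r)).
apply f_denom_sqrt_neq_0 in H; now apply Cmult_neq_0.
Qed.

(** The factor [ga] clears the denominators of [y], so that the forms [P] coming from different [f]
    become equal. The term [k = 0] is kept apart; the sum over positive [k] is doubled to account
    for [- k]. *)
Lemma f_term_partial_fractions (sq : C -> C) (x y w ga : C) (n r : nat) (P : nat -> C) :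
  sqrt_determination sq -> f_denom sq x y w n r <> 0 -> y <> 0 -> ga <> 0 ->
  (forall k, P k = ga * ga * (y * y * radicand x w n r + NtoC k * NtoC k)) ->
  (forall k, P k <> 0) /\ Cser (fun k => / P k) (Cseries1 (fun k => / P k)) /\
  1 / f_denom sq x y w n r
  = y * ga * ga / RtoC (2 * PI) * (/ P 0%nat + 2 * Cseries1 (fun k => / P k))
    - / (2 * sq (radicand x w n r)).
Proof.
intros Hsq Hd Hy Hga HP.
assert (Hs0 := f_denom_sqrt_neq_0 sq x y w n r Hd).
rewrite f_denom_exp2pi in *.
rewrite <- (proj1 Hsq (radicand x w n r)) in HP.
set (s := sq (radicand x w n r)) in *.
set (z := y * s) in *.
assert (Hz : exp2pi z <> 1) by (intros E; apply Hd; rewrite E; ring).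
assert (Hz0 : z <> 0) by now apply Cmult_neq_0.
assert (HPI := PI_RGT_0).
assert (HPC : RtoC PI <> 0) by (apply RtoC_neq_0; lra).
assert (HP' : forall k, P k = ga * ga * (z * z + NtoC k * NtoC k)).
{ intros k; rewrite HP; unfold z; ring. }
assert (Hk : forall k, z * z + NtoC k * NtoC k <> 0) by (intros k; now apply exp2pi_neq_1_sqr).
assert (Hser : Cser (fun k => / P k)
  (/ (2 * z * (ga * ga)) * (RtoC PI * ccoth z - 1 / z))).
{ eapply Cser_ext; [|apply Cser_scal, (ccoth_partial_fractions z Hz)].
  intros k _; cbv beta; rewrite HP'; specialize (Hk k); field; auto. }
split; [|split].
- intros k; rewrite HP'; repeat apply Cmult_neq_0; auto.
- rewrite (Cser_Cseries1 _ _ Hser); exact Hser.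
- rewrite (Cser_Cseries1 _ _ Hser), HP'.
  assert (He : exp2pi z - 1 <> 0) by now apply Cminus_eq_contra.
  unfold ccoth; rewrite RtoC_mult.
  replace (z * z + NtoC 0 * NtoC 0) with (z * z) by (unfold NtoC; simpl; ring).
  assert (Ez : y = z / s) by (unfold z; field; exact Hs0).
  rewrite Ez; field; repeat split; auto.
Qed.

Lemma Re_inv_pos (z : C) : (0 < Re (/ z))%R -> z <> 0 -> (0 < Re z)%R.
Proof.
intros H Hz.
assert (Hm : (0 < Re z * Re z + Im z * Im z)%R).
{ assert (H1 := Cmod2_alt z); assert (H2 := proj1 (Cmod_gt_0 z) Hz); nra. }
replace (Re z) with (Re (/ z) * (Re z * Re z + Im z * Im z))%R.
- now apply Rmult_lt_0_compat.
- unfold Re, Im in *; simpl; field; lra.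
Qed.

Lemma order_defect_series (al c : C) : (0 < Re al)%R ->
  (forall n r, (1 <= n)%nat -> (1 <= r)%nat ->
     al * al * (NtoC n * NtoC n) + NtoC r * NtoC r + c <> 0) ->
  exists kap,
  (forall r, (1 <= r)%nat ->
     Cser (fun n => / (al * al * (NtoC n * NtoC n) + NtoC r * NtoC r + c)
                    - / (al * al * (NtoC r * NtoC r) + NtoC n * NtoC n + c)) (kap r)) /\
  Cser kap (- (RtoC PI / (2 * al)) * Cln al).
Proof.
intros Hre H0.
set (h := fun n r => / (al * al * (NtoC n * NtoC n) + NtoC r * NtoC r + c)).
exists (fun r => Cseries1 (fun n => h n r - h r n)).
assert (H : forall r, (1 <= r)%nat ->
  Cser (fun n => h n r - h r n) (Cseries1 (fun n => h n r - h r n))).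
{ intros r Hr; apply Cser_Cseries1_ex; exact (inv_quad_summable al c r Hre Hr H0). }
split; [exact H|].
exact (Cser_order_defect al c _ Hre H0 H).
Qed.

Lemma f_rows (sq : C -> C) (x y w : C) : f_converges sq x y w ->
  exists v, (forall n, (1 <= n)%nat -> Cser (fun r => 1 / f_denom sq x y w n r) (v n)) /\
    Cser v (f sq x y w).
Proof.
intros [_ [Hrow Hout]].
exists (fun n => Cseries1 (fun r => 1 / f_denom sq x y w n r)); split.
- intros n Hn; apply ex_Cseries1_Cser, Hrow, Hn.
- apply ex_Cseries1_Cser; exact Hout.
Qed.

(** Provides the series with [r] as outer index, as on the right-hand side. *)
Lemma f_columns (sq : C -> C) (x y w : C) :
  sqrt_determination sq -> (0 < Re x)%R -> (0 < Re (x * y))%R -> f_converges sq x y w ->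
  exists v, (forall r, (1 <= r)%nat -> Cser (fun n => 1 / f_denom sq x y w n r) (v r)) /\
    Cser v (f sq x y w).
Proof.
intros Hsq Hx Hxy Hc.
destruct (f_swap sq x y w Hsq Hx Hxy Hc) as [Hcol Hout].
assert (Hv : forall r, (1 <= r)%nat -> Cser (fun n => 1 / f_denom sq x y w n r)
  (Cseries1 (fun n => 1 / f_denom sq x y w n r))).
{ intros r Hr; now apply Cser_Cseries1_ex, Hcol. }
eexists; split; [exact Hv|now apply Hout].
Qed.

Theorem theorem1 (sq : C -> C) (x1 x2 w : C)
  (Hsq : sqrt_determination sq)
  (Hx1 : x1 <> 0) (Hx2 : x2 <> 0)
  (Hs1 : sqrt_scales sq x1 x2 (w * / x1))
  (Hs2 : sqrt_scales sq x2 x1 (w * / x2))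
  (Hc1 : f_converges sq x1 (/ x2) w)
  (Hc2 : f_converges sq x2 (/ x1) w)
  (Hc3 : f_converges sq x1 (/ x1 * / x2) w)
  (Hc4 : f_converges sq x2 x1 (w * / x1))
  (Hc5 : f_converges sq x1 x2 (w * / x2))
  (Hc6 : f_converges sq x2 (/ x1 * / x2) w)
  (Hc7 : f_converges sq x1 (x2 * / x1) (w * / x2))
  (Hc8 : f_converges sq x2 (x1 * / x2) (w * / x1))
  (Hc9 : ex_Cdseries (rhs_term sq x1 x2 w)) :
  x1 * f sq x1 (/ x2) w
  - x2 * f sq x2 (/ x1) w
  - f sq x1 (/ x1 * / x2) w
  + x2 * f sq x2 x1 (w * / x1)
  - x1 * f sq x1 x2 (w * / x2)
  + f sq x2 (/ x1 * / x2) w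
  + f sq x1 (x2 * / x1) (w * / x2)
  - f sq x2 (x1 * / x2) (w * / x1)
  = 1 / 4 * (x1 - 1 / x1) * Cln x2
    - 1 / 4 * (x2 - 1 / x2) * Cln x1
    + 1 / 2 * Cdseries (rhs_term sq x1 x2 w).
Proof.
(* The half-planes are read off the second arguments [x1], [x2], [x2 / x1], [x1 / x2] and
   [1 / (x1 x2)]. *)
assert (R1 := f_converges_Re_pos _ _ _ _ Hsq Hc4).
assert (R2 := f_converges_Re_pos _ _ _ _ Hsq Hc5).
assert (R21 := f_converges_Re_pos _ _ _ _ Hsq Hc7).
assert (R12 := f_converges_Re_pos _ _ _ _ Hsq Hc8).
assert (Rp : (0 < Re (x1 * x2))%R).
{ apply Re_inv_pos; [|now apply Cmult_neq_0].
  replace (/ (x1 * x2)) with (/ x1 * / x2) by (field; auto).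
  exact (f_converges_Re_pos _ _ _ _ Hsq Hc3). }
assert (Hi1 : / x1 <> 0) by (intros E; apply C1_nz; rewrite <- (Cinv_r x1 Hx1), E; ring).
assert (Hi2 : / x2 <> 0) by (intros E; apply C1_nz; rewrite <- (Cinv_r x2 Hx2), E; ring).
assert (Hi12 : / x1 * / x2 <> 0) by now apply Cmult_neq_0.
assert (H12 : x1 * x2 <> 0) by now apply Cmult_neq_0.
assert (Hq21 : x2 * / x1 <> 0) by now apply Cmult_neq_0.
assert (Hq12 : x1 * / x2 <> 0) by now apply Cmult_neq_0.
assert (H1n : RtoC 1 <> 0) by exact C1_nz.
(* Series 1, 2, 4, 5 are taken by columns. Series 3, 6, 7, 8 stay in rows, with their outer index
   renamed [r]: in this way the quadratic forms match for each fixed [r]. *)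
destruct (f_columns _ _ _ _ Hsq R1 R12 Hc1) as [v1 [Hv1 Hf1]].
destruct (f_columns _ _ _ _ Hsq R2 R21 Hc2) as [v2 [Hv2 Hf2]].
destruct (f_rows _ _ _ _ Hc3) as [v3 [Hv3 Hf3]].
destruct (f_columns _ _ _ _ Hsq R2 ltac:(rewrite Cmult_comm; exact Rp) Hc4) as [v4 [Hv4 Hf4]].
destruct (f_columns _ _ _ _ Hsq R1 Rp Hc5) as [v5 [Hv5 Hf5]].
destruct (f_rows _ _ _ _ Hc6) as [v6 [Hv6 Hf6]].
destruct (f_rows _ _ _ _ Hc7) as [v7 [Hv7 Hf7]].
destruct (f_rows _ _ _ _ Hc8) as [v8 [Hv8 Hf8]].
destruct Hc9 as [Hrow9 Hout9].
apply ex_Cseries1_Cser in Hout9.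
assert (N1 : forall n r, (1 <= n)%nat -> (1 <= r)%nat ->
  x1 * x1 * (NtoC n * NtoC n) + NtoC r * NtoC r + w * w <> 0).
{ intros n r Hn Hr; exact (radicand_neq_0 _ _ _ _ n r Hsq (proj1 Hc1 n r Hn Hr)). }
assert (N2 : forall n r, (1 <= n)%nat -> (1 <= r)%nat ->
  x2 * x2 * (NtoC n * NtoC n) + NtoC r * NtoC r + w * w <> 0).
{ intros n r Hn Hr; exact (radicand_neq_0 _ _ _ _ n r Hsq (proj1 Hc2 n r Hn Hr)). }
assert (N3 : forall n r, (1 <= n)%nat -> (1 <= r)%nat ->
  x2 * x2 * (NtoC n * NtoC n) + NtoC r * NtoC r + w * / x1 * (w * / x1) <> 0).
{ intros n r Hn Hr; exact (radicand_neq_0 _ _ _ _ n r Hsq (proj1 Hc4 n r Hn Hr)). }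
assert (N4 : forall n r, (1 <= n)%nat -> (1 <= r)%nat ->
  x1 * x1 * (NtoC n * NtoC n) + NtoC r * NtoC r + w * / x2 * (w * / x2) <> 0).
{ intros n r Hn Hr; exact (radicand_neq_0 _ _ _ _ n r Hsq (proj1 Hc5 n r Hn Hr)). }
destruct (order_defect_series x1 (w * w) R1 N1) as [k1 [Hk1 HK1]].
destruct (order_defect_series x2 (w * w) R2 N2) as [k2 [Hk2 HK2]].
destruct (order_defect_series x2 (w * / x1 * (w * / x1)) R2 N3) as [k3 [Hk3 HK3]].
destruct (order_defect_series x1 (w * / x2 * (w * / x2)) R1 N4) as [k4 [Hk4 HK4]].
assert (HPI := PI_RGT_0).
assert (HPC : RtoC (2 * PI) <> 0) by (apply RtoC_neq_0; lra).
set (Z := fun r => x1 * v1 r - x2 * v2 r - v3 r + x2 * v4 r - x1 * v5 r + v6 r + v7 r - v8 r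
   - 1 / 2 * Cseries1 (rhs_term sq x1 x2 w r)).
assert (HZ : Cser Z (x1 * f sq x1 (/ x2) w - x2 * f sq x2 (/ x1) w - f sq x1 (/ x1 * / x2) w
  + x2 * f sq x2 x1 (w * / x1) - x1 * f sq x1 x2 (w * / x2) + f sq x2 (/ x1 * / x2) w
  + f sq x1 (x2 * / x1) (w * / x2) - f sq x2 (x1 * / x2) (w * / x1)
  - 1 / 2 * Cdseries (rhs_term sq x1 x2 w))).
{ unfold Z.
  repeat first [apply Cser_minus | apply Cser_plus | apply Cser_scal]; assumption. }
assert (Hrow : forall r, (1 <= r)%nat ->
  Z r = x1 * x2 / RtoC (2 * PI)
    * (k1 r - k2 r + / (x1 * x1) * k3 r - / (x2 * x2) * k4 r)).
{ intros r Hr.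
  (* The part of each form that depends on the fixed [r]. Series 1 and 2 share [cA], 3 and 4 [cB], 5
     and 6 [cC], 7 and 8 [cD], each time with [n] and [k] exchanged. *)
  set (cA := NtoC r * NtoC r + w * w).
  set (cD := x1 * x1 * (x2 * x2) * (NtoC r * NtoC r) + w * w).
  set (cB := x1 * x1 * (NtoC r * NtoC r) + w * w).
  set (cC := x2 * x2 * (NtoC r * NtoC r) + w * w).
  set (P := fun al be c n k => al * al * (NtoC n * NtoC n) + be * be * (NtoC k * NtoC k) + c).
  assert (T1 : forall n, (1 <= n)%nat -> _) by (intros n Hn;
    exact (f_term_partial_fractions sq x1 (/ x2) w x2 n r (fun k => P x1 x2 cA n k) Hsq
      (proj1 Hc1 n r Hn Hr) Hi2 Hx2
      ltac:(intros k; unfold P, cA, radicand, Csq; field; auto))).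
  assert (T2 : forall n, (1 <= n)%nat -> _) by (intros n Hn;
    exact (f_term_partial_fractions sq x2 (/ x1) w x1 n r (fun k => P x1 x2 cA k n) Hsq
      (proj1 Hc2 n r Hn Hr) Hi1 Hx1
      ltac:(intros k; unfold P, cA, radicand, Csq; field; auto))).
  assert (T3 : forall n, (1 <= n)%nat -> _) by (intros n Hn;
    exact (f_term_partial_fractions sq x1 (/ x1 * / x2) w (x1 * x2) r n
      (fun k => P (x1 * x2) 1 cB k n) Hsq
      (proj1 Hc3 r n Hr Hn) Hi12 H12
      ltac:(intros k; unfold P, cB, radicand, Csq; field; auto))).
  assert (T4 : forall n, (1 <= n)%nat -> _) by (intros n Hn;
    exact (f_term_partial_fractions sq x2 x1 (w * / x1) 1 n r
      (fun k => P (x1 * x2) 1 cB n k) Hsq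
      (proj1 Hc4 n r Hn Hr) Hx1 H1n
      ltac:(intros k; unfold P, cB, radicand, Csq; field; auto))).
  assert (T5 : forall n, (1 <= n)%nat -> _) by (intros n Hn;
    exact (f_term_partial_fractions sq x1 x2 (w * / x2) 1 n r
      (fun k => P (x1 * x2) 1 cC n k) Hsq
      (proj1 Hc5 n r Hn Hr) Hx2 H1n
      ltac:(intros k; unfold P, cC, radicand, Csq; field; auto))).
  assert (T6 : forall n, (1 <= n)%nat -> _) by (intros n Hn;
    exact (f_term_partial_fractions sq x2 (/ x1 * / x2) w (x1 * x2) r n
      (fun k => P (x1 * x2) 1 cC k n) Hsq
      (proj1 Hc6 r n Hr Hn) Hi12 H12
      ltac:(intros k; unfold P, cC, radicand, Csq; field; auto))).
  assert (T7 : forall n, (1 <= n)%nat -> _) by (intros n Hn;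
    exact (f_term_partial_fractions sq x1 (x2 * / x1) (w * / x2) x1 r n
      (fun k => P x1 x2 cD k n) Hsq
      (proj1 Hc7 r n Hr Hn) Hq21 Hx1
      ltac:(intros k; unfold P, cD, radicand, Csq; field; auto))).
  assert (T8 : forall n, (1 <= n)%nat -> _) by (intros n Hn;
    exact (f_term_partial_fractions sq x2 (x1 * / x2) (w * / x1) x2 r n
      (fun k => P x1 x2 cD n k) Hsq
      (proj1 Hc8 r n Hr Hn) Hq12 Hx2
      ltac:(intros k; unfold P, cD, radicand, Csq; field; auto))).
  set (V := fun al be c n => Cseries1 (fun k => / P al be c n k)) in *.
  set (V' := fun al be c n => Cseries1 (fun k => / P al be c k n)) in *.
  (* [cA] and [cD] are shifts of the same form in [n] and [k]; likewise [cB] and [cC] for [W2]. *)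
  assert (W1 : Cser (fun n => (V x1 x2 cA n - V x1 x2 cD n) - (V' x1 x2 cA n - V' x1 x2 cD n)) 0).
  { apply (Cser_swap_cancel x1 x2 cA cD); [exact Hx2|exact R12| | | | | |].
    - intros n k Hn _; exact (proj1 (T1 n Hn) k).
    - intros n k Hn _; exact (proj1 (T8 n Hn) k).
    - intros n Hn; exact (proj1 (proj2 (T1 n Hn))).
    - intros n Hn; exact (proj1 (proj2 (T8 n Hn))).
    - intros n Hn; exact (proj1 (proj2 (T2 n Hn))).
    - intros n Hn; exact (proj1 (proj2 (T7 n Hn))). }
  assert (W2 : Cser (fun n => (V (x1 * x2) 1 cB n - V (x1 * x2) 1 cC n)
                              - (V' (x1 * x2) 1 cB n - V' (x1 * x2) 1 cC n)) 0).
  { apply (Cser_swap_cancel (x1 * x2) 1 cB cC); [exact H1n| | | | | | |].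
    - replace (x1 * x2 / 1) with (x1 * x2) by (field; auto); exact Rp.
    - intros n k Hn _; exact (proj1 (T4 n Hn) k).
    - intros n k Hn _; exact (proj1 (T5 n Hn) k).
    - intros n Hn; exact (proj1 (proj2 (T4 n Hn))).
    - intros n Hn; exact (proj1 (proj2 (T5 n Hn))).
    - intros n Hn; exact (proj1 (proj2 (T3 n Hn))).
    - intros n Hn; exact (proj1 (proj2 (T6 n Hn))). }
  assert (HL : Cser (fun n => x1 * (1 / f_denom sq x1 (/ x2) w n r)
     - x2 * (1 / f_denom sq x2 (/ x1) w n r)
     - 1 / f_denom sq x1 (/ x1 * / x2) w r n
     + x2 * (1 / f_denom sq x2 x1 (w * / x1) n r)
     - x1 * (1 / f_denom sq x1 x2 (w * / x2) n r)
     + 1 / f_denom sq x2 (/ x1 * / x2) w r n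
     + 1 / f_denom sq x1 (x2 * / x1) (w * / x2) r n
     - 1 / f_denom sq x2 (x1 * / x2) (w * / x1) r n
     - 1 / 2 * rhs_term sq x1 x2 w r n) (Z r)).
  { unfold Z; apply Cser_minus;
      [|apply Cser_scal, ex_Cseries1_Cser, Hrow9, Hr].
    repeat first [apply Cser_minus | apply Cser_plus];
      try apply Cser_scal; auto. }
  apply (Cser_unique _ _ _ HL).
  (* The two zeros are the values of [W1] and [W2], doubled for [k] and [- k]. *)
  replace (k1 r - k2 r + / (x1 * x1) * k3 r - / (x2 * x2) * k4 r)
    with (k1 r - k2 r + / (x1 * x1) * k3 r - / (x2 * x2) * k4 r + 2 * 0 + 2 * 0) by ring.
  eapply Cser_ext; [|apply Cser_scal; apply Cser_plus; [apply Cser_plus; [|apply Cser_scal, W1]|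
    apply Cser_scal, W2]; apply Cser_minus; [apply Cser_plus; [apply Cser_minus|apply Cser_scal]|apply Cser_scal];
    [apply Hk1|apply Hk2|apply Hk3|apply Hk4]; exact Hr].
  intros n Hn; cbv beta.
  destruct (T1 n Hn) as [P1 [_ E1]]; destruct (T2 n Hn) as [P2 [_ E2]].
  destruct (T3 n Hn) as [P3 [_ E3]]; destruct (T4 n Hn) as [P4 [_ E4]].
  destruct (T5 n Hn) as [P5 [_ E5]]; destruct (T6 n Hn) as [P6 [_ E6]].
  destruct (T7 n Hn) as [P7 [_ E7]]; destruct (T8 n Hn) as [P8 [_ E8]].
  assert (S1 := f_denom_sqrt_neq_0 _ _ _ _ n r (proj1 Hc1 n r Hn Hr)).
  assert (S2 := f_denom_sqrt_neq_0 _ _ _ _ n r (proj1 Hc2 n r Hn Hr)).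
  assert (S3 := f_denom_sqrt_neq_0 _ _ _ _ r n (proj1 Hc3 r n Hr Hn)).
  assert (S4 := f_denom_sqrt_neq_0 _ _ _ _ n r (proj1 Hc4 n r Hn Hr)).
  assert (S5 := f_denom_sqrt_neq_0 _ _ _ _ n r (proj1 Hc5 n r Hn Hr)).
  assert (S6 := f_denom_sqrt_neq_0 _ _ _ _ r n (proj1 Hc6 r n Hr Hn)).
  assert (S7 := f_denom_sqrt_neq_0 _ _ _ _ r n (proj1 Hc7 r n Hr Hn)).
  assert (S8 := f_denom_sqrt_neq_0 _ _ _ _ r n (proj1 Hc8 r n Hr Hn)).
  specialize (P1 0%nat); specialize (P2 0%nat); specialize (P3 0%nat); specialize (P4 0%nat).
  specialize (P5 0%nat); specialize (P6 0%nat); specialize (P7 0%nat); specialize (P8 0%nat).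
  assert (Erhs : rhs_term sq x1 x2 w r n
    = x2 / sq (radicand x2 w n r) - x1 / sq (radicand x1 w n r)
      - x2 / sq (radicand x2 (w * / x1) n r) + 1 / sq (radicand x1 w r n)
      - 1 / sq (radicand x2 w r n) + x1 / sq (radicand x1 (w * / x2) n r)
      + 1 / sq (radicand x2 (w * / x1) r n) - 1 / sq (radicand x1 (w * / x2) r n)).
  { unfold rhs_term.
    replace (x2² * x1² * (NtoC n)² + x1² * (NtoC r)² + w²)
      with (x1² * radicand x2 (w * / x1) n r) by (unfold radicand, Csq; field; auto).
    replace ((NtoC n)² + (NtoC r)² * x1² + w²) with (radicand x1 w r n)
      by (unfold radicand, Csq; ring).
    replace ((NtoC n)² + x2² * (NtoC r)² + w²) with (radicand x2 w r n)
      by (unfold radicand, Csq; ring).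
    replace (x1² * x2² * (NtoC n)² + x2² * (NtoC r)² + w²)
      with (x2² * radicand x1 (w * / x2) n r) by (unfold radicand, Csq; field; auto).
    replace (x1² * (NtoC n)² + x1² * x2² * (NtoC r)² + w²)
      with (x1² * radicand x2 (w * / x1) r n) by (unfold radicand, Csq; field; auto).
    replace (x2² * (NtoC n)² + (NtoC r)² * x1² * x2² + w²)
      with (x2² * radicand x1 (w * / x2) r n) by (unfold radicand, Csq; field; auto).
    (* The compatibility of the root pulls [x1] or [x2] out of four of the radicals, which then
       become those of the [f]. *)
    rewrite (Hs1 n r Hn Hr), (Hs1 r n Hr Hn), (Hs2 n r Hn Hr), (Hs2 r n Hr Hn).
    fold (radicand x1 w n r) (radicand x2 w n r).
    field; repeat split; auto. }
  rewrite E1, E2, E3, E4, E5, E6, E7, E8, Erhs.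
  (* The summands of [k1] to [k4] are the terms [k = 0]; a factor [x1²] or [x2²] appears where [w]
     was divided by [x1] or [x2]. *)
  assert (Q1 : / (x1 * x1 * (NtoC n * NtoC n) + NtoC r * NtoC r + w * w) = / P x1 x2 cA n 0%nat).
  { f_equal; unfold P, cA, NtoC; simpl; ring. }
  assert (Q2 : / (x2 * x2 * (NtoC n * NtoC n) + NtoC r * NtoC r + w * w) = / P x1 x2 cA 0%nat n).
  { f_equal; unfold P, cA, NtoC; simpl; ring. }
  assert (Q3 : / (x1 * x1 * (NtoC r * NtoC r) + NtoC n * NtoC n + w * w)
    = / P (x1 * x2) 1 cB 0%nat n).
  { f_equal; unfold P, cB, NtoC; simpl; ring. }
  assert (Q6 : / (x2 * x2 * (NtoC r * NtoC r) + NtoC n * NtoC n + w * w)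
    = / P (x1 * x2) 1 cC 0%nat n).
  { f_equal; unfold P, cC, NtoC; simpl; ring. }
  assert (Q4 : / (x2 * x2 * (NtoC n * NtoC n) + NtoC r * NtoC r + w * / x1 * (w * / x1))
    = x1 * x1 * / P (x1 * x2) 1 cB n 0%nat).
  { assert (H := N3 n r Hn Hr).
    replace (P (x1 * x2) 1 cB n 0%nat) with (x1 * x1 * (x2 * x2 * (NtoC n * NtoC n)
      + NtoC r * NtoC r + w * / x1 * (w * / x1)))
      by (unfold P, cB, NtoC; simpl; field; auto).
    set (q := x2 * x2 * (NtoC n * NtoC n) + NtoC r * NtoC r + w * / x1 * (w * / x1)) in *.
    field; auto. }
  assert (Q8 : / (x2 * x2 * (NtoC r * NtoC r) + NtoC n * NtoC n + w * / x1 * (w * / x1))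
    = x1 * x1 * / P x1 x2 cD n 0%nat).
  { assert (H := N3 r n Hr Hn).
    replace (P x1 x2 cD n 0%nat) with (x1 * x1 * (x2 * x2 * (NtoC r * NtoC r)
      + NtoC n * NtoC n + w * / x1 * (w * / x1)))
      by (unfold P, cD, NtoC; simpl; field; auto).
    set (q := x2 * x2 * (NtoC r * NtoC r) + NtoC n * NtoC n + w * / x1 * (w * / x1)) in *.
    field; auto. }
  assert (Q5 : / (x1 * x1 * (NtoC n * NtoC n) + NtoC r * NtoC r + w * / x2 * (w * / x2))
    = x2 * x2 * / P (x1 * x2) 1 cC n 0%nat).
  { assert (H := N4 n r Hn Hr).
    replace (P (x1 * x2) 1 cC n 0%nat) with (x2 * x2 * (x1 * x1 * (NtoC n * NtoC n)
      + NtoC r * NtoC r + w * / x2 * (w * / x2)))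
      by (unfold P, cC, NtoC; simpl; field; auto).
    set (q := x1 * x1 * (NtoC n * NtoC n) + NtoC r * NtoC r + w * / x2 * (w * / x2)) in *.
    field; auto. }
  assert (Q7 : / (x1 * x1 * (NtoC r * NtoC r) + NtoC n * NtoC n + w * / x2 * (w * / x2))
    = x2 * x2 * / P x1 x2 cD 0%nat n).
  { assert (H := N4 r n Hr Hn).
    replace (P x1 x2 cD 0%nat n) with (x2 * x2 * (x1 * x1 * (NtoC r * NtoC r)
      + NtoC n * NtoC n + w * / x2 * (w * / x2)))
      by (unfold P, cD, NtoC; simpl; field; auto).
    set (q := x1 * x1 * (NtoC r * NtoC r) + NtoC n * NtoC n + w * / x2 * (w * / x2)) in *.
    field; auto. }
  rewrite Q1, Q2, Q3, Q4, Q5, Q6, Q7, Q8.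
  fold (V x1 x2 cA n) (V' x1 x2 cA n) (V x1 x2 cD n) (V' x1 x2 cD n)
    (V (x1 * x2) 1 cB n) (V (x1 * x2) 1 cC n) (V' (x1 * x2) 1 cB n) (V' (x1 * x2) 1 cC n).
  (* With the sums and the terms [k = 0] as free variables, a rational identity remains, in which
     the inverse roots cancel against [rhs_term]. *)
  generalize (V x1 x2 cA n) (V' x1 x2 cA n) (V x1 x2 cD n) (V' x1 x2 cD n)
    (V (x1 * x2) 1 cB n) (V (x1 * x2) 1 cC n) (V' (x1 * x2) 1 cB n) (V' (x1 * x2) 1 cC n).
  generalize (/ P x1 x2 cA n 0%nat) (/ P x1 x2 cA 0%nat n) (/ P (x1 * x2) 1 cB 0%nat n)
    (/ P (x1 * x2) 1 cC 0%nat n) (/ P (x1 * x2) 1 cB n 0%nat) (/ P x1 x2 cD n 0%nat)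
    (/ P (x1 * x2) 1 cC n 0%nat) (/ P x1 x2 cD 0%nat n).
  clearbody cA cB cC cD P; clear - S1 S2 S3 S4 S5 S6 S7 S8 Hx1 Hx2 HPC.
  intros; field; repeat split; auto. }
assert (HZ' : Cser Z (x1 * x2 / RtoC (2 * PI)
  * (- (RtoC PI / (2 * x1)) * Cln x1 - - (RtoC PI / (2 * x2)) * Cln x2
     + / (x1 * x1) * (- (RtoC PI / (2 * x2)) * Cln x2)
     - / (x2 * x2) * (- (RtoC PI / (2 * x1)) * Cln x1)))).
{ apply (Cser_ext (fun r => x1 * x2 / RtoC (2 * PI)
    * (k1 r - k2 r + / (x1 * x1) * k3 r - / (x2 * x2) * k4 r))).
  - intros r Hr; symmetry; now apply Hrow.
  - apply Cser_scal, Cser_minus; [apply Cser_plus; [apply Cser_minus|apply Cser_scal]|apply Cser_scal];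
      assumption. }
assert (E := Cser_unique _ _ _ HZ HZ').
match type of E with ?a - ?b = ?c =>
  match goal with |- ?g = _ => replace g with (c + b) by (rewrite <- E; ring) end end.
rewrite RtoC_mult in *.
assert (HPC' : RtoC PI <> 0) by (apply RtoC_neq_0; lra).
field; repeat split; auto.
Qed.
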